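(* Let $m\in\mathbb N$, let $\mathcal B$ be an arbitrary real $2m\times 2m$ matrix, and let $(G_1(t))_{t\ge0}$ be the $C_0$-semigroup on $\mathbf X_1=(L^1(0,1))^{2m}$ generated by the operator $A_{1,\mathcal B}$, $$A_{1,\mathcal B}\begin{pmatrix}\boldsymbol\upsilon\\ \boldsymbol\varpi\end{pmatrix}=\begin{pmatrix}(-c_j\,\partial_x\upsilon_j)_{j\in J^+}\\ (c_j\,\partial_x\varpi_j)_{j\in J^-}\end{pmatrix},$$ $$D(A_{1,\mathcal B})=\left\{\begin{pmatrix}\boldsymbol\upsilon\\ \boldsymbol\varpi\end{pmatrix}\in (W^{1,1}(0,1))^{2m}:\ \begin{pmatrix}\boldsymbol\upsilon(0)\\ \boldsymbol\varpi(1)\end{pmatrix}=\mathcal B\begin{pmatrix}\boldsymbol\upsilon(1)\\ \boldsymbol\varpi(0)\end{pmatrix}\right\}.$$ Then, for every $p\in[1,\infty)$, the restriction $(G_p(t))_{t\ge0}=(G_1(t)|_{\mathbf X_p})_{t\ge0}$ to $\mathbf X_p=(L^p(0,1))^{2m}$ is a strongly continuous semigroup on $\mathbf X_p$ (in particular, $G_1(t)\mathbf X_p\subset\mathbf X_p$ for all $t\ge0$), and its generator is the part of $A_{1,\mathcal B}$ in $\mathbf X_p$.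
   Context: The index set $\{1,\dots,2m\}$ is the disjoint union of $J^+=\{1,\dots,m^+\}$ and $J^-=\{m^++1,\dots,2m\}$ for some $0\le m^+\le 2m$. Elements of $(L^p(0,1))^{2m}$ are written $(\boldsymbol\upsilon,\boldsymbol\varpi)$ with $\boldsymbol\upsilon=(\upsilon_j)_{j\in J^+}$, $\boldsymbol\varpi=(\varpi_j)_{j\in J^-}$. The functions $c_j:[0,1]\to(0,\infty)$, $j\in J^+\cup J^-$, are given, continuous and (strictly) positive on $[0,1]$. The spaces are real, and $W^{1,1}(0,1)$ is the Sobolev space of functions in $L^1(0,1)$ with weak derivative in $L^1(0,1)$, whose elements have well-defined values at $0$ and $1$. It is a fact that $A_{1,\mathcal B}$ generates a $C_0$-semigroup on $\mathbf X_1$ for every real matrix $\mathcal B$. The part of $A_{1,\mathcal B}$ in $\mathbf X_p\subset\mathbf X_1$ is the restriction of $A_{1,\mathcal B}$ to $\{w\in D(A_{1,\mathcal B})\cap\mathbf X_p:\ A_{1,\mathcal B}w\in\mathbf X_p\}$. *)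

(* Defs.v *)
From HB Require Import structures.
From mathcomp Require Import all_boot all_order all_algebra.
From mathcomp Require Import all_classical all_reals all_analysis.
From mathcomp Require Import measurable_realfun ess_sup_inf.

Set Implicit Arguments.
Unset Strict Implicit.
Unset Printing Implicit Defensive.

Import Order.TTheory GRing.Theory Num.Theory.
Import numFieldNormedType.Exports.

Local Open Scope classical_set_scope.
Local Open Scope ring_scope.

(* [{mfun_ mu, T >-> R}] is the library's quotient of the measurable functions
   by a.e. equality; it is made a vector space here, then the library's L^p
   spaces [LspaceType] are made normed modules. *)
Section ae_classes.
Context d (T : measurableType d) (R : realType).
Variable mu : {measure set T -> \bar R}.

Local Notation M := {mfun T >-> R}.
Local Notation L := {mfun_ mu, T >-> measurableTypeR R}.
Local Open Scope quotient_scope.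

(* The quotient is over measurable functions to [measurableTypeR R], the ring
   structure over those to [R]; both carry the Borel sigma-algebra. *)
Lemma to_mfunR_subproof (f : M) :
  (f : T -> measurableTypeR R) \in @mfun _ _ T (measurableTypeR R).
Proof. by rewrite inE; exact: (measurable_funPT f). Qed.
Definition to_mfunR (f : M) : {mfun T >-> measurableTypeR R} :=
  mfun_Sub (to_mfunR_subproof f).

Lemma of_mfunR_subproof (f : {mfun T >-> measurableTypeR R}) :
  (f : T -> R) \in @mfun _ _ T R.
Proof. by rewrite inE; exact: (measurable_funPT f). Qed.
Definition of_mfunR (f : {mfun T >-> measurableTypeR R}) : M :=
  mfun_Sub (of_mfunR_subproof f).

Definition ae_class (f : M) : L := \pi_L (to_mfunR f).

Lemma ae_classP (f g : M) :
  ae_class f = ae_class g <-> (f : T -> R) = g %[ae mu].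
Proof.
rewrite /ae_class; split=> [/eqmodP/asboolP//|h].
by apply/eqmodP/asboolP.
Qed.

Definition ae_rep (u : L) : M := of_mfunR (repr u).

Lemma ae_repE (u : L) : (ae_rep u : T -> R) = u.
Proof. by []. Qed.

Lemma ae_repK (u : L) : ae_class (ae_rep u) = u.
Proof.
rewrite /ae_class (_ : to_mfunR _ = repr u) ?reprK//.
exact: val_inj.
Qed.

Lemma ae_classK (f : M) : (ae_class f : T -> R) = f %[ae mu].
Proof. exact: (ae_classP (ae_rep (ae_class f)) f).1 (ae_repK _). Qed.

Lemma ae_eqE (u v : L) : u = v <-> (u : T -> R) = v %[ae mu].
Proof.
split=> [->|uv]; first by apply: nearW.
by rewrite -[u]ae_repK -[v]ae_repK; apply/ae_classP.
Qed.

Definition ae_zero : L := ae_class 0.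
Definition ae_opp (u : L) : L := ae_class (- ae_rep u).
Definition ae_add (u v : L) : L := ae_class (ae_rep u + ae_rep v).
Definition ae_scale (a : R) (u : L) : L := ae_class (a *: ae_rep u).

Lemma ae_addP (f g : M) : ae_add (ae_class f) (ae_class g) = ae_class (f + g).
Proof.
apply/ae_classP; have := ae_classK f; have := ae_classK g.
by apply: filterS2 => x gx fx Dx /=; congr (_ + _); [exact: fx|exact: gx].
Qed.

Lemma ae_oppP (f : M) : ae_opp (ae_class f) = ae_class (- f).
Proof.
apply/ae_classP; have := ae_classK f.
by apply: filterS => x fx Dx /=; congr (- _); exact: fx.
Qed.

Lemma ae_scaleP (a : R) (f : M) : ae_scale a (ae_class f) = ae_class (a *: f).
Proof.
apply/ae_classP; have := ae_classK f.
by apply: filterS => x fx Dx /=; congr (_ *: _); exact: fx.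
Qed.

Let addA : associative ae_add.
Proof.
by move=> u v w; rewrite -(ae_repK u) -(ae_repK v) -(ae_repK w) !ae_addP addrA.
Qed.

Let addC : commutative ae_add.
Proof. by move=> u v; rewrite /ae_add addrC. Qed.

Let add0 : left_id ae_zero ae_add.
Proof. by move=> u; rewrite -(ae_repK u) ae_addP add0r. Qed.

Let addN : left_inverse ae_zero ae_opp ae_add.
Proof. by move=> u; rewrite -(ae_repK u) ae_oppP ae_addP addNr. Qed.

HB.instance Definition _ :=
  GRing.isZmodule.Build (@aeEqMfun _ _ R T (measurableTypeR R) mu) addA addC add0 addN.

Let scaleA a b (u : L) : ae_scale a (ae_scale b u) = ae_scale (a * b) u.
Proof. by rewrite -(ae_repK u) !ae_scaleP scalerA. Qed.

Let scale1 : left_id 1 ae_scale.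
Proof. by move=> u; rewrite -(ae_repK u) !ae_scaleP scale1r. Qed.

Let scaleDr : right_distributive ae_scale +%R.
Proof.
move=> a u v; rewrite -(ae_repK u) -(ae_repK v).
by rewrite (ae_addP (ae_rep u) (ae_rep v) : _ + _ = _) !ae_scaleP scalerDr -ae_addP.
Qed.

Let scaleDl (u : L) : {morph ae_scale^~ u : a b / a + b}.
Proof.
move=> a b; rewrite /= -(ae_repK u) !ae_scaleP scalerDl.
by rewrite -ae_addP.
Qed.

HB.instance Definition _ :=
  GRing.Zmodule_isLmodule.Build R (@aeEqMfun _ _ R T (measurableTypeR R) mu)
    scaleA scale1 scaleDr scaleDl.

Lemma ae_addE (u v : L) : (u + v : L) = (fun x => (u x : R) + v x) %[ae mu].
Proof. exact: ae_classK. Qed.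

Lemma ae_scaleE (a : R) (u : L) : (a *: u : L) = (fun x => a * u x) %[ae mu].
Proof. exact: ae_classK. Qed.

End ae_classes.

Section Lspace_normed.
Context d (T : measurableType d) (R : realType).
Variables (mu : {measure set T -> \bar R}) (p : \bar R) (p1 : (1 <= p)%E).

Local Notation M := {mfun T >-> R}.
Local Notation L := {mfun_ mu, T >-> measurableTypeR R}.
Local Notation Lp := (LspaceType mu p1).

Lemma Lnorm_ae_eq (f g : M) : (f : T -> R) = g %[ae mu] ->
  ('N[mu]_p[EFin \o f] = 'N[mu]_p[EFin \o g])%E.
Proof.
have mN r (h : M) : measurable_fun setT (fun x => (`|(EFin \o h) x| `^ r)%E).
  apply: (@measurableT_comp _ _ _ _ _ _ (fun x : \bar R => (x `^ r)%E)) => //.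
    exact: measurable_poweR.
  apply: measurableT_comp => //; apply/measurable_EFinP; exact: measurable_funPT.
move=> fg; rewrite unlock /Lnorm; case: p => [r| |].
- congr (_ `^ _)%E; apply: ge0_ae_eq_integral => //.
  + by move=> x _; exact: poweR_ge0.
  + by move=> x _; exact: poweR_ge0.
  + by apply: filterS fg => x fgx Dx /=; rewrite fgx.
- case: ifP => // _; apply: eq_ess_sup.
  by apply: filterS fg => x fgx /=; rewrite fgx.
- case: ifP => // _; apply: eq_ess_inf.
  by apply: filterS fg => x fgx /=; rewrite fgx.
Qed.

Lemma Lnorm_ae_class (f : M) :
  ('N[mu]_p[EFin \o (ae_class mu f : T -> R)] = 'N[mu]_p[EFin \o f])%E.
Proof. exact: (@Lnorm_ae_eq (ae_rep (ae_class mu f)) f (ae_classK _ _)). Qed.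

Definition Lspace_pred : {pred L} :=
  mem [set u : L | finite_norm mu p (u : T -> R)].

Lemma Lspace_predE (u : L) : u \in Lspace_pred -> (ae_rep u : T -> R) \in Lfun mu p.
Proof.
move=> /set_mem fu; apply/andP; split; first exact: mfunP.
exact: mem_set.
Qed.

Lemma Lspace_pred_class (f : M) :
  (f : T -> R) \in Lfun mu p -> ae_class mu f \in Lspace_pred.
Proof.
move=> /andP[_ /set_mem ff]; apply: mem_set => /=.
by rewrite /finite_norm Lnorm_ae_class.
Qed.

Section Sub.
Context (u : L) (uP : u \in Lspace_pred).
#[local] HB.instance Definition _ :=
  @isFinLebesgue.Build d T R mu p p1 u (set_mem uP).
Definition Lspace_Sub : Lp := [the LspaceType mu p1 of u].
End Sub.

Let Lspace_rect (K : Lp -> Type) :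
  (forall u (Pu : u \in Lspace_pred), K (Lspace_Sub Pu)) -> forall u, K u.
Proof.
move=> Ksub [u [[Pu]]].
have Pu' : u \in Lspace_pred by exact: mem_set.
have -> : Pu = set_mem Pu' by [].
exact: Ksub.
Qed.

Let Lspace_valP u (Pu : u \in Lspace_pred) : Lspace_Sub Pu = u :> L.
Proof. by []. Qed.

HB.instance Definition _ := isSub.Build _ _ Lp Lspace_rect Lspace_valP.
HB.instance Definition _ := [Choice of Lp by <:].

Let Lspace_submod_closed : submod_closed Lspace_pred.
Proof.
have [Lf0 LfP] := Lfun_submod_closed mu p1.
split.
  by apply: Lspace_pred_class; exact: Lf0.
move=> a u v /Lspace_predE fu /Lspace_predE fv.
rewrite -(ae_repK u) -(ae_repK v).
have -> : a *: ae_class mu (ae_rep u) + ae_class mu (ae_rep v) =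
          ae_class mu (a *: ae_rep u + ae_rep v).
  by rewrite -ae_addP -ae_scaleP.
by apply: Lspace_pred_class; exact: LfP.
Qed.

HB.instance Definition _ :=
  GRing.isSubmodClosed.Build R L Lspace_pred Lspace_submod_closed.
HB.instance Definition _ := [SubChoice_isSubLmodule of Lp by <:].

Definition Lspace_norm (u : Lp) : R := fine ('N[mu]_p[EFin \o (u : T -> R)])%E.

Lemma Lspace_norm_fin (u : Lp) :
  ((Lspace_norm u)%:E = 'N[mu]_p[EFin \o (u : T -> R)])%E.
Proof.
rewrite /Lspace_norm fineK// fin_numElt (lt_le_trans ltNy0) ?Lnorm_ge0//=.
exact: Lebesgue_finite.
Qed.

Let mLp (u : Lp) : measurable_fun [set: T] (u : T -> R).
Proof. exact: (measurable_funPT (ae_rep (u : L))). Qed.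

Let normD (u v : Lp) : Lspace_norm (u + v) <= Lspace_norm u + Lspace_norm v.
Proof.
rewrite -lee_fin EFinD !Lspace_norm_fin.
rewrite [leLHS](Lnorm_ae_class (ae_rep (u : L) + ae_rep (v : L))).
by apply: eminkowski.
Qed.

Let normZ (a : R) (u : Lp) : Lspace_norm (a *: u) = `|a| * Lspace_norm u.
Proof.
apply/EFin_inj; rewrite EFinM !Lspace_norm_fin.
rewrite [LHS](Lnorm_ae_class (a *: ae_rep (u : L))).
by rewrite -(LnormZ (Lfun_Sub p1 (Lspace_predE (valP u)))).
Qed.

Let norm0 (u : Lp) : Lspace_norm u = 0 -> u = 0.
Proof.
move=> u0; have {}u0 : ((Lspace_norm u)%:E = 0)%E by rewrite u0.
rewrite Lspace_norm_fin in u0.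
have mu' : measurable_fun setT (EFin \o (u : T -> R)).
  by apply/measurable_EFinP; exact: mLp.
have {}u0 := Lnorm_eq0_eq0 mu' (lt_le_trans lte01 p1) u0.
apply: val_inj; apply/ae_eqE.
have := ae_classK mu 0; move: u0; apply: filterS2 => x /(_ I)[ux] zx Dx.
by rewrite ux (zx Dx).
Qed.

HB.instance Definition _ := Lmodule_isNormed.Build R Lp normD normZ norm0.

End Lspace_normed.

(* A finite power of a normed space carries the sum of the norms of the
   components; the semigroup notions below only depend on its topology. *)
Section ffun_normed.
Context (R : realType) (I : finType) (E : normedModType R).
Implicit Types f g : {ffun I -> E}.

Let nrm f : R := \sum_i `|f i|.

Let nrmD f g : nrm (f + g) <= nrm f + nrm g.
Proof.
rewrite -big_split /=; apply: ler_sum => i _.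
by rewrite ffunE; exact: ler_normD.
Qed.

Let nrmZ a f : nrm (a *: f) = `|a| * nrm f.
Proof. by rewrite /nrm mulr_sumr; apply: eq_bigr => i _; rewrite ffunE normrZ. Qed.

Let nrm0 f : nrm f = 0 -> f = 0.
Proof.
move=> /eqP; rewrite psumr_eq0// => /allP f0; apply/ffunP => i.
by rewrite ffunE; apply/eqP; rewrite -normr_eq0; exact/f0/mem_index_enum.
Qed.

HB.instance Definition _ := Lmodule_isNormed.Build R {ffun I -> E} nrmD nrmZ nrm0.

Lemma ffun_normE f : `|f| = \sum_i `|f i|.
Proof. by []. Qed.

End ffun_normed.

Section semigroups.
Context (R : realType) (E : normedModType R).

(* Only the values [G t] for [t >= 0] are meaningful. *)
Definition C0_semigroup (G : R -> E -> E) : Prop :=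
  [/\ forall t, 0 <= t -> linear (G t) /\ continuous (G t),
      G 0 =1 id,
      forall s t, 0 <= s -> 0 <= t -> G (s + t) =1 G s \o G t
    & forall u, G t u @[t --> 0^'+] --> u].

(* Unbounded operators are represented by their graphs: [(u, v)] is in the
   graph of A when u is in D(A) and A u = v. *)
Definition generator (G : R -> E -> E) : set (E * E) :=
  [set uv | t^-1 *: (G t uv.1 - uv.1) @[t --> 0^'+] --> uv.2].

End semigroups.

(* Graph of the part in Y of an operator A in X, for Y embedded in X by i. *)
Definition part (X Y : Type) (i : Y -> X) (A : set (X * X)) : set (Y * Y) :=
  [set uv | A (i uv.1, i uv.2)].

(* Lebesgue measure on (0,1), seen as a measure on R carried by (0,1), so that
   classes of functions on R modulo mu01-a.e. equality are classes of functions
   on (0,1). *)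
Definition mu01 (R : realType) : set (measurableTypeR R) -> \bar R :=
  mrestr lebesgue_measure (measurable_itv `]0%R, 1%R[).

HB.instance Definition _ (R : realType) := Measure.on (@mu01 R).

Lemma mu01_setT (R : realType) : mu01 [set: R] = 1%E.
Proof.
rewrite /mu01 /mrestr setTI lebesgue_measure_itv/= lte01.
by rewrite oppr0 adde0.
Qed.

Section transport.
Context (R : realType).

Definition test_function (phi : R -> R) : Prop :=
  (forall n x, derivable (phi^`(n))%classic x 1) /\
  exists K : set R, [/\ compact K, K `<=` `]0, 1[
    & forall x, ~ K x -> phi x = 0].

Definition weak_derivative (u w : R -> R) : Prop :=
  forall phi, test_function phi ->
    \int[@mu01 R]_x (u x * (phi^`())%classic x) = - \int[@mu01 R]_x (w x * phi x).

Definition continuous_version (u f : R -> R) : Prop :=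
  {within `[0, 1], continuous f} /\ u = f %[ae @mu01 R].

Local Notation Lp p1 := (LspaceType (@mu01 R) p1).

Definition Xspace (m : nat) (p : \bar R) (p1 : (1 <= p)%E) :=
  {ffun 'I_(2 * m) -> Lp p1}.

HB.instance Definition _ m p p1 := NormedModule.on (@Xspace m p p1).

Definition X1 (m : nat) := Xspace m (lexx 1%E).

HB.instance Definition _ m := NormedModule.on (X1 m).

Lemma Lp_sub_L1 (p : \bar R) (p1 : (1 <= p)%E) (u : Lp p1) :
  (u : {mfun_ (@mu01 R), measurableTypeR R >-> measurableTypeR R})
    \in @Lspace_pred _ _ R (@mu01 R) 1%E.
Proof.
rewrite -(ae_repK (u : {mfun_ (@mu01 R), measurableTypeR R >-> measurableTypeR R})).
apply: Lspace_pred_class; apply: (Lfun_subset (lexx _) p1 _ p1).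
  by rewrite [X in X \is a fin_num](mu01_setT R).
exact: (Lspace_predE (valP u)).
Qed.

(* The inclusion of X_p in X_1: the classes are unchanged. *)
Definition X_incl (m : nat) (p : \bar R) (p1 : (1 <= p)%E)
    (u : Xspace m p1) : X1 m :=
  [ffun j => Lspace_Sub (lexx 1%E) (Lp_sub_L1 (u j))].

Lemma X_inclE (m : nat) (p : \bar R) (p1 : (1 <= p)%E) (u : Xspace m p1) j :
  (X_incl u j : R -> R) = u j.
Proof. by rewrite ffunE. Qed.

(* The graph of A_{1,B}: for (u, v) in it, w is the weak derivative of u and f is
   the continuous version of u. The index j : 'I_(2 * m) is in J^+ when j < mp. *)
Definition transport_operator (m mp : nat) (c : 'I_(2 * m) -> R -> R)
    (B : 'M[R]_(2 * m)) : set (X1 m * X1 m) :=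
  [set uv : X1 m * X1 m | exists (w : X1 m) (f : 'I_(2 * m) -> R -> R),
    [/\ forall j, weak_derivative (uv.1 j) (w j),
        forall j, continuous_version (uv.1 j) (f j),
        \col_j (if (j < mp)%N then f j 0 else f j 1) =
          B *m \col_j (if (j < mp)%N then f j 1 else f j 0)
      & forall j, (uv.2 j : R -> R) =
          (fun x => (if (j < mp)%N then - c j x else c j x) * (w j : R -> R) x)
          %[ae @mu01 R]]].

End transport.

(* Main.v *)
(* For a convex Phi >= 0 put E(u) = sum_j int (omega_j / c_j) Phi(u_j), where
   omega_j is affine, equal to a small eps at the inflow end and to 1 at the
   outflow end of the j-th component.  If u is in the domain of A, convexity and
   an integration by parts give E(u - h A u) >= (1 - w h) E(u): the outflow
   boundary terms absorb the inflow ones as soon as Phi(B y) is controlled by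
   sum_j Phi(y_j) and eps is small.  Since u(t) - h A u(t) = u(t - h) + o(h),
   this yields E(G t u) <= exp(2 w t) E(u), first on the domain and then on X_1
   by density.  For Phi the function |a|^q truncated to affine growth, all the
   constants are independent of the truncation, so G t is bounded in X_q for
   every q > 1.
   For p > 1 the rest is soft.  Strong continuity: on u in X_(p+1), interpolate
   the L^p norm of G t u - u between L^1 and L^(p+1); truncations are dense.
   Generator: if (u, v) is in the part of A, then (G t u - u) / t is the L^1-limit
   of Riemann means of s |-> G s v, which are L^p-close to v for small t, and the
   L^p norm is lower semicontinuous for L^1-convergence. *)
From HB Require Import structures.
Require Import Defs.
From mathcomp Require Import all_boot all_order all_algebra.
From mathcomp Require Import all_classical all_reals all_analysis.
From mathcomp Require Import measurable_realfun.
From mathcomp Require Import ring lra.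
Set Implicit Arguments.
Unset Strict Implicit.
Unset Printing Implicit Defensive.
Import Order.TTheory GRing.Theory Num.Theory.
Import numFieldNormedType.Exports.
Local Open Scope classical_set_scope.
Local Open Scope ring_scope.

(** * Integrals and L^1 *)

(** The semigroup is only given on X_1, through its generator, and an arbitrary [B] couples
    components with different travel times, so no convenient solution formula is at hand: everything
    has to come from the domain of A and from convergence in L^1. This dictates the affine growth of
    Phi: it makes the energy finite and Lipschitz on X_1, hence stable under the o(h) errors of the
    scheme and under approximation by elements of the domain. The Lipschitz constant blows up with
    the truncation level, but it only multiplies errors that tend to 0. The constants that survive
    come from Phi(l a) <= l^q Phi(a) for l >= 1, which holds with the same factor at every level.
    Backward steps are used because the tangent inequality bounds E(u - h A u) from below, with no
    second-order remainder to estimate. The o(h) errors are propagated by G, so a bound of G on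
    compact time intervals is required; this is where the uniform boundedness principle, and with it
    the completeness of L^1, comes in. *)

Section Rintegral_extra.
Context d (T : measurableType d) (R : realType) (mu : {measure set T -> \bar R}).
Implicit Types f g : T -> R.

Lemma ae_impl (P Q : T -> Prop) : (forall x, P x -> Q x) ->
  {ae mu, forall x, P x} -> {ae mu, forall x, Q x}.
Proof. by move=> PQ; apply: filterS. Qed.

Lemma ae_impl2 (P1 P2 Q : T -> Prop) : (forall x, P1 x -> P2 x -> Q x) ->
  {ae mu, forall x, P1 x} -> {ae mu, forall x, P2 x} -> {ae mu, forall x, Q x}.
Proof. by move=> PQ; apply: filterS2. Qed.

Lemma ae_eq_Rintegral f g : measurable_fun setT f -> measurable_fun setT g ->
  f = g %[ae mu] -> \int[mu]_x f x = \int[mu]_x g x.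
Proof.
move=> mf mg fg; congr fine; apply: ae_eq_integral => //; try exact/measurable_EFinP.
by apply: filterS fg => x /= fgx Dx; rewrite fgx.
Qed.

Lemma ae_eq_integrable f g : measurable_fun setT f -> measurable_fun setT g ->
  f = g %[ae mu] -> mu.-integrable setT (EFin \o f) -> mu.-integrable setT (EFin \o g).
Proof.
move=> mf mg fg /integrableP[_ fi]; apply/integrableP; split.
  exact/measurable_EFinP.
rewrite (le_lt_trans _ fi)// le_eqVlt; apply/orP; left; apply/eqP.
apply: ae_eq_integral => //.
- by apply: measurableT_comp => //; exact/measurable_EFinP.
- by apply: measurableT_comp => //; exact/measurable_EFinP.
- by apply: filterS fg => x /= fgx Dx; rewrite fgx.
Qed.

Lemma integrable_measurable f : mu.-integrable setT (EFin \o f) -> measurable_fun setT f.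
Proof. by move=> /integrableP[/measurable_EFinP]. Qed.

Lemma ae_le_Rintegral f g : mu.-integrable setT (EFin \o f) ->
  mu.-integrable setT (EFin \o g) ->
  {ae mu, forall x, f x <= g x} -> \int[mu]_x f x <= \int[mu]_x g x.
Proof.
move=> fi gi fg.
have mf := integrable_measurable fi; have mg := integrable_measurable gi.
(* Passing to max(f, g) alters [g] on a null set only and turns the a.e. inequality into a pointwise
   one. *)
pose g' x := Num.max (f x) (g x).
have mg' : measurable_fun setT g' by exact: measurable_maxr.
have gg' : g = g' %[ae mu] by apply: filterS fg => x fgx _; rewrite /g' max_r.
rewrite (ae_eq_Rintegral mg mg' gg'); apply: le_Rintegral => //.
  exact: ae_eq_integrable mg mg' gg' gi.
by move=> x _; rewrite le_max lexx.
Qed.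

Lemma integrable_le f g : measurable_fun setT f -> mu.-integrable setT (EFin \o g) ->
  {ae mu, forall x, `|f x| <= g x} -> mu.-integrable setT (EFin \o f).
Proof.
move=> mf gi fg; have mg := integrable_measurable gi.
pose g' x := Num.max `|f x| (g x).
have mg' : measurable_fun setT g'.
  by apply: measurable_maxr => //; apply: measurableT_comp.
have gg' : g = g' %[ae mu] by apply: filterS fg => x fgx _; rewrite /g' max_r.
apply: (le_integrable _ _ _ (ae_eq_integrable mg mg' gg' gi)) => //.
  exact/measurable_EFinP.
move=> x _ /=; rewrite lee_fin [leRHS]ger0_norm; first by rewrite le_max lexx.
by rewrite le_max normr_ge0.
Qed.

Lemma Rintegral_dominated (f_ : nat -> T -> R) f g :
  (forall n, measurable_fun setT (f_ n)) -> measurable_fun setT f ->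
  mu.-integrable setT (EFin \o g) ->
  {ae mu, forall x, f_ n x @[n --> \oo] --> f x} ->
  {ae mu, forall x, forall n, `|f_ n x| <= g x} ->
  \int[mu]_x f_ n x @[n --> \oo] --> \int[mu]_x f x.
Proof.
move=> mf_ mf gi cf bf.
have [|||||fi _ h] := @dominated_convergence _ T R mu setT measurableT
    (fun n => EFin \o f_ n) (EFin \o f) (EFin \o g).
- by move=> n; exact/measurable_EFinP.
- exact/measurable_EFinP.
- by apply: filterS cf => x h _; apply: cvg_EFin => //; exact: nearW.
- exact: gi.
- by apply: filterS bf => x h n _; rewrite lee_fin.
apply: fine_cvg; rewrite fineK//.
exact: integrable_fin_num.
Qed.

Lemma integrable_norm f : mu.-integrable setT (EFin \o f) ->
  mu.-integrable setT (EFin \o (fun x => `|f x|)).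
Proof. by move=> /integrable_abse; apply: eq_integrable. Qed.

Lemma integrableM_bounded f g (M : R) : measurable_fun setT f ->
  mu.-integrable setT (EFin \o g) -> {ae mu, forall x, `|f x| <= M} ->
  mu.-integrable setT (EFin \o (fun x => f x * g x)).
Proof.
move=> mf gi fM.
apply: (@integrable_le _ (fun x => M * `|g x|)).
- by apply: measurable_funM => //; exact: integrable_measurable gi.
- by have := integrableZl measurableT M (integrable_norm gi); apply: eq_integrable.
- by apply: filterS fM => x h; rewrite normrM ler_wpM2r.
Qed.

End Rintegral_extra.

Section L1_facts.
Context d (T : measurableType d) (R : realType) (mu : {measure set T -> \bar R}).
Local Notation L1 := (LspaceType mu (lexx 1%E)).

Lemma Lspace_measurable p (p1 : (1 <= p)%E) (u : LspaceType mu p1) :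
  measurable_fun [set: T] (u : T -> R).
Proof. exact: (measurable_funPT (ae_rep (u : {mfun_ mu, T >-> measurableTypeR R}))). Qed.

Lemma L1_integrable (u : L1) : mu.-integrable setT (EFin \o (u : T -> R)).
Proof.
by apply/Lfun1_integrable; apply: Lspace_predE; exact: (valP u).
Qed.

Lemma L1_normE (u : L1) : `|u| = \int[mu]_x `|(u : T -> R) x|.
Proof.
rewrite /Rintegral -[LHS]/(Lspace_norm u) /Lspace_norm Lnorm1.
by congr fine; apply: eq_integral.
Qed.

Lemma L1_class f : mu.-integrable setT (EFin \o f) ->
  exists u : L1, (u : T -> R) = f %[ae mu].
Proof.
move=> fi; have mf := integrable_measurable fi.
have mf' : f \in @mfun _ _ T R by rewrite inE.
pose F : {mfun T >-> R} := mfun_Sub mf'.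
have LF : ae_class mu F \in @Lspace_pred _ _ R mu 1%E.
  by apply: Lspace_pred_class; apply/Lfun1_integrable.
by exists (Lspace_Sub (lexx 1%E) LF); exact: ae_classK.
Qed.

Lemma LspaceBE p (p1 : (1 <= p)%E) (u v : LspaceType mu p1) :
  (u - v : LspaceType mu p1) = (fun x => (u : T -> R) x - (v : T -> R) x) %[ae mu].
Proof.
rewrite -scaleN1r.
have := ae_addE (u : {mfun_ mu, T >-> measurableTypeR R}) (-1 *: v : LspaceType mu p1).
have := ae_scaleE (-1) (v : {mfun_ mu, T >-> measurableTypeR R}).
apply: filterS2 => x h1 h2 Dx; rewrite h2//.
by have /= -> := h1 Dx; rewrite mulN1r.
Qed.

Lemma LspaceZE p (p1 : (1 <= p)%E) a (u : LspaceType mu p1) :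
  (a *: u : LspaceType mu p1) = (fun x => a * (u : T -> R) x) %[ae mu].
Proof. exact: (ae_scaleE a (u : {mfun_ mu, T >-> measurableTypeR R})). Qed.

Lemma L1_distE (u v : L1) : `|u - v| = \int[mu]_x `|(u : T -> R) x - (v : T -> R) x|.
Proof.
rewrite L1_normE; apply: ae_eq_Rintegral.
- by apply: measurableT_comp => //; exact: Lspace_measurable.
- by apply: measurableT_comp => //; apply: measurable_funB; exact: Lspace_measurable.
- by apply: filterS (LspaceBE u v) => x h Dx; rewrite h.
Qed.

End L1_facts.

(** * Calculus against Lebesgue measure on ]0, 1[ *)

Section mu01_facts.
Context (R : realType).
Local Notation mu := (@mu01 R).
Local Notation leb := (@lebesgue_measure R).
Implicit Types (f g F : R -> R) (a b x : R).

Lemma mu01_ae (P : R -> Prop) : (forall x, 0 < x < 1 -> P x) -> {ae mu, forall x, P x}.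
Proof.
move=> h; exists (~` `]0, 1[); split.
- by apply: measurableC; exact: measurable_itv.
- by rewrite /mu01 /mrestr setICl measure0.
- move=> x /= Px; apply: contra_not Px; rewrite in_itv /=; exact: h.
Qed.

Lemma measurable_indic_oo a b :
  measurable_fun [set: measurableTypeR R] (\1_(`]a, b[) : measurableTypeR R -> R).
Proof. by apply: measurable_indic; exact: measurable_itv. Qed.

(** Integrals over subintervals are written with indicators, so that they remain integrals against
    [mu01] over the whole space. Open and closed intervals give the same value, end points being
    null. *)
Lemma Rintegral_mu01_itv f a b : measurable_fun setT f -> 0 <= a -> b <= 1 ->
  \int[mu]_x (f x * \1_(`]a, b[) x) = \int[leb]_(x in `[a, b]) f x.
Proof.
move=> mf a0 b1.
have ab01 : `]a, b[ `<=` (`]0, 1[ : set R).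
  by move=> x /=; rewrite !in_itv/= => /andP[? ?]; apply/andP; split;
    [exact: le_lt_trans a0 _|exact: lt_le_trans b1].
have -> : \int[mu]_x (f x * \1_(`]a, b[) x) = \int[mu]_(x in `]a, b[) f x.
  rewrite [RHS]Rintegral_mkcond; apply: eq_Rintegral => x _.
  by rewrite patchE indicE; case: ifP => _; rewrite ?mulr1 ?mulr0.
rewrite /Rintegral (@eq_measure_integral _ _ _ _ leb); last first.
  by move=> A mA Aab; rewrite /= /mu01 /mrestr setIidl//; exact: subset_trans ab01.
congr fine; apply/esym; apply: integral_itv_bndoo.
by apply/measurable_EFinP; exact: measurable_funTS.
Qed.

(** Such an f may be unbounded on the line, but [mu01] is finite and carried by ]0, 1[, where |f| is
    at most its maximum over [0, 1]. *)
Lemma integrable_mu01_continuous f : continuous f -> mu.-integrable setT (EFin \o f).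
Proof.
move=> cf.
have cf' : {within `[0, 1], continuous (fun x => `|f x|)}.
  by apply: continuous_subspaceT => x; apply: cvg_norm; exact: cf.
have [c _ hc] := EVT_max ler01 cf'.
apply: (@integrable_le _ _ _ _ _ (cst `|f c|)).
- exact: continuous_measurable_fun.
- apply: measurable_bounded_integrable => //.
    by have := mu01_setT R; rewrite /= => ->; rewrite ltry.
  by exists `|f c|; split=> // M h x _ /=; rewrite normr_id ltW.
- apply: mu01_ae => x /andP[x0 x1]; apply: hc.
  by rewrite in_itv/= !ltW.
Qed.

Lemma Rintegral_mu01_FTC F f a b : 0 <= a -> a < b -> b <= 1 ->
  (forall x, a <= x <= b -> is_derive x (1 : R) F (f x)) -> continuous f ->
  \int[mu]_x (f x * \1_(`]a, b[) x) = F b - F a.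
Proof.
move=> a0 ab b1 dF cf.
rewrite Rintegral_mu01_itv//; last exact: continuous_measurable_fun.
have Fc x : a <= x <= b -> {for x, continuous F}.
  move=> /dF[dx _]; exact/differentiable_continuous/derivable1_diffP.
rewrite /Rintegral (@continuous_FTC2 _ f F)//.
- exact: continuous_subspaceT.
- split.
  + by move=> x; rewrite in_itv/= => /andP[ax xb]; have [|] := dF x; rewrite ?ltW.
  + by apply: cvg_at_right_filter; apply: Fc; rewrite lexx ltW.
  + by apply: cvg_at_left_filter; apply: Fc; rewrite lexx ltW.
- move=> x; rewrite in_itv/= => /andP[ax xb]; rewrite derive1E.
  by have [|_ ->] := dF x; rewrite ?ltW.
Qed.

Lemma Rintegral_mu01_indic f : measurable_fun setT f ->
  \int[mu]_x (f x * \1_(`]0, 1[) x) = \int[mu]_x f x.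
Proof.
move=> mf; apply: ae_eq_Rintegral => //.
  by apply: measurable_funM => //; exact/measurable_indic/measurable_itv.
by apply: mu01_ae => x x01 _; rewrite indicE mem_set ?mulr1//= in_itv.
Qed.

Lemma Rintegral_mu01_FTC1 F f :
  (forall x, 0 <= x <= 1 -> is_derive x (1 : R) F (f x)) -> continuous f ->
  \int[mu]_x f x = F 1 - F 0.
Proof.
move=> dF cf; rewrite -(Rintegral_mu01_FTC _ _ _ dF cf)//.
by rewrite Rintegral_mu01_indic//; exact: continuous_measurable_fun.
Qed.

Lemma test_function_derive (phi : R -> R) x : test_function phi ->
  is_derive x (1 : R) phi ((phi^`())%classic x).
Proof. by move=> [/(_ 0%N x) h _]; rewrite derive1E; exact: derivableP. Qed.

Lemma test_function_continuous (phi : R -> R) : test_function phi ->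
  continuous phi /\ continuous (phi^`())%classic.
Proof.
move=> [h _]; split=> x; apply/differentiable_continuous/derivable1_diffP.
  exact: (h 0%N).
exact: (h 1%N).
Qed.

(** Product rule and fundamental theorem of calculus; the boundary terms vanish because the compact
    support of a test function avoids 0 and 1. *)
Lemma C1_weak_derivative F f : continuous F -> continuous f ->
  (forall x, 0 <= x <= 1 -> is_derive x (1 : R) F (f x)) -> weak_derivative F f.
Proof.
move=> cF cf dF phi tphi.
have [cphi cphi'] := test_function_continuous tphi.
have c1 : continuous (fun x => F x * (phi^`())%classic x).
  by move=> x; apply: cvgM; [exact: cF|exact: cphi'].
have c2 : continuous (fun x => f x * phi x).
  by move=> x; apply: cvgM; [exact: cf|exact: cphi].
apply/eqP; rewrite -subr_eq0 opprK -RintegralD//; try exact: integrable_mu01_continuous.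
have [_ [K [_ K01 Kphi]]] := tphi.
have phi0 : phi 0 = 0 by apply: Kphi => /K01/=; rewrite in_itv/= ltxx.
have phi1 : phi 1 = 0 by apply: Kphi => /K01/=; rewrite in_itv/= ltxx andbF.
have dFphi x : 0 <= x <= 1 -> is_derive x (1 : R) (fun x => F x * phi x)
    (F x * (phi^`())%classic x + f x * phi x).
  move=> x01; apply: is_derive_eq (is_deriveM (dF x x01) (test_function_derive x tphi)) _.
  by rewrite /GRing.scale/=; ring.
rewrite (Rintegral_mu01_FTC1 dFphi); first by rewrite phi0 phi1 !mulr0 subrr.
by move=> x; apply: cvgD; [exact: c1|exact: c2].
Qed.

End mu01_facts.

(** * Weak derivatives *)

Section smooth_step.
Context (R : realType).
Implicit Types (f g : R -> R) (P : {poly R}) (a b x : R).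

(* [flat P]' = flat (X^2 (P - P')), so that all derivatives stay in the class. *)
Definition flat P x : R := if 0 < x then P.[x^-1] * expR (- x^-1) else 0.

(** Induction on the polynomial: half of the rate [a] is spent on the lower-degree factor, the other
    half on y <= (2 / a) exp(a y / 2). *)
Lemma horner_expR_bound P a : 0 < a ->
  exists2 M : R, 0 <= M & forall y, 0 <= y -> `|P.[y]| <= M * expR (a * y).
Proof.
elim/poly_ind: P a => [|P c IH] a a0.
  by exists 0 => // y _; rewrite horner0 normr0 mul0r.
have a20 : 0 < a / 2 by rewrite divr_gt0.
have [M M0 hM] := IH _ a20.
exists (M * (2 / a) + `|c|); first by rewrite addr_ge0// mulr_ge0// divr_ge0// ltW.
move=> y y0; rewrite hornerMXaddC (le_trans (ler_normD _ _))// mulrDl lerD//.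
  rewrite normrM (ger0_norm y0).
  have e1 : expR (a * y) = expR (a / 2 * y) * expR (a / 2 * y).
    by rewrite -expRD; congr expR; field.
  have e2 : y <= 2 / a * expR (a / 2 * y).
    have := expR_ge1Dx (a / 2 * y); rewrite -(ler_pM2l (divr_gt0 (ltr0Sn R 1) a0)).
    have -> : 2 / a * (1 + a / 2 * y) = 2 / a + y by field; rewrite gt_eqF.
    by apply: le_trans; rewrite lerDr divr_ge0// ltW.
  have := ler_pM (normr_ge0 _) y0 (hM y y0) e2.
  by rewrite e1; set e := expR (a / 2 * y); move/le_trans; apply; rewrite le_eqVlt; apply/orP; left; apply/eqP; ring.
by rewrite ler_peMr// -expR0 ler_expR mulr_ge0// ltW.
Qed.

(** With rate 1/2 and y = 1/x, |P(y)| exp(-y) <= M exp(-y/2) <= 2 M / y. This linear bound at 0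
    suffices for all orders because it is available for every polynomial. *)
Lemma flat_bound P : exists2 M : R, 0 <= M & forall x, `|flat P x| <= M * `|x|.
Proof.
have [|M M0 hM] := @horner_expR_bound P (2^-1); first by rewrite invr_gt0.
exists (M * 2) => [|x]; first by rewrite mulr_ge0.
rewrite /flat; case: ifPn => x0; last by rewrite normr0 !mulr_ge0.
rewrite normrM [X in _ * X](ger0_norm (expR_ge0 _)) (gtr0_norm x0) -mulrA.
have y0 : 0 < x^-1 by rewrite invr_gt0.
have h1 := hM _ (ltW y0).
apply: (@le_trans _ _ (M * expR (2^-1 / x) * expR (- x^-1))).
  by rewrite ler_wpM2r// expR_ge0.
rewrite -mulrA -expRD ler_wpM2l//.
have -> : 2^-1 / x - x^-1 = - (2^-1 / x) by lra.
have h2 := expR_ge1Dx (2^-1 / x).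
rewrite expRN -[leRHS]invrK lef_pV2 ?posrE ?expR_gt0 ?invr_gt0 ?mulr_gt0//.
by rewrite invfM; lra.
Qed.

Lemma flat_cvg0 P : flat P x @[x --> 0^'] --> 0.
Proof.
have [M M0 hM] := flat_bound P.
apply/norm_cvg0P; apply: (@squeeze_cvgr _ _ _ _ (cst 0) (fun x => M * `|x|)).
- by apply: nearW => x; rewrite normr_ge0 hM.
- exact: cvg_cst.
- have : M * `|x| @[x --> (0 : R)] --> M * `|0 : R| by apply: cvgMr; apply: cvg_norm; exact: cvg_id.
  by rewrite normr0 mulr0; apply: cvg_trans; apply: cvg_app; exact: nbhs_dnbhs.
Qed.

Lemma is_derive_horner P x : is_derive x (1 : R) (horner P) (P^`()).[x].
Proof. by apply: DeriveDef; [exact: derivable_horner|rewrite -derive1E derivE]. Qed.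

Lemma flat_derive P x :
  is_derive x (1 : R) (flat P) (flat ('X^2 * (P - P^`())%R) x).
Proof.
case: (ltgtP x 0) => x0.
- rewrite [flat (_ * _) _]/flat ltNge (ltW x0)/=.
  apply: (near_eq_is_derive _ (is_derive_cst 0 x 1)).
  near=> y; rewrite /flat ifF//; apply/negbTE; rewrite -leNgt ltW//.
  by near: y; exact: lt_nbhsl.
- rewrite [flat (_ * _) _]/flat x0/=.
  have dV : is_derive x (1 : R) (fun y : R => y^-1) (- x ^- 2).
    by apply: is_derive_eq (is_deriveV (lt0r_neq0 x0) (is_derive_id x 1)) _;
      rewrite /GRing.scale/= mulr1.
  have dP := @is_derive1_comp R (horner P) (fun y : R => y^-1) x _ _ (is_derive_horner P x^-1) dV.
  have dE := @is_derive1_comp R expR (fun y : R => - y^-1) x _ _ (is_derive_expR _) (is_deriveN dV).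
  apply: (near_eq_is_derive _ (is_derive_eq (is_deriveM dP dE) _)).
    near=> y; rewrite /flat ifT//; near: y; exact: lt_nbhsr.
  rewrite /GRing.scale/= hornerM hornerXn hornerD hornerN.
  move: (P.[x^-1]) (P^`().[x^-1]) (expR (- x^-1)) => A B C; field.
  by rewrite gt_eqF.
- rewrite x0 [flat (_ * _) _]/flat ltxx.
  (* At 0 the difference quotient is again a flat function, that of P times X, and so tends to 0. *)
  have h : h^-1 *: ((flat P \o shift 0) (h *: (1 : R)) - flat P 0) @[h --> 0^'] --> (0 : R).
    apply: cvg_trans (flat_cvg0 (P * 'X)); apply: near_eq_cvg.
    apply: filterS (nbhs_dnbhs_neq (0 : R)) => h h0.
    rewrite /= [h *: 1]mulr1 addr0 /flat ltxx subr0; case: ifP => hp.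
      by rewrite hornerMX /GRing.scale/=; ring.
    by rewrite scaler0.
  by apply: DeriveDef; [apply/cvg_ex; exists 0|exact: cvg_lim].
Unshelve. all: by end_near. Qed.

(** A class of functions in which every member has a derivative that is again a member; smoothness
    then follows by iteration, without formulas for higher derivatives. Reciprocals are included for
    the quotient in [smooth_step]. *)
Inductive flat_expr : (R -> R) -> Prop :=
| flat_expr_cst c : flat_expr (fun=> c)
| flat_expr_flat P a b : flat_expr (fun x => flat P (a * x + b))
| flat_expr_add f g : flat_expr f -> flat_expr g -> flat_expr (fun x => f x + g x)
| flat_expr_mul f g : flat_expr f -> flat_expr g -> flat_expr (fun x => f x * g x)
| flat_expr_inv f : flat_expr f -> (forall x, f x != 0) -> flat_expr (fun x => (f x)^-1).

Lemma flat_expr_derive f : flat_expr f ->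
  exists2 g, flat_expr g & forall x, is_derive x (1 : R) f (g x).
Proof.
elim=> {f} [c|P a b|f g _ [f' f'e df] _ [g' g'e dg]|f g fe [f' f'e df] ge [g' g'e dg]|
  f fe [f' f'e df] f0].
- by exists (fun=> 0) => [|x]; [exact: flat_expr_cst|exact: is_derive_cst].
- exists (fun x => a * flat ('X ^+ 2 * (P - P^`())) (a * x + b)).
    by apply: flat_expr_mul; [exact: flat_expr_cst|exact: flat_expr_flat].
  move=> x; rewrite mulrC.
  have h : is_derive x (1 : R) (fun x => a * x + b) a.
    by apply: is_derive_eq; rewrite /GRing.scale/= mulr1 addr0.
  exact: (@is_derive1_comp R (flat P) (fun x => a * x + b) x _ _ (flat_derive P (a * x + b)) h).
- exists (fun x => f' x + g' x); first exact: flat_expr_add.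
  by move=> x; apply: is_deriveD.
- exists (fun x => f x * g' x + g x * f' x).
    by apply: flat_expr_add; apply: flat_expr_mul.
  by move=> x; apply: is_deriveM.
- exists (fun x => (-1) * (f' x * ((f x)^-1 * (f x)^-1))).
    apply: flat_expr_mul; first exact: flat_expr_cst.
    by apply: flat_expr_mul => //; apply: flat_expr_mul; exact: flat_expr_inv.
  move=> x; apply: is_derive_eq (is_deriveV (f0 x) (df x)) _.
  by rewrite /GRing.scale/= -!expr2 -exprVn; ring.
Qed.

Lemma flat_expr_smooth f n x : flat_expr f -> derivable (f^`(n))%classic x 1.
Proof.
move=> fe; suff [g ge <-] : exists2 g, flat_expr g & g = (f^`(n))%classic.
  by have [h _ /(_ x)[]] := flat_expr_derive ge.
elim: n => [|n [g ge IH]]; first by exists f.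
have [h he gh] := flat_expr_derive ge.
exists h => //; rewrite derive1nS -IH; apply/funext => y.
by rewrite derive1E; have [_ ->] := gh y.
Qed.

Lemma flat1E x : flat 1 x = if 0 < x then expR (- x^-1) else 0.
Proof. by rewrite /flat hornerC mul1r. Qed.

Definition smooth_step x : R := flat 1 x / (flat 1 x + flat 1 (1 - x)).

Lemma flat1_ge0 x : 0 <= flat 1 x.
Proof. by rewrite flat1E; case: ifP => // _; rewrite expR_ge0. Qed.

Lemma smooth_step_den x : 0 < flat 1 x + flat 1 (1 - x).
Proof.
case: (ltP 0 x) => x0.
  by rewrite ltr_pwDl ?flat1_ge0// flat1E x0 expR_gt0.
by rewrite ltr_wpDl ?flat1_ge0// flat1E ifT ?expR_gt0//; lra.
Qed.

Lemma flat_expr_step a b : flat_expr (fun x => smooth_step (a * x + b)).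
Proof.
have h1 := flat_expr_flat 1 a b.
have h2 : flat_expr (fun x => flat 1 (1 - (a * x + b))).
  have -> : (fun x => flat 1 (1 - (a * x + b))) = (fun x => flat 1 (- a * x + (1 - b))).
    by apply/funext => x; congr flat; ring.
  exact: flat_expr_flat.
apply: flat_expr_mul => //; apply: flat_expr_inv; first exact: flat_expr_add.
by move=> x; rewrite gt_eqF// smooth_step_den.
Qed.

Lemma smooth_step_le0 x : x <= 0 -> smooth_step x = 0.
Proof. by move=> x0; rewrite /smooth_step flat1E ltNge x0/= mul0r. Qed.

Lemma smooth_step_ge1 x : 1 <= x -> smooth_step x = 1.
Proof.
move=> x1; have := smooth_step_den x; rewrite /smooth_step.
have -> : flat 1 (1 - x) = 0 by rewrite flat1E ifF//; apply/negbTE; lra.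
by rewrite addr0 => h; rewrite divff// gt_eqF.
Qed.

Lemma smooth_step_itv x : 0 <= smooth_step x <= 1.
Proof.
have d0 := smooth_step_den x.
rewrite /smooth_step divr_ge0 ?flat1_ge0 ?(ltW d0)//=.
by rewrite ler_pdivrMr// mul1r; have := flat1_ge0 (1 - x); lra.
Qed.

End smooth_step.

Lemma is_derive_ext (R : realType) (f g : R -> R) (x df dg : R) :
  is_derive x (1 : R) f df -> f =1 g -> df = dg -> is_derive x (1 : R) g dg.
Proof. by move=> + /funext <- <-. Qed.

(** * From weak derivatives to increments of the continuous version *)

Section du_bois_reymond.
Context (R : realType).
Local Notation mu := (@mu01 R).
Implicit Types (f : R -> R) (a b c x : R).

(** The quotient rule for [smooth_step] after cancellation; in this form the sign and the support in
    [0, 1] can be read off. *)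
Definition dstep x : R :=
  (flat 'X^2 x * flat 1 (1 - x) + flat 1 x * flat 'X^2 (1 - x)) /
  (flat 1 x + flat 1 (1 - x)) ^+ 2.

Lemma is_derive_step x : is_derive x (1 : R) (@smooth_step R) (dstep x).
Proof.
have Q : 'X^2 * (1 - 1^`()) = 'X^2 :> {poly R} by rewrite derivC subr0 mulr1.
have d1 : is_derive x (1 : R) (flat 1) (flat 'X^2 x) by rewrite -Q; exact: flat_derive.
have l1 : is_derive x (1 : R) (fun x : R => 1 - x) (-1).
  have h := is_deriveB (is_derive_cst (1 : R) x (1 : R)) (is_derive_id x (1 : R)).
  by apply: (is_derive_ext h) => //; rewrite sub0r.
have d2 : is_derive x (1 : R) (fun x => flat 1 (1 - x)) (- flat 'X^2 (1 - x)).
  have h : is_derive (1 - x) (1 : R) (flat 1) (flat 'X^2 (1 - x)).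
    by rewrite -Q; exact: flat_derive.
  by apply: is_derive_eq (@is_derive1_comp R (flat 1) (fun x => 1 - x) x _ _ h l1) _; rewrite mulrN1.
have D0 := smooth_step_den x; have Dn := lt0r_neq0 D0.
have d3 := is_deriveD d1 d2.
have d4 := is_deriveV (Dn : (flat 1 + (fun x => flat 1 (1 - x))) x != 0) d3.
apply: (is_derive_ext (is_deriveM d1 d4)) => //.
rewrite /GRing.scale/= /dstep fctE.
by field.
Qed.

Lemma flatX2_ge0 x : 0 <= flat 'X^2 x.
Proof. by rewrite /flat; case: ifP => // _; rewrite hornerXn mulr_ge0 ?sqr_ge0 ?expR_ge0. Qed.

Lemma dstep_ge0 x : 0 <= dstep x.
Proof.
rewrite /dstep divr_ge0 ?sqr_ge0//.
by rewrite addr_ge0// mulr_ge0 ?flat1_ge0 ?flatX2_ge0.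
Qed.

Lemma dstep_eq0 x : ~~ (0 < x < 1) -> dstep x = 0.
Proof.
have fl0 (P : {poly R}) y : y <= 0 -> flat P y = 0 by move=> y0; rewrite /flat ltNge y0.
rewrite negb_and -!leNgt => /orP[x0|x1]; rewrite /dstep.
  by rewrite !(fl0 _ x)// !mul0r addr0 mul0r.
by rewrite !(fl0 _ (1 - x)) ?subr_le0// !mulr0 addr0 mul0r.
Qed.

Lemma continuous_dstep : continuous dstep.
Proof.
have [g ge dg] : exists2 g, flat_expr g &
    forall x, is_derive x (1 : R) (@smooth_step R) (g x).
  apply: flat_expr_derive; have := flat_expr_step 1 (0 : R).
  by rewrite (_ : (fun x : R => _) = @smooth_step R)//; apply/funext => x; rewrite mul1r addr0.
have -> : dstep = g.
  apply/funext => x; have [_ <-] := dg x.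
  by have [_ ->] := is_derive_step x.
have [h _ dh] := flat_expr_derive ge.
by move=> x; apply/differentiable_continuous/derivable1_diffP; have [] := dh x.
Qed.

Lemma is_derive_affine_step (al be x : R) :
  is_derive x (1 : R) (fun x => smooth_step (al * x + be)) (al * dstep (al * x + be)).
Proof.
have h : is_derive x (1 : R) (fun x : R => al * x + be) al.
  by apply: is_derive_eq; rewrite /GRing.scale/= mulr1 addr0.
rewrite mulrC.
exact: (@is_derive1_comp R (@smooth_step R) (fun x => al * x + be) x _ _ (is_derive_step _) h).
Qed.

Lemma continuous_affine_dstep (al be : R) : continuous (fun x => al * dstep (al * x + be)).
Proof.
move=> x; apply: cvgMr.
apply: (@continuous_comp _ _ _ (fun x : R => al * x + be) dstep); last exact: continuous_dstep.
by apply: cvgD; [apply: cvgMr; exact: cvg_id|exact: cvg_cst].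
Qed.

(** The conditions on [be] and [al + be] say that the affine map sends 0 below 0 and 1 above 1, so
    the bump [al * dstep (al * x + be)] has total mass 1 on [0, 1]. It is a probability density
    living within d of c, and averaging f against it moves f(c) by at most e. *)
Lemma step_average f (al be c d e : R) : continuous f -> 0 < al -> be <= 0 -> 1 <= al + be ->
  (forall x, 0 < al * x + be < 1 -> `|x - c| < d) ->
  (forall x, `|x - c| < d -> `|f x - f c| <= e) ->
  `|\int[mu]_x (f x * (al * dstep (al * x + be))) - f c| <= e.
Proof.
move=> cf al0 be0 albe supp fe.
pose g x := al * dstep (al * x + be).
have cg : continuous g by exact: continuous_affine_dstep.
have g0 x : 0 <= g x by rewrite mulr_ge0 ?dstep_ge0// ltW.
have Ig : \int[mu]_x g x = 1.
  have dg x : 0 <= x <= 1 -> is_derive x (1 : R) (fun x => smooth_step (al * x + be)) (g x).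
    by move=> _; exact: is_derive_affine_step.
  rewrite (Rintegral_mu01_FTC1 dg cg).
  by rewrite mulr1 mulr0 add0r smooth_step_ge1// smooth_step_le0// subr0.
have cM f1 f2 : continuous f1 -> continuous f2 -> continuous (fun x : R => f1 x * f2 x : R).
  by move=> c1 c2 x; apply: cvgM; [exact: c1|exact: c2].
have cc (r : R) : continuous (fun _ : R => r) by move=> x; exact: cvg_cst.
have cfc : continuous (fun x => f x - f c) by move=> x; apply: cvgB; [exact: cf|exact: cvg_cst].
have iM f1 : continuous f1 -> mu.-integrable setT (EFin \o (fun x => f1 x * g x)).
  by move=> c1; apply: integrable_mu01_continuous; exact: cM.
have -> : \int[mu]_x (f x * g x) - f c = \int[mu]_x ((f x - f c) * g x).
  have -> : f c = \int[mu]_x (f c * g x).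
    by rewrite RintegralZl ?Ig ?mulr1//; exact: integrable_mu01_continuous.
  rewrite -RintegralB//; [|exact: iM|exact: iM].
  by apply: eq_Rintegral => x _; rewrite mulrBl RintegralZl ?Ig ?mulr1//; exact: integrable_mu01_continuous.
apply: le_trans (le_normr_Rintegral _ _) _ => //; first exact: iM.
have <- : \int[mu]_x (e * g x) = e.
  by rewrite RintegralZl ?Ig ?mulr1//; exact: integrable_mu01_continuous.
apply: le_Rintegral => //.
- exact/integrable_norm/iM.
- exact: iM.
- move=> x _; rewrite normrM (ger0_norm (g0 x)).
  have [x01|x01] := boolP (0 < al * x + be < 1).
    by rewrite ler_wpM2r//; exact/fe/supp.
  by rewrite /g dstep_eq0// !mulr0.
Qed.

(* Test with differences of smooth steps converging to the indicator of ]a, b[. *)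
Lemma weak_derivative_int (u w f : R -> R) a b : measurable_fun setT u ->
  mu.-integrable setT (EFin \o w) -> weak_derivative u w ->
  continuous f -> u = f %[ae mu] -> 0 <= a -> a < b -> b <= 1 ->
  \int[mu]_x (w x * \1_(`]a, b[) x) = f b - f a.
Proof.
move=> mu_ iw uw cf uf a0 ab b1.
have mw := integrable_measurable iw.
(* The 3 guarantees that the second step below still vanishes at a + 1/al and that the first is
   complete at b - 1/al, so their difference is supported between these points. *)
pose N := (Num.truncn (3 / (b - a))).+1.
have ba0 : 0 < b - a by rewrite subr_gt0.
pose al n : R := (n + N)%:R.
have al0 n : 0 < al n by rewrite ltr0n addnS.
have alN n : 3 <= al n * (b - a).
  rewrite -ler_pdivrMr// (le_trans (ltW (truncnS_gt _)))// /al ler_nat.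
  exact: leq_addl.
have alinv n : al n * (al n)^-1 = 1 by rewrite divff// gt_eqF.
(* The first step rises on [a + 1/al, a + 2/al], the second on [b - 2/al, b - 1/al]. The margin 1/al
   keeps the support compact in ]0, 1[ even when a = 0 or b = 1. *)
pose b1_ n := - al n * a - 1.
pose b2_ n := - al n * b + 2.
pose phi n x := smooth_step (al n * x + b1_ n) + -1 * smooth_step (al n * x + b2_ n).
have phi_le n x : x <= a + (al n)^-1 -> phi n x = 0.
  move=> /(ler_wpM2l (ltW (al0 n))); rewrite mulrDr alinv => h.
  have := alN n; rewrite mulrBr => h'.
  by rewrite /phi !smooth_step_le0 ?mulr0 ?addr0// /b1_ /b2_; lra.
have phi_ge n x : b - (al n)^-1 <= x -> phi n x = 0.
  move=> /(ler_wpM2l (ltW (al0 n))); rewrite mulrBr alinv => h.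
  have := alN n; rewrite mulrBr => h'.
  by rewrite /phi !smooth_step_ge1 ?mulN1r ?subrr// /b1_ /b2_; lra.
have fe n : flat_expr (phi n).
  apply: flat_expr_add; first exact: flat_expr_step.
  by apply: flat_expr_mul; [exact: flat_expr_cst|exact: flat_expr_step].
have dphi n x : is_derive x (1 : R) (phi n)
    (al n * dstep (al n * x + b1_ n) - al n * dstep (al n * x + b2_ n)).
  have h := is_derive_affine_step (al n) (b2_ n) x.
  have h' := is_deriveM (is_derive_cst (-1 : R) x (1 : R)) h.
  apply: (is_derive_ext (is_deriveD (is_derive_affine_step (al n) (b1_ n) x) h')) => //.
  by rewrite /GRing.scale/=; ring.
have alV0 n : 0 < (al n)^-1 by rewrite invr_gt0.
have tphi n : test_function (phi n).
  split; first by move=> k x; exact: flat_expr_smooth.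
  exists [set` `[a + (al n)^-1, b - (al n)^-1]]; split.
  - exact: segment_compact.
  - move=> x /=; rewrite !in_itv/= => /andP[h1 h2]; by have := alV0 n; move=> h3; apply/andP; split; lra.
  - move=> x /=; rewrite in_itv/= => /negP; rewrite negb_and -!ltNge => /orP[h|h].
      by apply: phi_le; exact: ltW.
    by apply: phi_ge; exact: ltW.
have phi1 n x : `|phi n x| <= 1.
  have /andP[h1 h2] := smooth_step_itv (al n * x + b1_ n).
  have /andP[h3 h4] := smooth_step_itv (al n * x + b2_ n).
  by rewrite /phi ler_norml; apply/andP; split; lra.
have cphi n : continuous (phi n) by have [] := test_function_continuous (tphi n).
have lim1 : \int[mu]_x (w x * phi n x) @[n --> \oo] --> \int[mu]_x (w x * \1_(`]a, b[) x).
  apply: (@Rintegral_dominated _ _ _ mu (fun n x => w x * phi n x)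
    (fun x => w x * \1_(`]a, b[) x) (fun x => `|w x|)).
  - by move=> n; apply: measurable_funM => //; exact: continuous_measurable_fun.
  - by apply: measurable_funM => //; exact/measurable_indic/measurable_itv.
  - exact: integrable_norm.
  - apply: nearW => x; apply: cvgMr.
    have [xab|xab] := boolP (x \in `]a, b[); last first.
      rewrite indicE memNset/=; last exact/negP.
      have -> : (fun n => phi n x) = cst 0; last exact: cvg_cst.
      apply/funext => n; move: xab; rewrite in_itv/= negb_and -!leNgt => /orP[h|h].
        by rewrite phi_le// (le_trans h)// lerDl ltW.
      by rewrite phi_ge// (le_trans _ h)// gerBl ltW.
    rewrite indicE mem_set//=; move: xab; rewrite in_itv/= => /andP[ax xb].
    have h : \forall n \near \oo, 2 <= al n * (x - a) /\ 2 <= al n * (b - x).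
      pose m := Num.min (x - a) (b - x).
      have m0 : 0 < m by rewrite lt_min !subr_gt0 ax.
      near=> n.
      have : 2 <= al n * m.
        rewrite -ler_pdivrMr// (le_trans (ltW (truncnS_gt _)))// /al ler_nat.
        rewrite (leq_trans _ (leq_addr _ _))//; near: n; exact: nbhs_infty_ge.
      by move=> h; split; apply: le_trans h _; rewrite ler_wpM2l ?(ltW (al0 n))// ge_min lexx ?orbT.
    apply: cvg_trans (@cvg_cst R 1 nat \oo _); apply: near_eq_cvg.
    apply: filterS h => n [h1 h2]; rewrite /phi smooth_step_ge1; last first.
      by rewrite /b1_; move: h1; rewrite mulrBr; lra.
    rewrite smooth_step_le0 ?mulr0 ?addr0//.
    by rewrite /b2_; move: h2; rewrite mulrBr; lra.
  - apply: nearW => x n; rewrite normrM -[leRHS]mulr1 ler_wpM2l//.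
(* The derivative of [phi n] is an approximate identity at a minus one at b. Tested against u = f it
   yields f(a) - f(b) in the limit, and the sign in [weak_derivative] reverses this. *)
have lim2 : \int[mu]_x (w x * phi n x) @[n --> \oo] --> f b - f a.
  have E n : \int[mu]_x (w x * phi n x) =
      \int[mu]_x (f x * (al n * dstep (al n * x + b2_ n))) -
      \int[mu]_x (f x * (al n * dstep (al n * x + b1_ n))).
    have /(congr1 -%R) := uw _ (tphi n); rewrite opprK => <-.
    have -> : \int[mu]_x (u x * ((phi n)^`())%classic x) =
      \int[mu]_x (f x * (al n * dstep (al n * x + b1_ n)) - f x * (al n * dstep (al n * x + b2_ n))).
      apply: ae_eq_Rintegral.
      - apply: measurable_funM => //; apply: continuous_measurable_fun.
        by have [] := test_function_continuous (tphi n).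
      - apply: continuous_measurable_fun => x; apply: cvgB; apply: cvgM.
        + exact: cf.
        + exact: continuous_affine_dstep.
        + exact: cf.
        + exact: continuous_affine_dstep.
      - apply: ae_impl uf => x h _; rewrite h// derive1E.
        by have [_ ->] := dphi n x; rewrite mulrBr.
    rewrite RintegralB ?opprB//; apply: integrable_mu01_continuous => x;
      apply: cvgM; [exact: cf|exact: continuous_affine_dstep|exact: cf|exact: continuous_affine_dstep].
  have avg c be : 0 <= c <= 1 -> (forall n, be n <= 0 /\ 1 <= al n + be n) ->
     (forall n x, 0 < al n * x + be n < 1 -> `|x - c| < 2 / al n) ->
     \int[mu]_x (f x * (al n * dstep (al n * x + be n))) @[n --> \oo] --> f c.
    move=> c01 hbe supp; apply/cvgrPdist_le => e e0.
    have /cvgrPdist_le/(_ e e0)[d /= d0 hd] := cf c.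
    near=> n; rewrite distrC; have [be0 albe] := hbe n.
    apply: (@step_average f (al n) (be n) c d e cf (al0 n) be0 albe).
      move=> x /supp; move/lt_trans; apply.
      rewrite ltr_pdivrMr// mulrC -ltr_pdivrMr//.
      apply: (lt_le_trans (truncnS_gt _)); rewrite /al ler_nat.
      rewrite (leq_trans _ (leq_addr _ _))//; near: n; exact: nbhs_infty_ge.
    by move=> x xc; rewrite distrC; apply: hd => /=; rewrite distrC.
  under eq_fun do rewrite E; apply: cvgB; apply: avg.
  - by rewrite b1 (le_trans a0)// ltW.
  - move=> n; have := alN n; have := mulr_ge0 (ltW (al0 n)) a0.
    have : 0 <= al n * (1 - b) by rewrite mulr_ge0 ?subr_ge0// ltW.
    by rewrite !mulrBr /b2_ => *; split; lra.
  - move=> n x /andP[h1 h2]; rewrite ltr_pdivlMr// -[X in _ * X](gtr0_norm (al0 n)) -normrM.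
    by rewrite ltr_norml mulrBl; move: h1 h2; rewrite /b2_ => *; apply/andP; split; lra.
  - by rewrite a0 (le_trans (ltW ab)).
  - move=> n; have := alN n; have := mulr_ge0 (ltW (al0 n)) a0.
    have : 0 <= al n * (1 - b) by rewrite mulr_ge0 ?subr_ge0// ltW.
    by rewrite !mulrBr /b1_ => *; split; lra.
  - move=> n x /andP[h1 h2]; rewrite ltr_pdivlMr// -[X in _ * X](gtr0_norm (al0 n)) -normrM.
    by rewrite ltr_norml mulrBl; move: h1 h2; rewrite /b1_ => *; apply/andP; split; lra.
exact: (cvg_unique _ lim1 lim2).
Unshelve. all: by end_near. Qed.

End du_bois_reymond.

(** * Chain rule for absolutely continuous functions *)

Section absolutely_continuous.
Context (R : realType).
Local Notation mu := (@mu01 R).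
Local Notation leb := (@lebesgue_measure R).
Implicit Types (f g w : R -> R) (a b c x : R).

Lemma ge0_integral_mu01 (g : R -> \bar R) : measurable_fun setT g ->
  (forall x, 0 <= g x)%E -> (\int[mu]_x g x = \int[leb]_(x in `]0%R, 1%R[) g x)%E.
Proof.
move=> mg g0.
have m01 : measurable (`]0%R, 1%R[ : set (measurableTypeR R)) by exact: measurable_itv.
transitivity (\int[mu]_(x in `]0%R, 1%R[) g x)%E.
  rewrite [RHS]integral_mkcond; apply: ae_eq_integral => //.
    by apply/(measurable_restrictT _ m01); exact: measurable_funTS.
  by apply: mu01_ae => x x01 _; rewrite patchE mem_set//= in_itv.
apply: eq_measure_integral => A mA A01.
by rewrite /= /mu01 /mrestr setIidl.
Qed.

Lemma integrable_mu01_approx w : mu.-integrable setT (EFin \o w) ->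
  exists g_ : nat -> R -> R, (forall n, continuous (g_ n)) /\
    \int[mu]_x `|w x - g_ n x| @[n --> \oo] --> 0.
Proof.
move=> iw; have mw := integrable_measurable iw.
have iw' : leb.-integrable `]0, 1[ (EFin \o w).
  apply/integrableP; split; first by apply/measurable_EFinP; exact: measurable_funTS.
  have /integrableP[_] := iw; rewrite ge0_integral_mu01//.
  by apply: measurableT_comp => //; exact/measurable_EFinP.
have [//||g_ [cg ig lg]] := @approximation_continuous_integrable R `]0, 1[ w _ _ iw'.
  have := mu01_setT R; rewrite /mu01 /mrestr setTI => m01.
  by apply: (@le_lt_trans _ _ 1%E); [rewrite le_eqVlt; apply/orP; left; apply/eqP; exact: m01|exact: ltry].
exists g_; split=> //.
have /fine_cvg := lg; apply: cvg_trans; apply: near_eq_cvg; apply: nearW => n.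
rewrite /Rintegral ge0_integral_mu01//.
apply/measurable_EFinP; apply: measurableT_comp => //; apply: measurable_funB => //.
exact: continuous_measurable_fun.
Qed.

Lemma continuous_primitive g : continuous g ->
  exists2 F : R -> R, continuous F & forall x, 0 <= x -> is_derive x (1 : R) F (g x).
Proof.
(* The base point -1 makes 0 an interior point, so that the derivative at 0 is two-sided. *)
move=> cg; pose F0 x := \int[leb]_(t in `[-1, x]) g t.
have dF0 x : -1 < x -> is_derive x (1 : R) F0 (g x).
  move=> x1; have xx : x < x + 1 by rewrite ltrDl.
  have [||d e] := @continuous_FTC1_closed _ g (-1) x (x + 1) xx _ x1.
  - apply: continuous_compact_integrable; first exact: segment_compact.
    exact: continuous_subspaceT.
  - exact: cg.
  - by apply: DeriveDef; [exact: d|rewrite -derive1E; exact: e].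
(* Freezing the argument below -1/2 makes the primitive continuous on the whole line, without
   changing it near any x >= 0. *)
pose m x : R := Num.max x (- 2^-1).
have cm : continuous m.
  by move=> x; apply: (@continuous_max R R id (cst (- 2^-1))); [exact: cvg_id|exact: cvg_cst].
have m1 x : -1 < m x by rewrite lt_max; apply/orP; right; lra.
exists (F0 \o m).
  move=> x; apply: continuous_comp; first exact: cm.
  apply/differentiable_continuous/derivable1_diffP.
  by have [] := dF0 _ (m1 x).
move=> x x0; have x1 : -1 < x by lra.
apply: (near_eq_is_derive _ (dF0 x x1)); near=> y.
rewrite /= /m max_l// ltW//; near: y; apply: lt_nbhsr.
lra.
Unshelve. all: by end_near. Qed.

(* Approximating w by continuous functions in L^1 makes their primitives converge
   uniformly to f. *)
Lemma Rintegral_chain_rule (Phi phi : R -> R) (L al be : R) f w :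
  (forall a, is_derive a (1 : R) Phi (phi a)) -> continuous phi ->
  (forall a, `|phi a| <= L) -> (forall a b, `|Phi a - Phi b| <= L * `|a - b|) ->
  continuous f -> mu.-integrable setT (EFin \o w) ->
  (forall a b, 0 <= a -> a < b -> b <= 1 ->
     \int[mu]_x (w x * \1_(`]a, b[) x) = f b - f a) ->
  \int[mu]_x (be * Phi (f x) + (al + be * x) * phi (f x) * w x) =
  (al + be) * Phi (f 1) - al * Phi (f 0).
Proof.
move=> dPhi cphi phiL PhiL cf iw fw.
have L0 : 0 <= L by exact: le_trans (phiL 0).
have mw := integrable_measurable iw.
have cPhi : continuous Phi.
  by move=> x; apply/differentiable_continuous/derivable1_diffP; have [] := dPhi x.
have [g_ [cg lg]] := integrable_mu01_approx iw.
have /choice[F0 hF0] n : exists F : R -> R, continuous F /\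
    forall x, 0 <= x -> is_derive x (1 : R) F (g_ n x).
  by have [F ? ?] := continuous_primitive (cg n); exists F.
(* The primitives are shifted to agree with f at 0; the L^1 distance of the derivatives then bounds
   |f_ n - f| on all of [0, 1]. *)
pose f_ n x := F0 n x + (f 0 - F0 n 0).
have cf_ n : continuous (f_ n).
  by move=> x; apply: cvgD; [exact: (hF0 n).1|exact: cvg_cst].
have df_ n x : 0 <= x -> is_derive x (1 : R) (f_ n) (g_ n x).
  move=> x0; have h := (hF0 n).2 x x0.
  by apply: (is_derive_ext (is_deriveD h (is_derive_cst (f 0 - F0 n 0 : R) x (1 : R)))) => //; rewrite addr0.
have mg n : measurable_fun setT (g_ n) by exact: continuous_measurable_fun.
have iwg n : mu.-integrable setT (EFin \o (fun x => w x - g_ n x)).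
  have := integrableB measurableT iw (integrable_mu01_continuous (cg n)).
  exact: eq_integrable.
pose eps n := \int[mu]_x `|w x - g_ n x|.
have eps0 n : 0 <= eps n by apply: Rintegral_ge0.
have fn0 n : f_ n 0 = f 0 by rewrite /f_ addrC subrK.
have ind1 x : {ae mu, forall t, `|\1_(`]0, x[) t : R| <= 1}.
  by apply: nearW => t; rewrite indicE; case: (_ \in _); rewrite ?normr1 ?normr0.
have f_f n x : 0 <= x <= 1 -> `|f_ n x - f x| <= eps n.
  move=> /andP[]; rewrite le_eqVlt => /predU1P[<- _|x0 x1].
    by rewrite fn0 subrr normr0.
  have e1 : \int[mu]_t (g_ n t * \1_(`]0, x[) t) = f_ n x - f_ n 0.
    have h t : 0 <= t <= x -> is_derive t (1 : R) (f_ n) (g_ n t).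
      by move=> /andP[t0 _]; exact: df_.
    exact: (Rintegral_mu01_FTC (lexx 0) x0 x1 h (cg n)).
  have e2 := fw _ _ (lexx 0) x0 x1.
  have -> : f_ n x - f x = - \int[mu]_t ((w t - g_ n t) * \1_(`]0, x[) t).
    have i1 := integrableM_bounded (measurable_indic_oo 0 x) iw (ind1 x).
    have i2 := integrableM_bounded (measurable_indic_oo 0 x) (integrable_mu01_continuous (cg n)) (ind1 x).
    rewrite -[LHS]opprK; congr (- _); rewrite opprB.
    have -> : f x - f_ n x = (f x - f 0) - (f_ n x - f_ n 0) by rewrite fn0; ring.
    rewrite -e1 -e2 -RintegralB//.
    + by apply: eq_Rintegral => t _; rewrite mulrBl.
    + by apply: eq_integrable i1 => // t _ /=; rewrite mulrC.
    + by apply: eq_integrable i2 => // t _ /=; rewrite mulrC.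
  have i3 : mu.-integrable setT (EFin \o (fun t => (w t - g_ n t) * \1_(`]0, x[) t)).
    have := integrableM_bounded (measurable_indic_oo 0 x) (iwg n) (ind1 x).
    by apply: eq_integrable => // t _ /=; rewrite mulrC.
  rewrite normrN; apply: le_trans (le_normr_Rintegral _ i3) _ => //.
  apply: le_Rintegral => //; [exact: integrable_norm|exact: integrable_norm|].
  move=> t _; rewrite normrM -[leRHS]mulr1 ler_wpM2l//.
  by rewrite indicE; case: (_ \in _); rewrite ?normr1 ?normr0.
have [E E0 hE] : exists2 E : R, 0 < E & forall n, eps n <= E.
  have /cvgP/cvg_seq_bounded/pinfty_ex_gt0[E E0 hE] := lg.
  by exists E => // n; apply: le_trans (hE n I); exact: ler_norm.
have f_cvg x : 0 <= x <= 1 -> f_ n x @[n --> \oo] --> f x.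
  move=> x01; apply/cvgrPdist_le => e e0.
  have /cvgrPdist_le/(_ e e0) := lg; apply: filterS => n.
  rewrite sub0r normrN ger0_norm ?eps0// distrC; apply: le_trans; exact: f_f.
pose A x := al + be * x.
have cA : continuous A.
  by move=> x; apply: cvgD; [exact: cvg_cst|apply: cvgMr; exact: cvg_id].
have A1 x : 0 < x < 1 -> `|A x| <= `|al| + `|be|.
  move=> /andP[x0 x1]; rewrite (le_trans (ler_normD _ _))// lerD2l normrM.
  by rewrite -[leRHS]mulr1 ler_wpM2l// ger0_norm ltW.
(* Here w is kept in place of [g_ n], so that a multiple of |w|, plus a continuous function,
   dominates all [h n]. The price is the integral with [w x - g_ n x], which is at most (|al| +
   |be|) L times the L^1 distance. *)
pose h n x := be * Phi (f_ n x) + A x * phi (f_ n x) * w x.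
have cphif n : continuous (fun x => A x * phi (f_ n x)).
  move=> x; apply: cvgM; first exact: cA.
  by apply: continuous_comp; [exact: cf_|exact: cphi].
have cPhif n : continuous (fun x => be * Phi (f_ n x)).
  by move=> x; apply: cvgMr; apply: continuous_comp; [exact: cf_|exact: cPhi].
have bnd n : {ae mu, forall x, `|A x * phi (f_ n x)| <= (`|al| + `|be|) * L}.
  by apply: mu01_ae => x x01; rewrite normrM ler_pM// A1.
have ipw n v : mu.-integrable setT (EFin \o v) ->
    mu.-integrable setT (EFin \o (fun x => A x * phi (f_ n x) * v x)).
  by move=> iv; apply: (integrableM_bounded _ iv (bnd n)); exact: continuous_measurable_fun.
have ih n : mu.-integrable setT (EFin \o h n).
  have := integrableD measurableT (integrable_mu01_continuous (cPhif n)) (ipw n w iw).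
  exact: eq_integrable.
have e1 n : \int[mu]_x h n x - \int[mu]_x (A x * phi (f_ n x) * (w x - g_ n x)) =
    (al + be) * Phi (f_ n 1) - al * Phi (f_ n 0).
  rewrite -RintegralB//; last exact: ipw.
  have dG x : 0 <= x <= 1 -> is_derive x (1 : R) (fun x => A x * Phi (f_ n x))
      (be * Phi (f_ n x) + A x * phi (f_ n x) * g_ n x).
    move=> /andP[x0 _].
    have dA : is_derive x (1 : R) A be.
      have dA' : is_derive x (1 : R) (fun x : R => be * x + al) be.
        by apply: is_derive_eq; rewrite /GRing.scale/= mulr1 addr0.
      by apply: (is_derive_ext dA') => // y; rewrite addrC.
    have dC := @is_derive1_comp R Phi (f_ n) x _ _ (dPhi _) (df_ n x x0).
    by apply: (is_derive_ext (is_deriveM dA dC)) => //; rewrite /GRing.scale/=; ring.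
  transitivity (\int[mu]_x (be * Phi (f_ n x) + A x * phi (f_ n x) * g_ n x)).
    by apply: eq_Rintegral => x _; rewrite /h; ring.
  rewrite (Rintegral_mu01_FTC1 dG).
    by rewrite /A mulr1 mulr0 addr0.
  by move=> x; apply: cvgD; [exact: cPhif|apply: cvgM; [exact: cphif|exact: cg]].
have l1 : \int[mu]_x h n x @[n --> \oo] -->
    \int[mu]_x (be * Phi (f x) + A x * phi (f x) * w x).
  apply: (@Rintegral_dominated _ _ _ mu h _
    (fun x => `|be| * (`|Phi (f x)| + L * E) + (`|al| + `|be|) * L * `|w x|)).
  - by move=> n; exact: integrable_measurable (ih n).
  - apply: measurable_funD.
      by apply: continuous_measurable_fun => x; apply: cvgMr; apply: continuous_comp; [exact: cf|exact: cPhi].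
    apply: measurable_funM => //; apply: continuous_measurable_fun => x.
    by apply: cvgM; [exact: cA|apply: continuous_comp; [exact: cf|exact: cphi]].
  - have c1 : continuous (fun x => `|be| * (`|Phi (f x)| + L * E)).
      move=> x; apply: cvgMr; apply: cvgD; last exact: cvg_cst.
      by apply: cvg_norm; apply: continuous_comp; [exact: cf|exact: cPhi].
    have := integrableD measurableT (integrable_mu01_continuous c1)
      (integrableZl measurableT ((`|al| + `|be|) * L) (integrable_norm iw)).
    exact: eq_integrable.
  - apply: mu01_ae => x /andP[x0 x1].
    have fx : f_ n x @[n --> \oo] --> f x by apply: f_cvg; rewrite !ltW.
    apply: cvgD; first by apply: cvgMr; apply: continuous_cvg fx; exact: cPhi.
    by apply: cvgMl; apply: cvgMr; apply: continuous_cvg fx; exact: cphi.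
  - apply: mu01_ae => x x01 n; rewrite /h (le_trans (ler_normD _ _))// lerD//.
      rewrite normrM ler_wpM2l// -(subrK (Phi (f x)) (Phi (f_ n x))).
      rewrite (le_trans (ler_normD _ _))// addrC lerD2l (le_trans (PhiL _ _))// ler_wpM2l//.
      by apply: le_trans (f_f n x _) (hE n); move: x01 => /andP[? ?]; rewrite !ltW.
    by rewrite normrM ler_wpM2r// normrM ler_pM// A1.
have l2 : \int[mu]_x (A x * phi (f_ n x) * (w x - g_ n x)) @[n --> \oo] --> 0.
  apply/norm_cvg0P.
  apply: (@squeeze_cvgr _ _ _ _ (cst 0) (fun n => (`|al| + `|be|) * L * eps n)).
  - apply: nearW => n; rewrite normr_ge0 /=.
    apply: le_trans (le_normr_Rintegral _ (ipw n _ (iwg n))) _ => //.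
    rewrite /eps -RintegralZl//; last exact: integrable_norm.
    apply: ae_le_Rintegral.
    + exact/integrable_norm/ipw.
    + have := integrableZl measurableT ((`|al| + `|be|) * L) (integrable_norm (iwg n)).
      exact: eq_integrable.
    + by apply: ae_impl (bnd n) => x hx; rewrite normrM ler_wpM2r.
  - exact: cvg_cst.
  - by rewrite -[X in _ --> X](mulr0 ((`|al| + `|be|) * L)); apply: cvgMr; exact: lg.
have l3 : \int[mu]_x h n x - \int[mu]_x (A x * phi (f_ n x) * (w x - g_ n x)) @[n --> \oo] -->
    \int[mu]_x (be * Phi (f x) + A x * phi (f x) * w x).
  by rewrite -[X in _ --> X]subr0; exact: cvgB.
have l4 : (al + be) * Phi (f_ n 1) - al * Phi (f_ n 0) @[n --> \oo] -->
    (al + be) * Phi (f 1) - al * Phi (f 0).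
  by apply: cvgB; apply: cvgMr; apply: continuous_cvg; try exact: cPhi;
    apply: f_cvg; rewrite ?lexx ?ler01.
have e2 : (fun n => \int[mu]_x h n x - \int[mu]_x (A x * phi (f_ n x) * (w x - g_ n x))) =
    (fun n => (al + be) * Phi (f_ n 1) - al * Phi (f_ n 0)) by apply/funext.
rewrite e2 in l3.
exact: cvg_unique l3 l4.
Qed.

End absolutely_continuous.

(** * Density of C^1 functions vanishing at both ends *)

Section C1_density.
Context (R : realType).
Local Notation mu := (@mu01 R).
Implicit Types (f g w : R -> R) (x : R).

(** The projection onto [0, 1]: composing with it extends a function continuous within [0, 1] to one
    continuous on the line, with the same values on [0, 1]. *)
Definition clamp x : R := Num.max 0 (Num.min x 1).

Lemma clamp_itv x : 0 <= clamp x <= 1.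
Proof. by rewrite /clamp le_max lexx/= ge_max ler01/= ge_min lexx orbT. Qed.

Lemma clamp_id x : 0 <= x <= 1 -> clamp x = x.
Proof. by move=> /andP[x0 x1]; rewrite /clamp min_l// max_r. Qed.

Lemma clamp_continuous : continuous clamp.
Proof.
move=> x; apply: (@continuous_max R R (cst 0) (fun x => Num.min x 1)); first exact: cvg_cst.
by apply: (@continuous_min R R id (cst 1)); [exact: cvg_id|exact: cvg_cst].
Qed.

Lemma continuous_clamp f : {within `[0, 1], continuous f} -> continuous (f \o clamp).
Proof.
move=> /subspace_continuousP cf x.
have cc := @clamp_continuous x.
have /cf cfx : `[0, 1]%classic (clamp x) by rewrite /= in_itv/= clamp_itv.
apply: (@cvg_comp _ _ _ clamp f _ _ _ _ cfx) => P; rewrite /= /within /= => nP.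
have h : \forall y \near x, `[0, 1]%classic (clamp y) -> P (clamp y) by exact: cc _ nP.
suff : \forall y \near x, P (clamp y) by [].
by apply: filterS h => y; apply; rewrite /= in_itv/= clamp_itv.
Qed.

(** F is the moving average (P(x + d) - P(x)) / d of g, where P is a primitive and d = 1/(n+1),
    times the polynomial cutoff 1 - (1 - 2x)^(2n). The cutoff vanishes at 0 and 1 and tends to 1 in
    between; the mean value theorem expresses the average as a value of g. *)
Lemma cutoff_C1 g n : continuous g -> exists F f : R -> R,
  [/\ continuous F, continuous f,
      forall x, 0 <= x <= 1 -> is_derive x (1 : R) F (f x),
      F 0 = 0 /\ F 1 = 0 &
      forall x, 0 <= x <= 1 -> exists2 y, x < y < x + n.+1%:R^-1 &
        F x = (1 - ((1 - 2 * x) ^+ 2) ^+ n) * g y].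
Proof.
move=> cg; have [P cP dP] := continuous_primitive cg.
pose d : R := n.+1%:R^-1; have d0 : 0 < d by rewrite invr_gt0.
pose p : {poly R} := 1 - ((1 - 2%:P * 'X) ^+ 2) ^+ n.
have pE x : p.[x] = 1 - ((1 - 2 * x) ^+ 2) ^+ n.
  by rewrite /p hornerD hornerN !horner_exp hornerD hornerN hornerM !hornerC hornerX.
pose D x := (P (x + d) - P x) / d.
pose D' x := (g (x + d) - g x) / d.
have cs : continuous (fun x : R => x + d).
  by move=> x; apply: cvgD; [exact: cvg_id|exact: cvg_cst].
have cD : continuous D.
  move=> x; apply: cvgMl; apply: cvgB; last exact: cP.
  by apply: (@continuous_comp _ _ _ (fun x : R => x + d) P); [exact: cs|exact: cP].
have cD' : continuous D'.
  move=> x; apply: cvgMl; apply: cvgB; last exact: cg.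
  by apply: (@continuous_comp _ _ _ (fun x : R => x + d) g); [exact: cs|exact: cg].
have dD x : 0 <= x -> is_derive x (1 : R) D (D' x).
  move=> x0.
  have h1 : is_derive x (1 : R) (fun x : R => x + d) 1.
    by apply: (is_derive_ext (is_deriveD (is_derive_id x (1 : R)) (is_derive_cst d x (1 : R)))) => //; rewrite addr0.
  have xd : 0 <= x + d by rewrite addr_ge0// ltW.
  have h2 := @is_derive1_comp R P (fun x : R => x + d) x _ _ (dP _ xd) h1.
  have h3 := is_deriveZ d^-1 (is_deriveB h2 (dP x x0)).
  apply: (is_derive_ext h3) => [y|]; first by rewrite /D mulrC.
  by rewrite /GRing.scale/= mulr1 /D' mulrC.
exists (fun x => p.[x] * D x), (fun x => p^`().[x] * D x + p.[x] * D' x); split.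
- by move=> x; apply: cvgM; [exact: continuous_horner|exact: cD].
- move=> x; apply: cvgD; apply: cvgM; try exact: continuous_horner; try exact: cD; exact: cD'.
- move=> x /andP[x0 _].
  apply: (is_derive_ext (is_deriveM (is_derive_horner p x) (dD x x0))) => //.
  by rewrite /GRing.scale/=; ring.
- rewrite !pE mulr0 subr0 mulr1 !expr1n subrr mul0r; split => //.
  have -> : (1 - 2 : R) ^+ 2 = 1 by ring.
  by rewrite expr1n subrr mul0r.
- move=> x /andP[x0 _]; have xd : x < x + d by rewrite ltrDl.
  have h1 y : y \in `]x, x + d[ -> is_derive y (1 : R) P (g y).
    by rewrite in_itv/= => /andP[xy _]; apply: dP; rewrite (le_trans x0)// ltW.
  have h2 : {within `[x, x + d], continuous P} by exact: continuous_subspaceT.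
  have [y] := MVT xd h1 h2.
  rewrite in_itv/= => xy; rewrite addrAC subrr add0r => e; exists y => //.
  by rewrite pE /D e mulfK// gt_eqF.
Qed.

(** Vanishing at both ends is requested because the boundary condition of A then holds whatever the
    matrix [B]. The approximation passes through a continuous g, then through its cutoffs, by
    dominated convergence. *)
Lemma C1_dense w e : mu.-integrable setT (EFin \o w) -> 0 < e -> exists F f : R -> R,
  [/\ continuous F, continuous f,
      forall x, 0 <= x <= 1 -> is_derive x (1 : R) F (f x),
      F 0 = 0 /\ F 1 = 0 & \int[mu]_x `|w x - F x| < e].
Proof.
move=> iw e0; have e2 : 0 < e / 2 by rewrite divr_gt0.
have mw := integrable_measurable iw.
have [g_ [cg lg]] := integrable_mu01_approx iw.
have /cvgrPdist_lt/(_ _ e2)[N _ /(_ N (leqnn _))] := lg.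
rewrite sub0r normrN ger0_norm ?Rintegral_ge0// => hN.
set g := g_ N in hN; have cgN : continuous g by exact: cg.
have /choice[F hF] n := cutoff_C1 n cgN.
have cF n : continuous (F n) by have [f []] := hF n.
(* The intermediate point y of [cutoff_C1] lies beyond x by less than 1, hence the interval
   [0, 2]. *)
have cg02 : {within `[0, 2], continuous (fun x => `|g x|)}.
  by apply: continuous_subspaceT => x; apply: cvg_norm; exact: cgN.
have [c _ hc] := EVT_max (ler0n R 2) cg02.
have itv_chi (x : R) n : 0 <= x <= 1 -> 0 <= 1 - ((1 - 2 * x) ^+ 2) ^+ n <= 1.
  move=> /andP[x0 x1]; have s0 : 0 <= (1 - 2 * x) ^+ 2 by rewrite sqr_ge0.
  have s1 : (1 - 2 * x) ^+ 2 <= 1 by rewrite expr2; nra.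
  by rewrite subr_ge0 exprn_ile1//= gerBl exprn_ge0.
have lim : \int[mu]_x `|g x - F n x| @[n --> \oo] --> \int[mu]_x (fun=> 0 : R) x.
  apply: (@Rintegral_dominated _ _ _ mu (fun n x => `|g x - F n x|) _ (fun x => `|g x| + `|g c|)).
  - move=> n; apply: measurableT_comp => //; apply: measurable_funB; exact: continuous_measurable_fun.
  - exact: measurable_cst.
  - apply: integrable_mu01_continuous => x; apply: cvgD; last exact: cvg_cst.
    by apply: cvg_norm; exact: cgN.
  - apply: mu01_ae => x /andP[x0 x1]; apply/norm_cvg0P; rewrite -[X in _ --> X](subrr (g x)).
    apply: cvgB; first exact: cvg_cst.
    have x01 : 0 <= x <= 1 by rewrite !ltW.
    have /choice[y hy] n : exists y, x < y < x + n.+1%:R^-1 /\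
        F n x = (1 - ((1 - 2 * x) ^+ 2) ^+ n) * g y.
      by have [f [_ _ _ _ /(_ x x01)[y]]] := hF n; exists y.
    have -> : (fun n => F n x) = (fun n => (1 - ((1 - 2 * x) ^+ 2) ^+ n) * g (y n)).
      by apply/funext => n; exact: (hy n).2.
    rewrite -[X in _ --> X]mul1r; apply: cvgM.
      rewrite -[X in _ --> X]subr0; apply: cvgB; first exact: cvg_cst.
      by apply: cvg_expr; rewrite ger0_norm ?sqr_ge0// expr2; nra.
    apply: continuous_cvg; first exact: cgN.
    apply: (@squeeze_cvgr _ _ _ _ (cst x) (fun n => x + n.+1%:R^-1)).
    + by apply: nearW => n; have [/andP[h1 h2] _] := hy n; rewrite /= !ltW.
    + exact: cvg_cst.
    + rewrite -[X in _ --> X]addr0; apply: cvgD; [exact: cvg_cst|exact: cvg_harmonic].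
  - apply: mu01_ae => x /andP[x0 x1] n; rewrite normr_id (le_trans (ler_normB _ _))// lerD2l.
    have x01 : 0 <= x <= 1 by rewrite !ltW.
    have [f [_ _ _ _ /(_ x x01)[y /andP[xy yx] ->]]] := hF n.
    have /andP[h0 h1] := itv_chi x n x01.
    rewrite normrM (ger0_norm h0) -[leRHS]mul1r ler_pM// hc// in_itv/=.
    rewrite (ltW (lt_trans x0 xy)) (le_trans (ltW yx))//.
    have : (n.+1%:R^-1 : R) <= 1 by rewrite invf_le1// ler1n.
    by move: (n.+1%:R^-1 : R) => r; lra.
rewrite Rintegral_cst// mul0r in lim.
have /cvgrPdist_lt/(_ _ e2)[N' _ /(_ N' (leqnn _))] := lim.
rewrite sub0r normrN ger0_norm ?Rintegral_ge0// => hN'.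
have [f [? cf dF F01 _]] := hF N'.
exists (F N'), f; split => //.
have iwg : mu.-integrable setT (EFin \o (fun x => w x - g x)).
  have := integrableB measurableT iw (integrable_mu01_continuous cgN).
  exact: eq_integrable.
have cgF : continuous (fun x => g x - F N' x).
  by move=> x; apply: cvgB; [exact: cgN|exact: cF].
have iwF : mu.-integrable setT (EFin \o (fun x => w x - F N' x)).
  have := integrableB measurableT iw (integrable_mu01_continuous (cF N')).
  exact: eq_integrable.
have i1 := integrable_norm iwg.
have i2 := integrable_norm (integrable_mu01_continuous cgF).
apply: (@le_lt_trans _ _ (\int[mu]_x (`|w x - g x| + `|g x - F N' x|))).
  apply: le_Rintegral => //; first exact: integrable_norm.
    by have := integrableD measurableT i1 i2; apply: eq_integrable.
  by move=> x _; rewrite -(subrKA (g x)) ler_normD.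
by rewrite RintegralD// (splitr e) ltrD.
Qed.

End C1_density.

(** * Truncated powers *)

Section truncated_power.
Context (R : realType) (p : R) (p1 : 1 < p).

Let p0 : 0 < p. Proof. exact: lt_trans p1. Qed.
Let pm0 : 0 < p - 1. Proof. by rewrite subr_gt0. Qed.

(* |a|^p for |a| <= k, continued by its tangent lines: convex, C^1 and Lipschitz. *)
Definition tpow (k a : R) : R :=
  let s := Num.min `|a| k in s `^ p + p * s `^ (p - 1) * (`|a| - s).

Definition dtpow (k a : R) : R :=
  p * Num.sg a * (Num.min `|a| k) `^ (p - 1).

(** Young's inequality for b and s^(p-1), with exponents p and p / (p - 1). *)
Lemma powR_tangent (s b : R) : 0 <= s -> 0 <= b ->
  s `^ p + p * s `^ (p - 1) * (b - s) <= b `^ p.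
Proof.
move=> s0 b0.
have q0 : 0 < p / (p - 1) by rewrite divr_gt0.
have pq : p^-1 + (p / (p - 1))^-1 = 1.
  by rewrite invf_div; field; rewrite !gt_eqF.
have := conjugate_powR b0 (powR_ge0 s (p - 1)) p0 q0 pq.
rewrite -powRrM [(p - 1) * _]mulrC divfK ?gt_eqF//.
move=> /(ler_wpM2l (ltW p0)).
have <- := mulr_powRB1 s0 p0.
move: (s `^ (p - 1)) (b `^ p) => S B.
have -> : p * (B / p + s * S / (p / (p - 1))) = B + s * S * (p - 1).
  by field; rewrite !gt_eqF.
lra.
Qed.

Lemma tpow_le k a : 0 <= k -> tpow k a <= `|a| `^ p.
Proof. by move=> k0; apply: powR_tangent => //; rewrite le_min normr_ge0. Qed.

Lemma tpow_eq k a : `|a| <= k -> tpow k a = `|a| `^ p.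
Proof. by move=> ak; rewrite /tpow min_l// subrr mulr0 addr0. Qed.

Lemma tpow_ge0 k a : 0 <= tpow k a.
Proof.
rewrite /tpow addr_ge0 ?powR_ge0// mulr_ge0//.
  by rewrite mulr_ge0 ?powR_ge0// ltW.
by rewrite subr_ge0 ge_min lexx.
Qed.

(** The truncated power is the upper envelope of the tangents to t^p, in t = |b|, at the points s of
    [0, k]. Convexity and the scaling bound below both come from choosing s well. *)
Lemma tpow_sup k s b : 0 <= s <= k ->
  s `^ p + p * s `^ (p - 1) * (`|b| - s) <= tpow k b.
Proof.
move=> /andP[s0 sk]; rewrite /tpow; case: (leP `|b| k) => bk.
  by rewrite subrr mulr0 addr0 powR_tangent.
have k0 : 0 <= k by exact: le_trans sk.
have h1 := powR_tangent s0 k0.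
have h2 : p * s `^ (p - 1) * (`|b| - k) <= p * k `^ (p - 1) * (`|b| - k).
  rewrite ler_wpM2r ?subr_ge0 ?(ltW bk)// ler_wpM2l ?(ltW p0)//.
  by apply: ge0_ler_powR => //; rewrite ltW.
by move: h1 h2; rewrite !mulrBr; lra.
Qed.

Lemma tpow_tangent k a b : 0 <= k -> tpow k a + dtpow k a * (b - a) <= tpow k b.
Proof.
move=> k0.
have sk : 0 <= Num.min `|a| k <= k by rewrite le_min normr_ge0 k0 ge_min lexx orbT.
apply: le_trans (tpow_sup b sk); rewrite /tpow /dtpow.
set s := Num.min _ _; have S0 : 0 <= p * s `^ (p - 1).
  by rewrite mulr_ge0 ?powR_ge0// ltW.
have : Num.sg a * (b - a) <= `|b| - `|a|.
  rewrite mulrBr -normrEsg lerB//.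
  by case: (sgrP a) => ?; rewrite ?mul0r ?mul1r ?mulN1r ?ler_norm// -normrN ler_norm.
move=> /(ler_wpM2l S0).
by rewrite !mulrBr; lra.
Qed.

Lemma dtpow_le k a : 0 <= k -> `|dtpow k a| <= p * k `^ (p - 1).
Proof.
move=> k0; rewrite /dtpow !normrM (gtr0_norm p0) [X in _ * X](ger0_norm (powR_ge0 _ _)).
rewrite -mulrA ler_wpM2l ?(ltW p0)// -[leRHS]mul1r ler_pM ?powR_ge0//.
  by rewrite normr_sg; case: (_ != _).
by apply: ge0_ler_powR; rewrite ?nnegrE ?(ltW pm0) ?le_min ?normr_ge0 ?k0 ?ge_min ?lexx ?orbT.
Qed.

(** Compare with the tangent at s/l, where s is the contact point of [b]: by homogeneity it rescales
    to the tangent at s. The factor l^p does not involve k, which makes the final L^p estimate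
    uniform in the truncation. *)
Lemma tpow_doubling k l a b : 0 <= k -> 1 <= l -> `|b| <= l * `|a| ->
  tpow k b <= l `^ p * tpow k a.
Proof.
move=> k0 l1 bla; have l0 : 0 < l by exact: lt_le_trans l1.
set s := Num.min `|b| k.
have s0 : 0 <= s by rewrite le_min normr_ge0.
have sl0 : 0 <= s / l by rewrite divr_ge0// ltW.
have slk : s / l <= k.
  by rewrite ler_pdivrMr// (@le_trans _ _ k) ?ler_peMr// ge_min lexx orbT.
have {slk} : 0 <= s / l <= k by rewrite sl0.
move=> /(tpow_sup a) /(ler_wpM2l (powR_ge0 l p)); apply: le_trans.
have es : s = l * (s / l) by rewrite mulrC divfK ?gt_eqF.
have e1 : s `^ p = l `^ p * (s / l) `^ p by rewrite {1}es powRM// ltW.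
have e2 : s `^ (p - 1) = l `^ (p - 1) * (s / l) `^ (p - 1) by rewrite {1}es powRM// ltW.
rewrite /tpow -/s e1 e2 -(mulr_powRB1 (ltW l0) p0).
move: (powR_ge0 l (p - 1)) (powR_ge0 (s / l) (p - 1)).
move: (l `^ (p - 1)) ((s / l) `^ p) ((s / l) `^ (p - 1)) => x y z x0 z0.
have : p * x * z * `|b| <= p * x * z * (l * `|a|).
  by rewrite ler_wpM2l// !mulr_ge0// ltW.
rewrite [in X in _ -> X](_ : `|b| - s = `|b| - l * (s / l)); last by rewrite -es.
move: (s / l) `|a| `|b| => w A B; lra.
Qed.

Lemma tpow_dist k a b : 0 <= k ->
  `|tpow k a - tpow k b| <= p * k `^ (p - 1) * `|a - b|.
Proof.
move=> k0; have h1 := tpow_tangent a b k0; have h2 := tpow_tangent b a k0.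
have h3 : `|dtpow k a * (b - a)| <= p * k `^ (p - 1) * `|a - b|.
  by rewrite normrM [`|b - a|]distrC ler_wpM2r// dtpow_le.
have h4 : `|dtpow k b * (a - b)| <= p * k `^ (p - 1) * `|a - b|.
  by rewrite normrM ler_wpM2r// dtpow_le.
move: h3 h4; rewrite !ler_norml => /andP[? ?] /andP[? ?]; apply/andP; split; lra.
Qed.

Lemma continuous_posp_powR (r : R) : 0 < r -> continuous (fun x : R => (Num.max x 0) `^ r).
Proof.
move=> r0 a; case: (ltgtP a 0) => a0.
- apply: cvg_trans (@cvg_cst R ((Num.max a 0) `^ r) R (nbhs a) _).
  apply: near_eq_cvg; near=> x; rewrite /= !max_r// ltW//.
  by near: x; exact: lt_nbhsl.
- rewrite /continuous_at max_l ?(ltW a0)//.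
  have : {for a, continuous (fun x : R => x `^ r)}.
    apply: differentiable_continuous; apply/derivable1_diffP.
    by apply: derivable_powR; rewrite in_itv/= a0.
  apply: cvg_trans; apply: near_eq_cvg; near=> x; rewrite /= max_l// ltW//.
  by near: x; exact: lt_nbhsr.
- rewrite /continuous_at a0 maxxx powR0 ?gt_eqF//.
  apply/cvgrPdist_lt => e e0.
  have /cvgrPdist_lt/(_ e e0)[d /= d0 hd] := powR_cvg0 r0.
  exists d => //= x /= xd; case: (leP x 0) => x0; last exact: hd.
  by rewrite powR0 ?gt_eqF// subrr normr0.
Unshelve. all: by end_near. Qed.

Lemma continuous_dtpow k : 0 <= k -> continuous (dtpow k).
Proof.
move=> k0; pose h (x : R) := (Num.max x 0) `^ (p - 1).
pose m (x : R) : R := Num.min x k.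
(* The sign, discontinuous at 0, is absorbed by splitting into the contributions of the positive and
   negative parts of a; each is continuous because p - 1 > 0. *)
have -> : dtpow k = fun a => p * (h (m a) - h (m (- a))).
  apply/funext => a; rewrite /dtpow /m /h -mulrA; congr (_ * _).
  case: (ltgtP a 0) => a0.
  - rewrite ltr0_sg// ltr0_norm// [X in X `^ _ - _]max_r ?ge_min ?(ltW a0)//.
    by rewrite max_l ?le_min ?oppr_ge0 ?(ltW a0)// powR0 ?gt_eqF// sub0r mulN1r.
  - rewrite gtr0_sg// gtr0_norm// [X in _ - X `^ _]max_r ?ge_min ?oppr_le0 ?(ltW a0)//.
    by rewrite max_l ?le_min ?(ltW a0)// powR0 ?gt_eqF// subr0 mul1r.
  - by rewrite a0 sgr0 mul0r oppr0 subrr.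
have ch : continuous h by exact: continuous_posp_powR.
have cm : continuous m.
  by move=> x; apply: (@continuous_min R R id (cst k)); [exact: cvg_id|exact: cvg_cst].
move=> a; apply: cvgMr; apply: cvgB.
  by apply: continuous_comp; [exact: cm|exact: ch].
apply: (@continuous_comp _ _ _ (fun a => m (- a)) h); last exact: ch.
by apply: (@continuous_comp _ _ _ (fun a : R => - a) m); [exact: opp_continuous|exact: cm].
Qed.

End truncated_power.

(** The tangent inequalities at a and at a + h squeeze the difference quotient between f(a) and f(a
    + h). For [tpow] this spares a separate treatment of 0 and of the junctions at k and -k. *)
Lemma is_derive_tangent (R : realType) (F f : R -> R) (a : R) :
  (forall x y, F x + f x * (y - x) <= F y) -> {for a, continuous f} ->
  is_derive a (1 : R) F (f a).
Proof.
move=> tg fa.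
have h : h^-1 *: ((F \o shift a) (h *: (1 : R)) - F a) @[h --> 0^'] --> f a.
  have : {for 0, continuous (f \o shift a)}.
    apply: continuous_comp; first by apply: cvgD; [exact: cvg_id|exact: cvg_cst].
    by rewrite /= add0r.
  rewrite /prop_for /continuous_at /= add0r => /cvgrPdist_lt fc.
  apply/cvgrPdist_lt => e e0; have := nbhs_dnbhs (fc e e0).
  apply: filterS2 (nbhs_dnbhs_neq (0 : R)) => h h0.
  rewrite /= [h *: 1]mulr1 => hd; apply: le_lt_trans hd.
  have h1 := tg a (h + a); have h2 := tg (h + a) a.
  rewrite addrK in h1; rewrite opprD addrCA subrr addr0 mulrN in h2.
  set q := h^-1 *: _; have qE : F (h + a) = F a + h * q.
    by rewrite -[q]/(h^-1 * (F (h + a) - F a)) mulVKf// [RHS]addrC subrK.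
  rewrite {}qE in h1 h2; move: h0 h1 h2; move: q (f a) (f (h + a)) (F a) => q A B C h0 h1 h2.
  have [hp|hn] : 0 < h \/ h < 0 by apply/orP; rewrite orbC -neq_lt.
    have q1 : A <= q by rewrite -(ler_pM2l hp); lra.
    have q2 : q <= B by rewrite -(ler_pM2l hp); lra.
    by rewrite !ler0_norm ?subr_le0//; lra.
  have q1 : q <= A by rewrite -(ler_nM2l hn); lra.
  have q2 : B <= q by rewrite -(ler_nM2l hn); lra.
  by rewrite !ger0_norm ?subr_ge0//; lra.
by apply: DeriveDef; [apply/cvg_ex; exists (f a)|exact: cvg_lim].
Qed.

(** * Semigroups on normed spaces *)

Section abstract_semigroup.
Context (R : realType) (E : normedModType R).

(** Completeness tested only on sequences with geometrically small increments, the form that the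
    Riesz-Fischer argument proves directly. The factor 4 leaves room for the sum of two consecutive
    radii 2^-n and 2^-(n+1). *)
Definition rapid_complete := forall x : nat -> E,
  (forall n, `|x n.+1 - x n| <= 4 * 2^-1 ^+ n) -> exists l : E, x n @[n --> \oo] --> l.

Lemma cauchy_cvg_of_rapid : rapid_complete ->
  forall F : set_system E, ProperFilter F -> cauchy F -> cvg F.
Proof.
move=> rc F FF Fc.
have /choice [x Fx] : forall n : nat, exists x, F (ball x (2^-1 ^+ n : R)).
  by move=> n; apply: (cauchyP F).1 => //; rewrite exprn_gt0// invr_gt0.
have xr n : `|x n.+1 - x n| <= 4 * 2^-1 ^+ n.
  have [z [z1 z0]] : (ball (x n.+1) (2^-1 ^+ n.+1 : R) `&` ball (x n) (2^-1 ^+ n : R)) !=set0.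
    by apply: (@filter_ex _ F); apply: filterI; exact: Fx.
  move: z1 z0; rewrite -!ball_normE /= => z1 z0.
  rewrite -(subrKA z) (le_trans (ler_normD _ _))// [`|z - _|]distrC.
  rewrite (le_trans (lerD (ltW z1) (ltW z0)))// exprS.
  have : 0 <= (2^-1 : R) ^+ n by rewrite exprn_ge0// invr_ge0.
  lra.
have [l xl] := rc x xr.
apply/cvg_ex; exists l; apply/cvgrPdist_lt => e e0.
have e2 : 0 < e / 2 by rewrite divr_gt0.
have /cvgrPdist_lt/(_ _ e2) h1 := xl.
have h2 : \forall n \near \oo, `|0 - (2^-1 : R) ^+ n| < e / 2.
  move: e2; apply/(cvgrPdist_lt _ _).1; apply: cvg_expr.
  by rewrite ger0_norm ?invr_ge0// invf_lt1// ltr1n.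
have [n [n1 n2]] := @filter_ex _ \oo _ _ (filterI h1 h2).
apply: filterS (Fx n) => z; rewrite -ball_normE /= => xz.
rewrite -(subrKA (x n)) (le_lt_trans (ler_normD _ _))//.
rewrite [ltRHS](splitr e) ltrD// (lt_le_trans xz)//.
move: n2; rewrite sub0r normrN ger0_norm ?exprn_ge0 ?invr_ge0//.
exact: ltW.
Qed.

(** Banach-Steinhaus for E, repackaged as a complete space with its own norm; homogeneity turns the
    bound on the unit ball into an operator bound. *)
Lemma uniform_bound (F : set (E -> E)) : rapid_complete ->
  (forall f, F f -> linear f /\ continuous f) ->
  (forall x, exists M, forall f, F f -> `|f x| <= M) ->
  exists M, forall f, F f -> forall x, `|f x| <= M * `|x|.
Proof.
move=> rc lF pb.
pose V : completeNormedModType R := HB.pack (NormedModule.sort E)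
  (Uniform_isComplete.Build (NormedModule.sort E) (cauchy_cvg_of_rapid rc)).
have [] := @Banach_Steinhauss R V E F _ pb 1.
  move=> f /lF[lf cf]; split => //.
  pose g : {linear V -> E} := HB.pack f (GRing.isLinear.Build _ _ _ _ _ lf).
  have cg : continuous (g : V -> E) by exact: cf.
  have /linear_bounded_continuous/bounded_funP := cg.
  exact.
move=> M FM; exists M => f Ff x.
have [lf _] := lF f Ff.
pose g : {linear E -> E} := HB.pack f (GRing.isLinear.Build _ _ _ _ _ lf).
have [->|x0] := eqVneq x 0; first by have := linear0 g; rewrite /= => ->; rewrite normr0 mulr0.
have nx : 0 < `|x| by rewrite normr_gt0.
have : `|f (`|x|^-1 *: x)| <= M.
  by apply: FM => //; rewrite normrZ ger0_norm ?invr_ge0// mulVf// gt_eqF.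
have -> : f (`|x|^-1 *: x) = `|x|^-1 *: f x by exact: (linearZ_LR g).
by rewrite normrZ ger0_norm ?invr_ge0// mulrC ler_pdivrMr.
Qed.

Context (G : R -> E -> E) (GC : C0_semigroup G).

Let Glin t : 0 <= t -> linear (G t). Proof. by case: GC => h _ _ _ /h[]. Qed.

Lemma semigroupZ t a u : 0 <= t -> G t (a *: u) = a *: G t u.
Proof.
move=> /Glin lf.
pose g : {linear E -> E} := HB.pack (G t) (GRing.isLinear.Build _ _ _ _ _ lf).
exact: (linearZ_LR g).
Qed.

Lemma semigroupB t u v : 0 <= t -> G t (u - v) = G t u - G t v.
Proof.
move=> /Glin lf.
pose g : {linear E -> E} := HB.pack (G t) (GRing.isLinear.Build _ _ _ _ _ lf).
exact: (raddfB g).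
Qed.

(** Otherwise there are times t_n tending to 0 with the norm of G(t_n) exceeding n. Strong
    continuity at 0 makes each orbit along t_n convergent, hence bounded, against the uniform
    boundedness principle. *)
Lemma semigroup_bound_near0 : rapid_complete ->
  exists d M : R, 0 < d /\ forall t, 0 <= t <= d -> forall u, `|G t u| <= M * `|u|.
Proof.
move=> rc; apply: contrapT => /forallNP nb.
have /choice[t ht] : forall n : nat, exists t : R, 0 <= t <= n.+1%:R^-1 /\ ~ (forall u, `|G t u| <= n%:R * `|u|).
  move=> n; apply: contrapT => /forallNP h; apply: (nb n.+1%:R^-1).
  exists n%:R; split; first by rewrite invr_gt0.
  by move=> t tn u; apply: contrapT => hu; apply: (h t); split => // /(_ u).
have t0 n : 0 <= t n by have [/andP[]] := ht n.
have tcvg : t n @[n --> \oo] --> (0 : R).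
  apply: (@squeeze_cvgr _ _ _ _ (cst 0) (fun n => n.+1%:R^-1)).
  - by apply: nearW => n; have [] := ht n.
  - exact: cvg_cst.
  - exact: cvg_harmonic.
pose F := [set f | exists n, f = G (t n)].
have Flc f : F f -> linear f /\ continuous f.
  by move=> [n ->]; case: GC => + _ _ _; apply; exact: t0.
have Fpb x : exists M, forall f, F f -> `|f x| <= M.
  have [_ G0 _ /(_ x) Gx] := GC.
  have : G (t n) x @[n --> \oo] --> x.
    apply/cvgrPdist_lt => e e0.
    have /cvgrPdist_lt/(_ e e0)[d /= d0 hd] := Gx.
    have /cvgrPdist_lt/(_ d d0) := tcvg; apply: filterS => n /= nd.
    have := t0 n; rewrite le_eqVlt => /predU1P[<-|tn]; first by rewrite G0 subrr normr0.
    exact: hd.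
  move=> /cvgP/cvg_seq_bounded/pinfty_ex_gt0[M M0 hM].
  by exists M => _ [n ->]; exact: hM.
have [M FM] := uniform_bound rc Flc Fpb.
apply: (ht (Num.truncn M).+1).2 => u; rewrite (le_trans (FM _ _ u)) //.
  by exists (Num.truncn M).+1.
by rewrite ler_wpM2r// ltW// truncnS_gt.
Qed.

Lemma semigroup_bound : rapid_complete -> forall T, exists2 M : R, 0 < M &
  forall t, 0 <= t <= T -> forall u, `|G t u| <= M * `|u|.
Proof.
move=> rc T; have [d [M0 [d0 hM0]]] := semigroup_bound_near0 rc.
pose M := Num.max M0 1.
have M1 : 1 <= M by rewrite le_max lexx orbT.
have hM t : 0 <= t <= d -> forall u, `|G t u| <= M * `|u|.
  by move=> /hM0 h u; rewrite (le_trans (h u))// ler_wpM2r// le_max lexx.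
have hn n t : 0 <= t <= d *+ n -> forall u, `|G t u| <= M ^+ n * `|u|.
  elim: n t => [|n IH] t.
    move=> t0 u; have -> : t = 0 by apply/eqP; rewrite eq_le andbC; rewrite mulr0n in t0.
    by case: GC => _ -> _ _; rewrite expr0 mul1r.
  move=> /andP[t0 tn] u; have [td|/ltW td] := leP t d.
    by rewrite (le_trans (hM _ _ u)) ?t0// ler_wpM2r// exprS ler_peMr ?exprn_ege1// (le_trans _ M1).
  have -> : t = d + (t - d) by rewrite addrC subrK.
  have td0 : 0 <= t - d by rewrite subr_ge0.
  have [_ _ Gd _] := GC; rewrite Gd ?(ltW d0)//=.
  rewrite (le_trans (hM _ _ _)) ?lexx ?(ltW d0)// exprS -mulrA ler_wpM2l ?(le_trans _ M1)//.
  by apply: IH; rewrite td0 lerBlDr -mulrSr.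
exists (M ^+ (Num.truncn (T / d)).+1); first by rewrite exprn_gt0// (lt_le_trans ltr01).
move=> t /andP[t0 tT]; apply: hn; rewrite t0 (le_trans tT)//.
by rewrite -mulr_natr -ler_pdivrMl// mulrC ltW// truncnS_gt.
Qed.

Lemma generator_semigroup u v t : 0 <= t -> generator G (u, v) ->
  generator G (G t u, G t v).
Proof.
move=> t0; rewrite /generator /= => uv.
have [/(_ t t0)[_ Gc] _ Ga _] := GC.
apply: cvg_trans (continuous_cvg _ (Gc v) uv); apply: near_eq_cvg.
near=> h.
have h0 : 0 <= h by near: h; exact: nbhs_right_ge.
have Gth : G t (G h u) = G h (G t u).
  by rewrite -[LHS]/((G t \o G h) u) -Ga// addrC Ga.
by rewrite /comp semigroupZ// semigroupB// Gth.
Unshelve. all: by end_near. Qed.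

(* The first bound expands at the right end point, as the implicit Euler scheme requires. *)
Lemma generator_expansion u v : generator G (u, v) -> forall e, 0 < e ->
  exists2 d, 0 < d & forall h, 0 < h < d ->
    `|h *: G h v - (G h u - u)| <= e * h /\ `|h *: v - (G h u - u)| <= e * h.
Proof.
move=> uv e e0; have e2 : 0 < e / 2 by rewrite divr_gt0.
have [_ _ _ /(_ v) Gv] := GC.
have /cvgrPdist_lt/(_ _ e2)[d1 /= d10 h1] := Gv.
have /cvgrPdist_lt/(_ _ e2)[d2 /= d20 h2] := uv.
exists (Num.min d1 d2); first by rewrite lt_min d10.
move=> h /andP[h0]; rewrite lt_min => /andP[hd1 hd2].
have {}h1 : `|v - G h v| < e / 2 by apply: h1 => //=; rewrite sub0r normrN gtr0_norm.
have {}h2 : `|v - h^-1 *: (G h u - u)| < e / 2.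
  by apply: h2 => //=; rewrite sub0r normrN gtr0_norm.
have hv : `|h *: v - (G h u - u)| <= e / 2 * h.
  have -> : h *: v - (G h u - u) = h *: (v - h^-1 *: (G h u - u)).
    by rewrite [in RHS]scalerBr scalerA divff ?scale1r// gt_eqF.
  by rewrite normrZ gtr0_norm// mulrC ler_wpM2r ?(ltW h0)// ltW.
split; last by rewrite (le_trans hv)// ler_wpM2r ?(ltW h0)//; lra.
rewrite -(subrKA (h *: v)) (le_trans (ler_normD _ _))//.
rewrite -scalerBr normrZ (gtr0_norm h0) [X in _ * X + _]distrC.
have : h * `|v - G h v| <= h * (e / 2) by rewrite ler_wpM2l ?(ltW h0)// ltW.
lra.
Qed.

Let GD s t u : 0 <= s -> 0 <= t -> G (s + t) u = G s (G t u).
Proof. by case: GC => _ _ h _ s0 t0; rewrite h. Qed.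

Let GSn (h : R) i u : 0 <= h -> G (i.+1%:R * h) u = G (i%:R * h) (G h u).
Proof. by move=> h0; rewrite -GD ?mulr_ge0// -natr1 mulrDl mul1r. Qed.

Let exists_step (t d : R) : 0 < d -> exists n : nat, t / n.+1%:R < d.
Proof.
move=> d0; exists (Num.truncn (t / d)); rewrite ltr_pdivrMr//.
by rewrite mulrC -ltr_pdivrMr// truncnS_gt.
Qed.

(** Stands in for the formula expressing G t u - u as the integral of G s v over [0, t], with no
    vector-valued integration. The increments telescope; each one costs at most M e h / (M t), and
    the steps h add up to t. *)
Lemma semigroup_riemann_sum u v t e : rapid_complete -> generator G (u, v) ->
  0 <= t -> 0 < e -> exists n : nat,
    `|(t / n.+1%:R) *: (\sum_(i < n.+1) G (i%:R * (t / n.+1%:R)) v) - (G t u - u)| <= e.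
Proof.
move=> rc uv; rewrite le_eqVlt => /predU1P[<- e0|t0 e0].
  by exists 0%N; have [_ -> _ _] := GC; rewrite mul0r scale0r !subrr normr0 ltW.
have [M M0 hM] := semigroup_bound rc t.
have [|d d0 hd] := @generator_expansion u v uv (e / (M * t)).
  by rewrite divr_gt0// mulr_gt0.
have [n nd] := exists_step t d0; exists n.
set h := t / n.+1%:R.
have h0 : 0 < h by rewrite divr_gt0.
have nh : n.+1%:R * h = t by rewrite mulrC divfK.
have -> : G t u - u = \sum_(i < n.+1) (G (i.+1%:R * h) u - G (i%:R * h) u).
  rewrite -(big_mkord xpredT (fun i => G (i.+1%:R * h) u - G (i%:R * h) u)).
  rewrite telescope_sumr// nh mul0r.
  by have [_ -> _ _] := GC.
rewrite scaler_sumr -sumrB (le_trans (ler_norm_sum _ _ _))//.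
apply: (@le_trans _ _ (\sum_(i < n.+1) (M * (e / (M * t) * h)))).
  apply: ler_sum => i _.
  have ih : 0 <= i%:R * h by rewrite mulr_ge0// ltW.
  rewrite GSn ?(ltW h0)// -semigroupZ// -!semigroupB//.
  apply: le_trans (hM _ _ _) _.
    by rewrite ih -nh ler_wpM2r ?(ltW h0)// ler_nat ltnW.
  rewrite ler_wpM2l ?(ltW M0)//.
  by have [|_] := hd h; rewrite ?h0.
rewrite sumr_const card_ord -mulr_natl [X in X <= _](_ : _ = e)//.
rewrite mulrCA; rewrite [X in _ * X](_ : _ = e / (M * t) * t); last first.
  by rewrite -{3}nh mulrCA.
by field; rewrite (gt_eqF M0) gt_eqF.
Qed.

(** A discrete Gronwall argument along implicit Euler steps from an element of the domain, followed
    by approximation of a general u. Convexity enters only through the dissipation hypothesis;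
    otherwise [N] need only be nonnegative and Lipschitz. *)
Lemma semigroup_energy_bound (N : E -> R) (L w : R) : rapid_complete ->
  0 < L -> 0 < w -> (forall u, 0 <= N u) ->
  (forall u v, `|N u - N v| <= L * `|u - v|) ->
  (forall u v h, generator G (u, v) -> 0 <= h -> (1 - w * h) * N u <= N (u - h *: v)) ->
  (forall u e, 0 < e -> exists u' v', generator G (u', v') /\ `|u - u'| < e) ->
  forall t u, 0 <= t -> N (G t u) <= expR (2 * w * t) * N u.
Proof.
move=> rc L0 w0 N0 NL Ngen dns t u t0.
set K := expR _.
have K0 : 0 < K by rewrite expR_gt0.
have [M M0 hM] := semigroup_bound rc t.
have gen_bound x v : generator G (x, v) -> N (G t x) <= K * N x.
  move=> xv; move: t0; rewrite le_eqVlt => /predU1P[t0|t0].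
    by have [_ G0 _ _] := GC; rewrite /K -t0 G0 mulr0 expR0 mul1r.
  apply/ler_addgt0Pr => e e0.
  have D0 : 0 < K * (L * M * t) by rewrite !mulr_gt0.
  (* Tuned so that the consistency errors of all steps, amplified by M, L and K, add up to e
     exactly. *)
  have [|d d0 hd] := @generator_expansion x v xv (e / (K * (L * M * t))).
    by rewrite divr_gt0.
  (* The step must be below d, for the expansion, and satisfy w h < 1/2, for the comparison with the
     exponential. *)
  have [|n] := @exists_step t (Num.min d (2 * w)^-1).
    by rewrite lt_min d0 invr_gt0 mulr_gt0.
  rewrite lt_min => /andP[nd nw]; set h := t / n.+1%:R in nd nw.
  have h0 : 0 < h by rewrite divr_gt0.
  have nh : n.+1%:R * h = t by rewrite mulrC divfK.
  have wh : w * h < 2^-1.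
    by rewrite mulrC -ltr_pdivlMr// -invfM.
  set c := L * (M * (e / (K * (L * M * t)) * h)).
  have c0 : 0 <= c.
    by rewrite !mulr_ge0 ?invr_ge0// ltW// !mulr_gt0.
  set q := expR (2 * (w * h)).
  have q1 : 1 <= q.
    by rewrite (le_trans _ (expR_ge1Dx _))// lerDl !mulr_ge0// ltW.
  have step i : (i <= n.+1)%N -> N (G (i%:R * h) x) <= q ^+ i * (N x + i%:R * c).
    elim: i => [_|i IH ilt].
      by have [_ G0 _ _] := GC; rewrite !mul0r G0 addr0 expr0 mul1r.
    have ih : 0 <= i%:R * h by rewrite mulr_ge0// ltW.
    have h1 := Ngen _ _ h (generator_semigroup (mulr_ge0 (ler0n R i.+1) (ltW h0)) xv) (ltW h0).
    have h2 := NL (G (i.+1%:R * h) x - h *: G (i.+1%:R * h) v) (G (i%:R * h) x).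
    have h3 : `|G (i.+1%:R * h) x - h *: G (i.+1%:R * h) v - G (i%:R * h) x| <=
        M * (e / (K * (L * M * t)) * h).
      rewrite addrAC distrC !GSn ?(ltW h0)// -semigroupZ// -!semigroupB//.
      apply: le_trans (hM _ _ _) _.
        by rewrite ih -nh ler_wpM2r ?(ltW h0)// ler_nat ltnW.
      rewrite ler_wpM2l ?(ltW M0)//.
      by have [|+ _] := hd h; rewrite ?h0.
    have h4 : (1 - w * h) * N (G (i.+1%:R * h) x) <= q ^+ i * (N x + i%:R * c) + c.
      have := IH (ltnW ilt); have := ler_wpM2l (ltW L0) h3.
      move: h2; rewrite ler_norml -/c => /andP[_ h2]; lra.
    (* For 0 < x < 1/2 one has (1 + 2x)(1 - x) >= 1. This is the origin of the factor 2 in the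
       exponential rate. *)
    have h5 : 1 <= q * (1 - w * h).
      have : 1 + 2 * (w * h) <= q by exact: expR_ge1Dx.
      have wh0 : 0 < w * h by rewrite mulr_gt0.
      nra.
    have h6 : N (G (i.+1%:R * h) x) <= q * (q ^+ i * (N x + i%:R * c) + c).
      rewrite (le_trans (ler_peMl (N0 _) h5))// -mulrA ler_wpM2l//.
      exact: le_trans q1.
    rewrite (le_trans h6)// exprS -mulrA ler_wpM2l ?(le_trans _ q1)//.
    rewrite -natr1 mulrDl mul1r addrA [leRHS]mulrDr lerD2l ler_peMl//.
    exact: exprn_ege1.
  have := step n.+1 (leqnn _); rewrite nh => /le_trans; apply.
  have -> : q ^+ n.+1 = K.
    by rewrite /q -expRM_natl /K -nh; congr expR; ring.
  rewrite mulrDr lerD2l [X in X <= _](_ : _ = e)// /c /h.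
  have Kn : K != 0 by rewrite gt_eqF.
  have Ln : L != 0 by rewrite gt_eqF.
  have Mn : M != 0 by rewrite gt_eqF.
  have tn : t != 0 by rewrite gt_eqF.
  have nn : n.+1%:R != 0 :> R by [].
  by move: n.+1%:R nn => y nn; field; rewrite Kn Ln Mn tn nn.
apply/ler_addgt0Pr => e e0.
have D0 : 0 < K * L + L * M by rewrite addr_gt0// mulr_gt0.
have [|x [v [xv ux]]] := dns u (e / (K * L + L * M)); first by rewrite divr_gt0.
have h1 := gen_bound _ _ xv.
have /ler_normlP[_ h2] := NL (G t u) (G t x).
have /ler_normlP[h3 _] := NL u x.
have h4 : `|G t u - G t x| <= M * `|u - x| by rewrite -semigroupB// hM// t0 lexx.
have h5 := ler_wpM2l (ltW L0) h4.
have h6 : K * N x <= K * (N u + L * `|u - x|) by rewrite ler_wpM2l ?(ltW K0)//; lra.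
have h7 : (K * L + L * M) * `|u - x| <= e by rewrite mulrC -ler_pdivlMr// ltW.
lra.
Qed.

End abstract_semigroup.

(** * Completeness of L^1 and of its finite powers *)

Section L1_complete.
Context d (T : measurableType d) (R : realType) (mu : {measure set T -> \bar R}).

(** Riesz-Fischer: the sum S of the absolute increments is integrable, so the sequence converges
    wherever S is finite, and 2 S dominates its distance to the limit. *)
Lemma L1_rapid_complete : rapid_complete (LspaceType mu (lexx 1%E)).
Proof.
move=> x xr; pose f n := (x n : T -> R).
have mf n : measurable_fun setT (f n) by exact: Lspace_measurable.
pose a (n : nat) (t : T) : R := `|f n.+1 t - f n t|.
have ma n : measurable_fun setT (a n).
  by apply: measurableT_comp => //; exact: measurable_funB.
have a0 n t : 0 <= a n t by exact: normr_ge0.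
pose S t := (\sum_(0 <= n <oo) (a n t)%:E)%E.
have mS : measurable_fun setT S.
  by apply: ge0_emeasurable_sum => [n t _ _|n _]; [rewrite lee_fin|exact/measurable_EFinP].
have S0 t : (0 <= S t)%E by apply: nneseries_ge0 => n _ _; rewrite lee_fin.
have Sge n t : ((\sum_(0 <= k < n) a k t)%:E <= S t)%E.
  rewrite -sumEFin; apply: nneseries_lim_ge => k _ _.
  by rewrite lee_fin.
have Sfin : (\int[mu]_t S t < +oo)%E.
  rewrite integral_nneseries//; last 2 first.
  - by move=> n; exact/measurable_EFinP.
  - by move=> n t _; rewrite lee_fin.
  (* 8 is the sum of the geometric series 4 * 2^-n. *)
  apply: (@le_lt_trans _ _ (8%:E)%E); last exact: ltry.
  apply: lime_le.
    by apply: is_cvg_nneseries => n _ _; apply: integral_ge0 => t _; rewrite lee_fin.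
  apply: nearW => n.
  apply: (@le_trans _ _ (\sum_(0 <= k < n) (4 * 2^-1 ^+ k)%:E)%E).
    apply: lee_sum => k _.
    have ik : mu.-integrable setT (EFin \o (a k)).
      have h : mu.-integrable setT (EFin \o (fun t => f k.+1 t - f k t)).
        by have := integrableB measurableT (L1_integrable (x k.+1)) (L1_integrable (x k));
          apply: eq_integrable.
      exact: integrable_norm h.
    rewrite -[leLHS]fineK ?integrable_fin_num// lee_fin.
    by have := xr k; rewrite L1_distE.
  rewrite sumEFin lee_fin -mulr_sumr.
  have -> : \sum_(0 <= k < n) (2^-1 : R) ^+ k = 2 - 2 * 2^-1 ^+ n.
    elim: n => [|n IH]; first by rewrite big_geq// expr0 mulr1 subrr.
    by rewrite big_nat_recr//= IH exprS; lra.
  have : 0 <= (2^-1 : R) ^+ n by rewrite exprn_ge0// invr_ge0.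
  lra.
have iS : mu.-integrable setT S.
  by apply/integrableP; split => //; under eq_integral do rewrite gee0_abs//.
have Sae : {ae mu, forall t, S t \is a fin_num}.
  by have := integrable_ae measurableT iS; apply: filterS => t; apply.
have fcv t : S t \is a fin_num -> cvgn (fun n => f n t).
  move=> St.
  have ca : cvgn (series (fun n => a n t)).
    apply: nondecreasing_is_cvgn; first by apply: nondecreasing_series => n _ _.
    exists (fine (S t)) => _ [n _ <-]; rewrite -lee_fin fineK//; exact: Sge.
  have cb : cvgn (series (fun n => f n.+1 t - f n t)) by exact: normed_cvg.
  have -> : (fun n => f n t) = (fun n => f 0%N t + series (fun n => f n.+1 t - f n t) n).
    by apply/funext => n; rewrite /series/= telescope_sumr// addrC subrK.
  by apply: is_cvgD => //; exact: is_cvg_cst.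
pose g t := if S t \is a fin_num then lim (f n t @[n --> \oo]) else 0.
have mg : measurable_fun setT g.
  (* Cutting off the set where S is infinite makes the convergence pointwise everywhere, hence the
     limit measurable. *)
  pose h n t := f n t * \1_[set t | S t \is a fin_num] t.
  have mD : measurable [set t | S t \is a fin_num].
    by have := emeasurable_fin_num measurableT mS; rewrite setTI.
  apply: (@measurable_fun_cvg _ _ _ _ h) => //.
    by move=> n; apply: measurable_funM => //; exact: measurable_indic.
  move=> t _; rewrite /h /g indicE; case: ifPn => St.
    apply: cvg_trans (fcv t St); apply: near_eq_cvg; apply: nearW => n.
    by rewrite mem_set//= mulr1.
  rewrite -[X in _ --> X]/((fun=> 0) 0%N).
  apply: cvg_trans (@cvg_cst R 0 nat \oo _); apply: near_eq_cvg; apply: nearW => n.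
  by rewrite memNset ?mulr0//=; exact/negP.
have bnd0 t n : S t \is a fin_num -> `|f n t - f 0%N t| <= fine (S t).
  move=> St; rewrite -(telescope_sumr (fun k => f k t))//.
  rewrite -lee_fin fineK//; apply: le_trans (Sge n t).
  by rewrite lee_fin; exact: ler_norm_sum.
have bndg t : S t \is a fin_num -> `|g t - f 0%N t| <= fine (S t).
  move=> St; rewrite /g St.
  apply: (@closed_cvg _ _ \oo eventually_filter (fun n => `|f n t - f 0%N t|)
    [set y | y <= fine (S t)]); first exact: closed_le.
    by apply: nearW => n; exact: bnd0.
  by apply: cvg_norm; apply: cvgB; [exact: fcv|exact: cvg_cst].
have igS : mu.-integrable setT (EFin \o (fun t => fine (S t))).
  have mfS : measurable_fun setT (fun t => fine (S t)).
    by apply: measurableT_comp => //; exact: fine_measurable.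
  apply/integrableP; split; first exact/measurable_EFinP.
  apply: le_lt_trans Sfin; apply: ge0_le_integral => //.
  - by apply: measurableT_comp => //; exact/measurable_EFinP.
  - move=> t _; rewrite gee0_abs ?lee_fin ?fine_ge0//.
    by rewrite /=; move: (S0 t); case: (S t) => [r||] //= _; rewrite leey.
have ig : mu.-integrable setT (EFin \o g).
  apply: (@integrable_le _ _ _ _ _ (fun t => `|f 0%N t| + fine (S t))) => //.
    have := integrableD measurableT (integrable_norm (L1_integrable (x 0%N))) igS.
    by apply: eq_integrable.
  apply: filterS Sae => t /bndg; rewrite distrC -lerBlDl; apply: le_trans.
  by rewrite lerBlDl (le_trans _ (ler_normB _ _))// opprB addrC subrK.
have [l lg] := L1_class ig.
exists l; apply/cvgrPdist_lt => e e0.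
have : \int[mu]_t `|g t - f n t| @[n --> \oo] --> \int[mu]_t (fun=> 0 : R) t.
  apply: (@Rintegral_dominated _ _ _ _ _ _ (fun t => 2 * fine (S t))).
  - by move=> n; apply: measurableT_comp => //; exact: measurable_funB.
  - exact: measurable_cst.
  - by have := integrableZl measurableT 2 igS; apply: eq_integrable.
  - apply: filterS Sae => t St; apply/norm_cvg0P; rewrite -[X in _ --> X](subrr (g t)).
    by apply: cvgB; [exact: cvg_cst|rewrite /g St; exact: fcv].
  - apply: filterS Sae => t St n; rewrite normr_id.
    rewrite -(subrKA (f 0%N t)) (le_trans (ler_normD _ _))//.
    by have := bnd0 t n St; have := bndg t St; rewrite [`|f n t - _|]distrC; lra.
rewrite Rintegral_cst// mul0r => /cvgrPdist_lt/(_ e e0); apply: filterS => n.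
rewrite sub0r normrN ger0_norm ?Rintegral_ge0// => {}h; apply: le_lt_trans h.
rewrite L1_distE le_eqVlt; apply/orP; left; apply/eqP; apply: ae_eq_Rintegral.
- by apply: measurableT_comp => //; apply: measurable_funB => //; exact: Lspace_measurable.
- by apply: measurableT_comp => //; apply: measurable_funB.
- by apply: filterS lg => t h Dt; rewrite h.
Qed.

End L1_complete.

Lemma ffun_rapid_complete (R : realType) (I : finType) (E : normedModType R) :
  rapid_complete E -> rapid_complete {ffun I -> E}.
Proof.
move=> rc x xr.
have comp_le (f : {ffun I -> E}) i : `|f i| <= `|f|.
  by rewrite ffun_normE (bigD1 i)//= lerDl sumr_ge0.
have /choice[l xl] : forall i, exists l : E, x n i @[n --> \oo] --> l.
  move=> i; apply: rc => n; apply: le_trans (xr n).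
  by rewrite (le_trans _ (comp_le _ i))// !ffunE.
exists [ffun i => l i]; apply/cvgrPdist_lt => e e0.
have : \sum_i `|l i - x n i| @[n --> \oo] --> \sum_(i : I) (0 : R).
  apply: cvg_big => [|i _]; first exact: add_continuous.
  apply/norm_cvg0P; rewrite -[X in _ --> X](subrr (l i)).
  by apply: cvgB; [exact: cvg_cst|exact: xl].
rewrite big1// => /cvgrPdist_lt/(_ e e0); apply: filterS => n.
rewrite sub0r normrN ger0_norm ?sumr_ge0// ffun_normE => h.
by under eq_bigr do rewrite !ffunE.
Qed.

(** * Energy estimate for the transport operator *)

Section transport_energy.
Context (R : realType) (m mp : nat) (c : 'I_(2 * m) -> R -> R).
Hypothesis c_cont : forall j, {within `[0, 1], continuous (c j)}.
Hypothesis c_pos : forall j (x : R), x \in `[0, 1] -> 0 < c j x.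
Variable B : 'M[R]_(2 * m).
Local Notation mu := (@mu01 R).
Local Notation A := (transport_operator mp c B).
Implicit Types (j : 'I_(2 * m)) (x : R).

(** The speeds are controlled on [0, 1] only; this is a continuous positive extension to the
    line. *)
Let cc j x := c j (clamp x).

Let cc_cont j : continuous (cc j). Proof. exact: continuous_clamp. Qed.

Let cc_gt0 j x : 0 < cc j x.
Proof. by apply: c_pos; rewrite in_itv/= clamp_itv. Qed.

Let cc_id j x : 0 <= x <= 1 -> cc j x = c j x.
Proof. by move=> x01; rewrite /cc clamp_id. Qed.

Let bounded_clamp (f : 'I_(2 * m) -> R -> R) : (forall j, {within `[0, 1], continuous (f j)}) ->
  exists2 C : R, 0 < C & forall j x, f j (clamp x) <= C.
Proof.
move=> cf; have /choice[C hC] j : exists C : R, forall x, f j (clamp x) <= C.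
  have [y _ hy] := EVT_max ler01 (cf j).
  by exists (f j y) => x; apply: hy; rewrite in_itv/= clamp_itv.
exists (1 + \sum_j `|C j|); first by rewrite ltr_pwDl// sumr_ge0.
move=> j x; rewrite (le_trans (hC j x))// (le_trans (ler_norm _))//.
by rewrite (bigD1 j)//= addrCA lerDl addr_ge0// sumr_ge0.
Qed.

Lemma speed_bounds : exists2 C : R, 0 < C & forall j x, cc j x <= C /\ (cc j x)^-1 <= C.
Proof.
have [C1 C10 h1] := bounded_clamp c_cont.
have cV j : {within `[0, 1], continuous (fun x => (c j x)^-1)}.
  apply/subspace_continuousP => x x01; apply: cvgV.
    by rewrite gt_eqF//; apply: c_pos.
  by have /subspace_continuousP := @c_cont j; apply.
have [C2 C20 h2] := bounded_clamp cV.
by exists (C1 + C2) => [|j x]; [rewrite addr_gt0|split; [have := h1 j x|have := h2 j x]; rewrite /cc; lra].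
Qed.

(** C^1 functions vanishing at 0 and 1 satisfy the boundary condition trivially, both sides being
    0. *)
Lemma transport_dense (U : X1 R m) (e : R) : 0 < e ->
  exists u v, A (u, v) /\ `|U - u| < e.
Proof.
(* The successor keeps the quotient meaningful when m = 0 and makes the sum of the 2m component
   errors strictly smaller than e; the same device recurs below. *)
move=> e0; pose e' := e / (2 * m).+1%:R; have e'0 : 0 < e' by rewrite divr_gt0.
have /choice[Ff hFf] j : exists Ff : (R -> R) * (R -> R),
  [/\ continuous Ff.1, continuous Ff.2,
      forall x, 0 <= x <= 1 -> is_derive x (1 : R) Ff.1 (Ff.2 x),
      Ff.1 0 = 0 /\ Ff.1 1 = 0 & \int[mu]_x `|(U j : R -> R) x - Ff.1 x| < e'].
  have [F [f h]] := C1_dense (L1_integrable (U j)) e'0.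
  by exists (F, f).
have cF j : continuous (Ff j).1 by have [] := hFf j.
have cf j : continuous (Ff j).2 by have [] := hFf j.
pose s j x : R := if (j < mp)%N then - cc j x else cc j x.
have cs j : continuous (fun x => s j x * (Ff j).2 x).
  move=> x; apply: cvgM; last exact: cf.
  by rewrite /s; case: ifP => _; [apply: cvgN|]; exact: cc_cont.
have /choice[u hu] j := L1_class (integrable_mu01_continuous (cF j)).
have /choice[w hw] j := L1_class (integrable_mu01_continuous (cf j)).
have /choice[v hv] j := L1_class (integrable_mu01_continuous (cs j)).
exists [ffun j => u j], [ffun j => v j]; split.
- exists [ffun j => w j], (fun j => (Ff j).1); split.
  + move=> j; rewrite /= !ffunE; have [_ _ dF _ _] := hFf j.
    move=> phi tphi; have [cphi cphi'] := test_function_continuous tphi.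
    have := C1_weak_derivative (cF j) (cf j) dF tphi.
    have -> : \int[mu]_x ((u j : R -> R) x * phi^`()%classic x) =
        \int[mu]_x ((Ff j).1 x * phi^`()%classic x).
      apply: ae_eq_Rintegral.
      - by apply: measurable_funM; [exact: Lspace_measurable|exact: continuous_measurable_fun].
      - by apply: measurable_funM; exact: continuous_measurable_fun.
      - by apply: ae_impl (hu j) => x h Dx; rewrite h.
    have -> // : \int[mu]_x ((w j : R -> R) x * phi x) = \int[mu]_x ((Ff j).2 x * phi x).
      apply: ae_eq_Rintegral.
      - by apply: measurable_funM; [exact: Lspace_measurable|exact: continuous_measurable_fun].
      - by apply: measurable_funM; exact: continuous_measurable_fun.
      - by apply: ae_impl (hw j) => x h Dx; rewrite h.
  + by move=> j; rewrite /= ffunE; split; [exact: continuous_subspaceT|exact: hu].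
  + have F0 j : (Ff j).1 0 = 0 by have [_ _ _ []] := hFf j.
    have F1 j : (Ff j).1 1 = 0 by have [_ _ _ []] := hFf j.
    have z (b : 'I_(2 * m) -> bool) : \col_j (if b j then (Ff j).1 0 else (Ff j).1 1) = 0.
      by apply/colP => j; rewrite !mxE F0 F1; case: (b j).
    rewrite z [X in B *m X](_ : _ = 0) ?mulmx0//.
    by apply/colP => j; rewrite !mxE F0 F1; case: ifP.
  + move=> j; rewrite /= !ffunE.
    have h01 : {ae mu, forall x, cc j x = c j x}.
      by apply: mu01_ae => x /andP[x0 x1]; rewrite cc_id// !ltW.
    have h1 : {ae mu, forall x, (v j : R -> R) x = s j x * (Ff j).2 x /\ cc j x = c j x}.
      by apply: ae_impl2 (hv j) h01 => x h ?; split => //; exact: h.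
    apply: ae_impl2 (hw j) h1 => x hx [-> ccx] _.
    by rewrite hx// /s ccx.
- rewrite [X in X < _]ffun_normE; apply: (@le_lt_trans _ _ (\sum_(j < 2 * m) e')).
    apply: ler_sum => j _; rewrite !ffunE L1_distE; have [_ _ _ _ h] := hFf j.
    apply/ltW/(le_lt_trans _ h); rewrite le_eqVlt; apply/orP; left; apply/eqP.
    apply: ae_eq_Rintegral.
    + by apply: measurableT_comp => //; apply: measurable_funB; exact: Lspace_measurable.
    + by apply: measurableT_comp => //; apply: measurable_funB; [exact: Lspace_measurable|exact: continuous_measurable_fun].
    + by apply: ae_impl (hu j) => x hx Dx; rewrite hx.
  rewrite sumr_const card_ord -mulr_natl /e' mulrCA gtr_pMr// ltr_pdivrMr// mul1r.
  by rewrite ltr_nat.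
Qed.

Section energy.
Variables (Phi phi : R -> R) (L K C eps : R).
Hypothesis dPhi : forall a, is_derive a (1 : R) Phi (phi a).
Hypothesis cphi : continuous phi.
Hypothesis phiL : forall a, `|phi a| <= L.
Hypothesis PhiL : forall a b, `|Phi a - Phi b| <= L * `|a - b|.
Hypothesis tangent : forall a b, Phi a + phi a * (b - a) <= Phi b.
Hypothesis Phi0 : forall a, 0 <= Phi a.
Hypothesis PhiB : forall (y : 'I_(2 * m) -> R) j,
  Phi (\sum_i B j i * y i) <= K * \sum_i Phi (y i).
Hypothesis eps01 : 0 < eps <= 1.
Hypothesis epsK : (2 * m)%:R * K * eps <= 1.
Hypothesis C0 : 0 < C.
Hypothesis ccC : forall j x, cc j x <= C /\ (cc j x)^-1 <= C.

Let al j : R := if (j < mp)%N then eps else 1.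
Let be j : R := if (j < mp)%N then 1 - eps else - (1 - eps).

(** Dividing by the speed cancels the factor [c j] in A. Only the affine numerator is differentiated
    in the integration by parts, while [c j] is merely continuous. *)
Definition energy_weight j x : R := (al j + be j * clamp x) / cc j x.

Definition energy (u : X1 R m) : R :=
  \sum_j \int[mu]_x (energy_weight j x * Phi ((u j : R -> R) x)).

Let rho := energy_weight.

Let om_itv j x : eps <= al j + be j * clamp x <= 1.
Proof.
have /andP[x0 x1] := clamp_itv x; have /andP[e0 e1] := eps01.
by rewrite /al /be; case: ifP => _; apply/andP; split; nra.
Qed.

Let rho_cont j : continuous (rho j).
Proof.
move=> x; apply: cvgM.
  apply: cvgD; first exact: cvg_cst.
  by apply: cvgMr; exact: clamp_continuous.
by apply: cvgV; [rewrite gt_eqF|exact: cc_cont].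
Qed.

Let eps_gt0 : 0 < eps. Proof. by case/andP: eps01. Qed.

Let rho_itv j x : eps / C <= rho j x <= C.
Proof.
have /andP[h1 h2] := om_itv j x; have [h3 h4] := ccC j x.
have o0 : 0 <= al j + be j * clamp x by rewrite (le_trans (ltW eps_gt0)).
apply/andP; split.
  by rewrite ler_pM// ?invr_ge0 ?lef_pV2 ?posrE// ltW.
by rewrite -[leRHS]mul1r ler_pM// invr_ge0 ltW.
Qed.

Let rho_ge0 j x : 0 <= rho j x.
Proof. by have /andP[h _] := rho_itv j x; rewrite (le_trans _ h)// divr_ge0// ltW. Qed.

Let rho_norm j x : `|rho j x| <= C.
Proof. by rewrite ger0_norm//; have /andP[] := rho_itv j x. Qed.

Let L_ge0 : 0 <= L. Proof. exact: le_trans (phiL 0). Qed.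

Let cPhi : continuous Phi.
Proof. by move=> x; apply/differentiable_continuous/derivable1_diffP; have [] := dPhi x. Qed.

Let iPhi (f : R -> R) : mu.-integrable setT (EFin \o f) ->
  mu.-integrable setT (EFin \o (fun x => Phi (f x))).
Proof.
move=> fi; have mf := integrable_measurable fi.
apply: (@integrable_le _ _ _ mu _ (fun x => Phi 0 + L * `|f x|)).
- by apply: measurableT_comp => //; exact: continuous_measurable_fun.
- have c1 : continuous (fun _ : R => Phi 0) by move=> x; exact: cvg_cst.
  have := integrableD measurableT (integrable_mu01_continuous c1)
    (integrableZl measurableT L (integrable_norm fi)).
  exact: eq_integrable.
- apply: nearW => x; have /ler_normlP[_ h] := PhiL (f x) 0.
  by rewrite ger0_norm//; move: h; rewrite subr0; lra.
Qed.

Let irho j (f : R -> R) : mu.-integrable setT (EFin \o f) ->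
  mu.-integrable setT (EFin \o (fun x => rho j x * f x)).
Proof.
move=> fi; apply: (@integrableM_bounded _ _ _ mu _ _ C) => //.
  exact: (continuous_measurable_fun (@rho_cont j)).
by apply: nearW => x; exact: rho_norm.
Qed.

Let iE (u : X1 R m) j :
  mu.-integrable setT (EFin \o (fun x => rho j x * Phi ((u j : R -> R) x))).
Proof. exact/irho/iPhi/L1_integrable. Qed.

Lemma energy_ge0 u : 0 <= energy u.
Proof. by apply: sumr_ge0 => j _; apply: Rintegral_ge0 => x _; rewrite mulr_ge0. Qed.

(** This is what the truncation buys: for Phi = |a|^q with q > 1 the energy would not even be finite
    on X_1. *)
Lemma energy_lip u v : `|energy u - energy v| <= C * L * `|u - v|.
Proof.
rewrite ffun_normE mulr_sumr /energy -sumrB (le_trans (ler_norm_sum _ _ _))//.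
apply: ler_sum => j _; rewrite !ffunE L1_distE -RintegralB//.
have ib : mu.-integrable setT (EFin \o (fun x =>
    rho j x * Phi ((u j : R -> R) x) - rho j x * Phi ((v j : R -> R) x))).
  have := integrableB measurableT (iE u j) (iE v j); exact: eq_integrable.
have iuv : mu.-integrable setT (EFin \o (fun x => (u j : R -> R) x - (v j : R -> R) x)).
  have := integrableB measurableT (L1_integrable (u j)) (L1_integrable (v j)); exact: eq_integrable.
apply: le_trans (le_normr_Rintegral _ ib) _ => //.
rewrite -RintegralZl//; last exact: integrable_norm.
apply: le_Rintegral => //; first exact: integrable_norm.
  have := integrableZl measurableT (C * L) (integrable_norm iuv); exact: eq_integrable.
by move=> x _; rewrite -mulrBr normrM -mulrA ler_pM.
Qed.

Let Phi_le_energy_term (u : X1 R m) j : \int[mu]_x Phi ((u j : R -> R) x) <=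
  C / eps * \int[mu]_x (rho j x * Phi ((u j : R -> R) x)).
Proof.
rewrite -RintegralZl//; apply: le_Rintegral => //.
- by apply: iPhi; exact: L1_integrable.
- by have := integrableZl measurableT (C / eps) (iE u j); apply: eq_integrable.
- move=> x _; rewrite mulrA ler_peMl//.
  have /andP[h1 _] := rho_itv j x.
  have := ler_wpM2l (divr_ge0 (ltW C0) (ltW eps_gt0)) h1; apply: le_trans.
  by rewrite le_eqVlt; apply/orP; left; apply/eqP; field; rewrite (gt_eqF eps_gt0) gt_eqF.
Qed.

Lemma Phi_le_energy (u : X1 R m) j : \int[mu]_x Phi ((u j : R -> R) x) <= C / eps * energy u.
Proof.
apply: le_trans (Phi_le_energy_term u j) _.
rewrite ler_wpM2l ?divr_ge0 ?(ltW C0) ?(ltW eps_gt0)//.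
rewrite /energy (bigD1 j)//= lerDl sumr_ge0// => i _.
by apply: Rintegral_ge0 => x _; rewrite mulr_ge0.
Qed.

Lemma energy_le (u : X1 R m) : energy u <= C * \sum_j \int[mu]_x Phi ((u j : R -> R) x).
Proof.
rewrite mulr_sumr; apply: ler_sum => j _.
have iP := iPhi (L1_integrable (u j)).
rewrite -RintegralZl//; apply: le_Rintegral => //.
  by have := integrableZl measurableT C iP; apply: eq_integrable.
by move=> x _; rewrite ler_wpM2r//; have /andP[] := rho_itv j x.
Qed.

(** The sum of the [T j] below is the first-order variation of the energy in the direction v = A u.
    Convexity reduces the claim to bounding that sum by C / eps times the energy. *)
Lemma energy_dissipative u v h : A (u, v) -> 0 <= h ->
  (1 - C / eps * h) * energy u <= energy (u - h *: v).
Proof.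
move=> [w [f [uw uf bc vw]]] h0; rewrite /= in uw uf vw.
pose g j := f j \o @clamp R.
have cg j : continuous (g j) by apply: continuous_clamp; have [] := uf j.
have ug j : {ae mu, forall x, (u j : R -> R) x = g j x}.
  have h1 : {ae mu, forall x, g j x = f j x}.
    by apply: mu01_ae => x /andP[x0 x1]; rewrite /g /= clamp_id// !ltW.
  by apply: ae_impl2 (uf j).2 h1 => x h2 h3; rewrite h3 h2.
have ug' j : (u j : R -> R) = g j %[ae mu] by apply: ae_impl (ug j).
have mu_ j : measurable_fun [set: measurableTypeR R] (u j : R -> R) by exact: Lspace_measurable.
have iu j := L1_integrable (u j); have iv j := L1_integrable (v j); have iw j := L1_integrable (w j).
have g0 j : g j 0 = f j 0 by rewrite /g /= clamp_id// lexx ler01.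
have g1 j : g j 1 = f j 1 by rewrite /g /= clamp_id// lexx ler01.
pose inn j := if (j < mp)%N then f j 0 else f j 1.
pose out j := if (j < mp)%N then f j 1 else f j 0.
pose T j := \int[mu]_x (rho j x * phi ((u j : R -> R) x) * (v j : R -> R) x).
have mrp j : measurable_fun [set: measurableTypeR R] (fun x => rho j x * phi ((u j : R -> R) x)).
  apply: measurable_funM; first exact: (continuous_measurable_fun (@rho_cont j)).
  by apply: measurableT_comp => //; exact: continuous_measurable_fun.
have iT j : mu.-integrable setT (EFin \o (fun x =>
    rho j x * phi ((u j : R -> R) x) * (v j : R -> R) x)).
  apply: (@integrableM_bounded _ _ _ mu _ _ (C * L) (mrp j) (iv j)).
  by apply: nearW => x; rewrite normrM ler_pM.
(* The tangent inequality at u(x) for the increment -h v(x), weighted and integrated. *)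
have step j : \int[mu]_x (rho j x * Phi ((u j : R -> R) x)) - h * T j <=
    \int[mu]_x (rho j x * Phi (((u - h *: v) j : R -> R) x)).
  rewrite -RintegralZl// -RintegralB//; last first.
    by have := integrableZl measurableT h (iT j); apply: eq_integrable.
  apply: ae_le_Rintegral => //.
    have := integrableB measurableT (iE u j) (integrableZl measurableT h (iT j)).
    exact: eq_integrable.
  have e1 := LspaceBE (u j) (h *: v j); have e2 := LspaceZE h (v j).
  apply: ae_impl2 e1 e2 => x h1 h2; rewrite !ffunE h1// h2//.
  have := ler_wpM2l (rho_ge0 j x) (tangent ((u j : R -> R) x) ((u j : R -> R) x - h * (v j : R -> R) x)).
  by rewrite addrAC subrr add0r; lra.
(* Integration by parts. The sign of the speed in A and the slope of the weight change together
   between the two families, so both give the same formula in terms of inflow and outflow values. *)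
have Tj j : T j = eps * Phi (inn j) - Phi (out j) + (1 - eps) * \int[mu]_x Phi ((u j : R -> R) x).
  have iPg : mu.-integrable setT (EFin \o (fun x => Phi (g j x))).
    by apply: iPhi; exact: integrable_mu01_continuous.
  have bnd : {ae mu, forall x, `|(al j + be j * x) * phi (g j x)| <= L}.
    apply: mu01_ae => x /andP[x0 x1]; rewrite normrM -[leRHS]mul1r ler_pM//.
    have := om_itv j x; rewrite clamp_id ?(ltW x0) ?(ltW x1)// => /andP[q1 q2].
    by rewrite ger0_norm// (le_trans (ltW eps_gt0)).
  have mom : measurable_fun [set: measurableTypeR R] (fun x => (al j + be j * x) * phi (g j x)).
    apply: continuous_measurable_fun => x; apply: cvgM.
      by apply: cvgD; [exact: cvg_cst|apply: cvgMr; exact: cvg_id].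
    by apply: continuous_comp; [exact: cg|exact: cphi].
  have iow := integrableM_bounded mom (iw j) bnd.
  have chain : \int[mu]_x (be j * Phi (g j x) + (al j + be j * x) * phi (g j x) * (w j : R -> R) x) =
      (al j + be j) * Phi (g j 1) - al j * Phi (g j 0).
    apply: (Rintegral_chain_rule _ _ dPhi cphi phiL PhiL (cg j) (iw j)) => a b a0 ab b1.
    exact: (weak_derivative_int (mu_ j) (iw j) (uw j) (cg j) (ug' j) a0 ab b1).
  have ibP : mu.-integrable setT (EFin \o (fun x => be j * Phi (g j x))).
    have := integrableZl measurableT (be j) iPg; exact: eq_integrable.
  rewrite RintegralD// RintegralZl// g0 g1 in chain.
  pose s : R := if (j < mp)%N then -1 else 1.
  have -> : T j = s * \int[mu]_x ((al j + be j * x) * phi (g j x) * (w j : R -> R) x).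
    rewrite -RintegralZl//; apply: ae_eq_Rintegral.
    - exact: integrable_measurable (iT j).
    - by apply: measurable_funM => //; exact: integrable_measurable iow.
    - have h01 : {ae mu, forall x, 0 < x < 1} by exact: mu01_ae.
      have h02 : {ae mu, forall x, 0 < x < 1 /\ (u j : R -> R) x = g j x}.
        by apply: ae_impl2 h01 (ug j).
      apply: ae_impl2 (vw j) h02 => x hv [/andP[x0 x1] ->] _.
      have x01 : 0 <= x <= 1 by rewrite !ltW.
      rewrite hv// /rho /energy_weight clamp_id// cc_id//.
      have cn : c j x != 0 by rewrite -cc_id// gt_eqF.
      by rewrite /s; case: ifP => _; field.
  have -> : \int[mu]_x Phi ((u j : R -> R) x) = \int[mu]_x Phi (g j x).
    apply: ae_eq_Rintegral.
    - by apply: measurableT_comp => //; exact: continuous_measurable_fun.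
    - exact: integrable_measurable iPg.
    - by apply: ae_impl (ug j) => x ->.
  by move: chain; rewrite /s /inn /out /al /be; case: ifP => _; lra.
(* The inflow values are [B] applied to the outflow values, so each of the 2m inflow terms is at
   most K times the total outflow; [epsK] then lets the outflow absorb them. *)
have bdry : \sum_j (eps * Phi (inn j) - Phi (out j)) <= 0.
  have innE j : inn j = \sum_i B j i * out i.
    have /colP/(_ j) := bc; rewrite !mxE -/(inn j) => ->.
    by apply: eq_bigr => i _; rewrite mxE.
  have S0 : 0 <= \sum_i Phi (out i) by rewrite sumr_ge0.
  rewrite sumrB subr_le0 -mulr_sumr.
  apply: (@le_trans _ _ (eps * \sum_(j < 2 * m) (K * \sum_i Phi (out i)))).
    by rewrite ler_wpM2l ?(ltW eps_gt0)//; apply: ler_sum => j _; rewrite innE.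
  rewrite sumr_const card_ord -mulr_natl; have := ler_wpM2r S0 epsK.
  rewrite mul1r; apply: le_trans; move: (2 * m)%:R => y.
  by rewrite le_eqVlt; apply/orP; left; apply/eqP; ring.
(* Once the boundary terms are dropped, 1 - eps is bounded by 1 and the weight is bounded below by
   eps / C. *)
have E1 : \sum_j T j <= C / eps * energy u.
  under eq_bigr do rewrite Tj; rewrite big_split/= -mulr_sumr.
  have : \sum_j \int[mu]_x Phi ((u j : R -> R) x) <= C / eps * energy u.
    by rewrite /energy mulr_sumr; apply: ler_sum => j _; exact: Phi_le_energy_term.
  have : 0 <= \sum_j \int[mu]_x Phi ((u j : R -> R) x).
    by apply: sumr_ge0 => j _; exact: Rintegral_ge0.
  have /andP[e0 e1] := eps01.
  move: bdry; set X := \sum_j _; set Y := \sum_j _; nra.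
have E2 : energy u - h * \sum_j T j <= energy (u - h *: v).
  by rewrite /energy mulr_sumr -sumrB; apply: ler_sum.
have := ler_wpM2l h0 E1; lra.
Qed.

End energy.

End transport_energy.

(** * The semigroup on L^p *)

Section Lp_facts.
Context (R : realType) (p : R) (p1 : (1 <= p%:E)%E) (p1' : 1 < p).
Local Notation mu := (@mu01 R).
Local Notation Lp := (LspaceType mu p1).
Local Notation L1 := (LspaceType mu (lexx 1%E)).

Let p0 : 0 < p. Proof. exact: lt_trans p1'. Qed.

Definition to_L1 (u : Lp) : L1 := Lspace_Sub (lexx 1%E) (Lp_sub_L1 u).

Lemma measurable_powR_norm (f : R -> R) (q : R) : measurable_fun [set: measurableTypeR R] f ->
  measurable_fun [set: measurableTypeR R] (fun x => `|f x| `^ q).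
Proof.
move=> mf; apply: (measurableT_comp (measurable_powR q)) => //.
exact: measurableT_comp.
Qed.

Lemma Lp_integrable (u : Lp) : mu.-integrable setT (EFin \o (fun x => `|(u : R -> R) x| `^ p)).
Proof.
have uL := Lspace_predE (valP u).
by have := Lfun_integrable (ltW p1') uL; apply: eq_integrable.
Qed.

Lemma Lp_normE (u : Lp) : `|u| `^ p = \int[mu]_x `|(u : R -> R) x| `^ p.
Proof.
have h := Lspace_norm_fin u.
rewrite -[LHS]/(Lspace_norm u `^ p); apply: EFin_inj.
rewrite -poweR_EFin h powR_Lnorm ?gt_eqF// /Rintegral fineK.
  by apply: eq_integral => x _; rewrite -poweR_EFin.
exact: (integrable_fin_num measurableT (Lp_integrable u)).
Qed.

Lemma Lp_of_L1 (v : L1) : mu.-integrable setT (EFin \o (fun x => `|(v : R -> R) x| `^ p)) ->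
  exists u : Lp, to_L1 u = v.
Proof.
move=> iv.
have vP : (v : {mfun_ mu, measurableTypeR R >-> measurableTypeR R}) \in @Lspace_pred _ _ R mu p%:E.
  apply: mem_set => /=; rewrite /finite_norm unlock /Lnorm; apply: poweR_lty.
  have /integrableP[_] := iv; apply: le_lt_trans; rewrite le_eqVlt; apply/orP; left; apply/eqP.
  by apply: eq_integral => x _ /=; rewrite [X in _ = X%:E]ger0_norm ?powR_ge0// -poweR_EFin.
by exists (Lspace_Sub p1 vP); apply: val_inj.
Qed.

Lemma to_L1_inj : injective to_L1.
Proof. by move=> u v /(congr1 val) h; apply: val_inj. Qed.

Lemma to_L1B u v : to_L1 (u - v) = to_L1 u - to_L1 v.
Proof. exact: val_inj. Qed.

Lemma to_L1D u v : to_L1 (u + v) = to_L1 u + to_L1 v.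
Proof. exact: val_inj. Qed.

Lemma to_L1Z a u : to_L1 (a *: u) = a *: to_L1 u.
Proof. exact: val_inj. Qed.

Lemma Lp_norm_le (u : Lp) (e : R) : 0 <= e ->
  \int[mu]_x `|(u : R -> R) x| `^ p <= e `^ p -> `|u| <= e.
Proof.
move=> e0; rewrite -Lp_normE => h; rewrite leNgt; apply/negP => eu.
have := gt0_ltr_powR p0 (e0 : e \in Num.nneg) (normr_ge0 u : `|u| \in Num.nneg) eu.
by rewrite ltNge h.
Qed.

(* The sharp constant is 1; with 2 the inequality a <= 1 + a^p suffices. *)
Lemma to_L1_norm (u : Lp) : `|to_L1 u| <= 2 * `|u|.
Proof.
have [->|u0] := eqVneq u 0; first by rewrite (_ : to_L1 0 = 0) ?normr0 ?mulr0//; exact: val_inj.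
have d0 : 0 < `|u| by rewrite normr_gt0.
set d := `|u| in d0 *.
have iu := Lp_integrable u.
have c1 : continuous (fun _ : R => d) by move=> x; exact: cvg_cst.
have i1 := integrable_mu01_continuous c1.
have i2 : mu.-integrable setT (EFin \o (fun x => d / d `^ p * `|(u : R -> R) x| `^ p)).
  by have := integrableZl measurableT (d / d `^ p) iu; apply: eq_integrable.
rewrite L1_normE.
apply: (@le_trans _ _ (\int[mu]_x (d + d / d `^ p * `|(u : R -> R) x| `^ p))).
  apply: le_Rintegral => //.
  - exact: integrable_norm (L1_integrable (to_L1 u)).
  - by have := integrableD measurableT i1 i2; apply: eq_integrable.
  - move=> x _; rewrite -[X in X <= _]/`|(u : R -> R) x|; move: `|_ x| (normr_ge0 ((u : R -> R) x)) => a a0.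
    have [ad|/ltW da] := leP a d.
      by rewrite (le_trans ad)// lerDl mulr_ge0 ?powR_ge0// divr_ge0 ?powR_ge0// ltW.
    rewrite (@le_trans _ _ (d / d `^ p * a `^ p))// ?lerDr ?(ltW d0)//.
    have dp : 0 < d `^ p by rewrite powR_gt0.
    rewrite mulrAC ler_pdivlMr// -(mulr_powRB1 (ltW d0) p0) -(mulr_powRB1 a0 p0).
    rewrite mulrCA ler_wpM2l ?(ltW d0)// ler_wpM2l//.
    by apply: ge0_ler_powR; rewrite ?nnegrE ?subr_ge0 ?(ltW p1')// ?ltW.
rewrite RintegralD// RintegralZl// Rintegral_cst//.
have := mu01_setT R; rewrite /= => ->; rewrite /= mulr1 -Lp_normE -/d divfK.
  by rewrite mulr_natl mulr2n.
by rewrite gt_eqF// powR_gt0.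
Qed.

(** Fatou's lemma: at each point the truncated power equals |f(x)|^p as soon as k >= |f(x)|, so
    bounds uniform in k pass to the limit. *)
Lemma Lp_of_tpow (f : R -> R) (S : R) : measurable_fun [set: measurableTypeR R] f ->
  (forall k : nat, mu.-integrable setT (EFin \o (fun x => tpow p k%:R (f x)))) ->
  (forall k : nat, \int[mu]_x tpow p k%:R (f x) <= S) ->
  mu.-integrable setT (EFin \o (fun x => `|f x| `^ p)) /\ \int[mu]_x `|f x| `^ p <= S.
Proof.
move=> mf ik hk.
have S0 : 0 <= S by apply: le_trans (hk 0%N); apply: Rintegral_ge0 => x _; exact: tpow_ge0.
have mfp := measurable_powR_norm p mf.
have mk k : measurable_fun [set: measurableTypeR R] (fun x => (tpow p k%:R (f x))%:E).
  by apply/measurable_EFinP; exact: integrable_measurable (ik k).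
have fle : (\int[mu]_x (`|f x| `^ p)%:E <= S%:E)%E.
  have nk (k : nat) (x : measurableTypeR R) : setT x -> (0 <= (tpow p k%:R (f x))%:E)%E.
    by move=> _; rewrite lee_fin tpow_ge0.
  have := @fatou _ _ R mu setT measurableT (fun k x => (tpow p k%:R (f x))%:E) mk nk.
  have -> : (\int[mu]_x limn_einf (fun k => (tpow p k%:R (f x))%:E) = \int[mu]_x (`|f x| `^ p)%:E)%E.
    apply: eq_integral => x _; refine (cvg_limn_einf_sup _).1.
    apply: cvg_EFin; first exact: nearW.
    apply: cvg_trans (@cvg_cst R (`|f x| `^ p) nat \oo _); apply: near_eq_cvg; near=> k.
    rewrite /= tpow_eq// (le_trans (ltW (truncnS_gt _)))// ler_nat.
    by near: k; exact: nbhs_infty_ge.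
  move/le_trans; apply; rewrite limn_einf_lim; apply: lime_le; first exact: is_cvg_einfs.
  apply: nearW => k; apply: (@le_trans _ _ (\int[mu]_x (tpow p k%:R (f x))%:E)%E).
    by apply: ereal_inf_lbound; exists k => /=.
  rewrite -[leLHS]fineK ?lee_fin; first exact: hk.
  exact: (integrable_fin_num measurableT (ik k)).
have int_fin : (\int[mu]_x (`|f x| `^ p)%:E < +oo)%E by rewrite (le_lt_trans fle)// ltry.
split.
  apply/integrableP; split; first exact/measurable_EFinP.
  by under eq_integral do rewrite gee0_abs ?lee_fin ?powR_ge0//.
by rewrite -lee_fin /Rintegral fineK// ge0_fin_numE// integral_ge0.
Unshelve. all: by end_near. Qed.

Lemma integrable_tpow (k : nat) (f : R -> R) : mu.-integrable setT (EFin \o f) ->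
  mu.-integrable setT (EFin \o (fun x => tpow p k%:R (f x))).
Proof.
move=> fi; have mf := integrable_measurable fi.
have ct : continuous (tpow p k%:R).
  move=> x; apply/differentiable_continuous/derivable1_diffP.
  have h := is_derive_tangent (fun x y => tpow_tangent p1' x y (ler0n R k)) (@continuous_dtpow R p p1' k%:R (ler0n R k) x).
  by have [] := h.
apply: (@integrable_le _ _ _ mu _ (fun x => p * k%:R `^ (p - 1) * `|f x|)).
- by apply: measurableT_comp => //; exact: continuous_measurable_fun.
- have := integrableZl measurableT (p * k%:R `^ (p - 1)) (integrable_norm fi); exact: eq_integrable.
- apply: nearW => x; have := tpow_dist p1' (f x) 0 (ler0n R k).
  rewrite [tpow p k%:R 0]tpow_eq ?normr0 ?ler0n// powR0 ?gt_eqF// !subr0.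
  exact.
Qed.

(** At a fixed truncation level the integral is Lipschitz for the L^1 norm, so the bound passes to
    the L^1-limit directly, with no a.e. convergent subsequence; then [Lp_of_tpow] removes the
    truncation. *)
Lemma Lp_norm_lsc (z : nat -> Lp) (w : Lp) (e : R) : 0 <= e ->
  (forall n, `|z n| <= e) -> to_L1 (z n) @[n --> \oo] --> to_L1 w -> `|w| <= e.
Proof.
move=> e0 ze zw; apply: Lp_norm_le => //.
have mw : measurable_fun [set: measurableTypeR R] (w : R -> R) by exact: Lspace_measurable.
apply: (Lp_of_tpow mw _ _).2 => k; first exact: (integrable_tpow k (L1_integrable (to_L1 w))).
have itz n := integrable_tpow k (L1_integrable (to_L1 (z n))).
have itw := integrable_tpow k (L1_integrable (to_L1 w)).
apply/ler_addgt0Pr => d d0.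
set L := p * k%:R `^ (p - 1) + 1.
have L0 : 0 < L by rewrite ltr_wpDl// mulr_ge0 ?powR_ge0// ltW.
have /cvgrPdist_lt/(_ (d / L))[|N _ /(_ N (leqnn _))] := zw; first by rewrite divr_gt0.
rewrite L1_distE => hN.
have iwz : mu.-integrable setT (EFin \o (fun x => (w : R -> R) x - (z N : R -> R) x)).
  have := integrableB measurableT (L1_integrable (to_L1 w)) (L1_integrable (to_L1 (z N))).
  exact: eq_integrable.
have iL : mu.-integrable setT (EFin \o (fun x => L * `|(w : R -> R) x - (z N : R -> R) x|)).
  by have := integrableZl measurableT L (integrable_norm iwz); apply: eq_integrable.
apply: (@le_trans _ _ (\int[mu]_x (`|(z N : R -> R) x| `^ p +
    L * `|(w : R -> R) x - (z N : R -> R) x|))).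
  apply: le_Rintegral => //.
    by have := integrableD measurableT (Lp_integrable (z N)) iL; apply: eq_integrable.
  move=> x _; have := tpow_dist p1' ((w : R -> R) x) ((z N : R -> R) x) (ler0n R k).
  move=> /ler_normlP[_ h1]; have h2 := tpow_le p1' ((z N : R -> R) x) (ler0n R k).
  have h3 := normr_ge0 ((w : R -> R) x - (z N : R -> R) x).
  by rewrite /L mulrDl mul1r; lra.
rewrite RintegralD//; last exact: Lp_integrable.
rewrite RintegralZl//; last exact: integrable_norm.
rewrite lerD//; last by rewrite mulrC -ler_pdivlMr// ltW.
rewrite -Lp_normE; apply: ge0_ler_powR; rewrite ?nnegrE ?(ltW p0)//; exact: ze.
Qed.

End Lp_facts.

(** * Bounds in L^q for the given semigroup *)

Section transport_semigroup.
Context (R : realType) (m mp : nat) (c : 'I_(2 * m) -> R -> R).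
Hypothesis c_cont : forall j, {within `[0, 1], continuous (c j)}.
Hypothesis c_pos : forall j (x : R), x \in `[0, 1] -> 0 < c j x.
Variables (B : 'M[R]_(2 * m)) (G : R -> X1 R m -> X1 R m).
Hypothesis GC : C0_semigroup G.
Hypothesis Ggen : generator G = transport_operator mp c B.
Local Notation mu := (@mu01 R).
Implicit Types (j : 'I_(2 * m)).

Lemma X1_rapid_complete : rapid_complete (X1 R m).
Proof. exact: (ffun_rapid_complete (@L1_rapid_complete _ _ R mu)). Qed.

(** Each coordinate of B y is at most a constant times the largest |y_i|, so [tpow_doubling]
    applies. The summand 1 makes that constant at least 1, as the scaling bound requires. *)
Lemma tpow_mulmx (q k : R) (y : 'I_(2 * m) -> R) j : 1 < q -> 0 <= k ->
  tpow q k (\sum_i B j i * y i) <=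
  (1 + \sum_j \sum_i `|B j i|) `^ q * \sum_i tpow q k (y i).
Proof.
move=> q1 k0; set Lam := 1 + _.
have Lam1 : 1 <= Lam by rewrite lerDl; apply: sumr_ge0 => ? _; apply: sumr_ge0.
pose i0 := [arg max_(i > j) `|y i|]%O.
have yi0 i : `|y i| <= `|y i0|.
  by rewrite /i0; case: arg_maxP => // i1 _; apply.
apply: (@le_trans _ _ (Lam `^ q * tpow q k (y i0))).
  apply: tpow_doubling => //.
  apply: le_trans (ler_norm_sum _ _ _) _.
  apply: (@le_trans _ _ ((\sum_i `|B j i|) * `|y i0|)).
    by rewrite mulr_suml; apply: ler_sum => i _; rewrite normrM ler_wpM2l.
  rewrite ler_wpM2r// /Lam [X in 1 + X](bigD1 j)//= addrCA lerDl addr_ge0//.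
  by apply: sumr_ge0 => ? _; apply: sumr_ge0.
rewrite ler_wpM2l ?powR_ge0// (bigD1 i0)//= lerDl sumr_ge0// => i _.
exact: tpow_ge0.
Qed.

(** The energy bound is applied to every truncation level k. The factors of K are, in order, the
    passage from the energy to one component, the growth up to time T, and the passage from the
    components of u to the energy. *)
Lemma transport_Lp_bound (q T : R) : 1 < q -> exists2 K : R, 0 < K &
  forall t (u : X1 R m), 0 <= t <= T ->
    (forall i, mu.-integrable setT (EFin \o (fun x => `|(u i : R -> R) x| `^ q))) ->
  forall j, mu.-integrable setT (EFin \o (fun x => `|(G t u j : R -> R) x| `^ q)) /\
    \int[mu]_x `|(G t u j : R -> R) x| `^ q <=
    K * \sum_i \int[mu]_x `|(u i : R -> R) x| `^ q.
Proof.
move=> q1; have [C C0 hC] := speed_bounds c_cont c_pos.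
have q0 : 0 < q by exact: lt_trans q1.
pose KB := (1 + \sum_(j < 2 * m) \sum_i `|B j i|) `^ q.
have KB0 : 0 <= KB by exact: powR_ge0.
have D0 : 0 < (2 * m)%:R * KB + 1 by rewrite ltr_wpDl// mulr_ge0.
(* Small enough for the boundary absorption and, thanks to the summand 1, at most 1. It depends on
   m, [B] and q, but not on k. *)
pose eps := ((2 * m)%:R * KB + 1)^-1.
have eps0 : 0 < eps by rewrite invr_gt0.
have eps01 : 0 < eps <= 1 by rewrite eps0/= invf_le1// lerDr mulr_ge0.
have epsK : (2 * m)%:R * KB * eps <= 1 by rewrite ler_pdivrMr// mul1r lerDl.
exists (C / eps * (expR (2 * (C / eps) * T) * C)).
  by rewrite mulr_gt0 ?divr_gt0// mulr_gt0 ?expR_gt0.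
move=> t u /andP[t0 tT] iu j.
have mGu : measurable_fun [set: measurableTypeR R] (G t u j : R -> R) by exact: Lspace_measurable.
apply: (Lp_of_tpow q1 mGu) => k; first exact: (integrable_tpow q1 k (L1_integrable (G t u j))).
have k0 : 0 <= k%:R :> R by exact: ler0n.
(* The only constant depending on k; it enters as a Lipschitz constant and is absent from the
   resulting bound. The summand 1 keeps it positive at k = 0. *)
pose L := q * k%:R `^ (q - 1) + 1.
have L0 : 0 < L by rewrite ltr_wpDl// mulr_ge0 ?powR_ge0// ltW.
have dPhi a : is_derive a (1 : R) (tpow q k%:R) (dtpow q k%:R a).
  exact: (is_derive_tangent (fun x y => tpow_tangent q1 x y k0) (@continuous_dtpow R q q1 k%:R k0 a)).
have cphi := continuous_dtpow q1 k0.
have phiL a : `|dtpow q k%:R a| <= L.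
  by rewrite (le_trans (dtpow_le q1 a k0))// lerDl.
have PhiL a b : `|tpow q k%:R a - tpow q k%:R b| <= L * `|a - b|.
  by rewrite (le_trans (tpow_dist q1 a b k0))// ler_wpM2r// lerDl.
have tg a b : tpow q k%:R a + dtpow q k%:R a * (b - a) <= tpow q k%:R b by exact: tpow_tangent.
have Phi0 a : 0 <= tpow q k%:R a by exact: tpow_ge0.
have PhiB y i : tpow q k%:R (\sum_j B i j * y j) <= KB * \sum_j tpow q k%:R (y j).
  exact: tpow_mulmx.
pose N := energy mp c (tpow q k%:R) eps.
have N0 (v : X1 R m) : 0 <= N v.
  exact: (energy_ge0 mp c_pos Phi0 eps01 C0 hC).
have NL (v w : X1 R m) : `|N v - N w| <= C * L * `|v - w|.
  exact: (energy_lip mp c_cont c_pos dPhi PhiL Phi0 eps01 C0 hC).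
have Ngen (v w : X1 R m) (h : R) : generator G (v, w) -> 0 <= h -> (1 - C / eps * h) * N v <= N (v - h *: w).
  rewrite Ggen => vw h0.
  exact: (energy_dissipative c_cont c_pos dPhi cphi phiL PhiL tg Phi0 PhiB eps01 epsK C0 hC vw h0).
have dns (v : X1 R m) (e : R) : 0 < e -> exists v' w', generator G (v', w') /\ `|v - v'| < e.
  by rewrite Ggen; exact: transport_dense.
have EB := semigroup_energy_bound GC X1_rapid_complete (mulr_gt0 C0 L0)
  (divr_gt0 C0 eps0) N0 NL Ngen dns u t0.
have h1 := Phi_le_energy mp c_cont c_pos dPhi PhiL Phi0 eps01 C0 hC (G t u) j.
have h2 := energy_le mp c_cont c_pos dPhi PhiL Phi0 eps01 C0 hC u.
have h3 : \sum_i \int[mu]_x tpow q k%:R ((u i : R -> R) x) <= \sum_i \int[mu]_x `|(u i : R -> R) x| `^ q.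
  apply: ler_sum => i _; apply: le_Rintegral => //.
    exact: (integrable_tpow q1 k (L1_integrable (u i))).
  by move=> x _; exact: tpow_le.
apply: (le_trans h1); rewrite -[leRHS]mulrA ler_wpM2l//; first by rewrite divr_ge0 ?(ltW C0) ?(ltW eps0).
apply: (le_trans EB); rewrite -[leRHS]mulrA ler_pM ?expR_ge0//.
  by rewrite ler_expR ler_wpM2l// mulr_ge0// divr_ge0 ?(ltW C0) ?(ltW eps0).
by apply: (le_trans h2); rewrite ler_wpM2l// ltW.
Qed.

End transport_semigroup.

Lemma linear_le_continuous (R : realType) (E : normedModType R) (f : E -> E) (K : R) :
  linear f -> (forall x, `|f x| <= K * `|x|) -> continuous f.
Proof.
move=> lf fK x.
pose g : {linear E -> E} := HB.pack f (GRing.isLinear.Build _ _ _ _ _ lf).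
have gB y : f (x - y) = f x - f y by exact: (raddfB g).
have K0 : 0 < `|K| + 1 by rewrite ltr_wpDl.
apply/cvgrPdist_lt => e e0; near=> y.
rewrite -gB (le_lt_trans (fK _))//.
apply: (@le_lt_trans _ _ ((`|K| + 1) * `|x - y|)).
  by rewrite ler_wpM2r// (le_trans (ler_norm _))// lerDl.
rewrite mulrC -ltr_pdivlMr//; near: y.
by apply: cvgr_dist_lt; [exact: cvg_id|rewrite divr_gt0].
Unshelve. all: by end_near. Qed.

(** * Restriction to X_p for p > 1 *)

Section Lp_semigroup.
Context (R : realType) (m mp : nat) (c : 'I_(2 * m) -> R -> R).
Hypothesis c_cont : forall j, {within `[0, 1], continuous (c j)}.
Hypothesis c_pos : forall j (x : R), x \in `[0, 1] -> 0 < c j x.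
Variables (B : 'M[R]_(2 * m)) (G : R -> X1 R m -> X1 R m).
Hypothesis GC : C0_semigroup G.
Hypothesis Ggen : generator G = transport_operator mp c B.
Variables (p : R) (p1 : (1 <= p%:E)%E).
Hypothesis p1' : 1 < p.
Local Notation mu := (@mu01 R).
Local Notation Xp := (Xspace m p1).
Local Notation incl := (@X_incl R m p%:E p1).
Implicit Types (j : 'I_(2 * m)) (u v w : Xp) (t : R).

Let p0 : 0 < p. Proof. exact: lt_trans p1'. Qed.

Let inclE u j : incl u j = to_L1 (u j).
Proof. by rewrite ffunE. Qed.

Let incl_inj : injective incl.
Proof.
move=> u v /ffunP uv; apply/ffunP => j; have := uv j.
by rewrite !inclE; exact: to_L1_inj.
Qed.

Let inclB u v : incl (u - v) = incl u - incl v.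
Proof. by apply/ffunP => j; rewrite !ffunE -to_L1B. Qed.

Let inclD u v : incl (u + v) = incl u + incl v.
Proof. by apply/ffunP => j; rewrite !ffunE -to_L1D. Qed.

Let inclZ a u : incl (a *: u) = a *: incl u.
Proof. by apply/ffunP => j; rewrite !ffunE -to_L1Z. Qed.

Let incl_norm u : `|incl u| <= 2 * `|u|.
Proof.
rewrite !ffun_normE mulr_sumr; apply: ler_sum => j _.
by rewrite inclE to_L1_norm.
Qed.

Let comp_le (E : normedModType R) (u : {ffun 'I_(2 * m) -> E}) j : `|u j| <= `|u|.
Proof. by rewrite ffun_normE (bigD1 j)//= lerDl sumr_ge0. Qed.

Let norm_le_comp u (e : R) : (forall j, `|u j| <= e) -> `|u| <= (2 * m)%:R * e.
Proof.
move=> h; rewrite ffun_normE (le_trans (ler_sum _ (fun j _ => h j)))//.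
by rewrite sumr_const card_ord mulr_natl.
Qed.

Let incl_lsc (z : nat -> Xp) w (e : R) : 0 <= e -> (forall n, `|z n| <= e) ->
  incl (z n) @[n --> \oo] --> incl w -> `|w| <= (2 * m)%:R * e.
Proof.
move=> e0 ze zw; apply: norm_le_comp => j.
apply: (@Lp_norm_lsc R p p1 p1' (fun n => z n j)) => //.
  by move=> n; exact: le_trans (comp_le (z n) j) (ze n).
apply/cvgrPdist_lt => d d0; have /cvgrPdist_lt/(_ d d0) := zw.
apply: filterS => n; apply: le_lt_trans.
by have := comp_le (incl w - incl (z n)) j; rewrite !ffunE.
Qed.

Let incl_range t u : 0 <= t -> exists v, incl v = G t (incl u).
Proof.
move=> t0; have [K K0 hK] := transport_Lp_bound c_cont c_pos GC Ggen t p1'.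
have iu i : mu.-integrable setT (EFin \o (fun x => `|(incl u i : R -> R) x| `^ p)).
  by rewrite inclE; exact: (Lp_integrable p1' (u i)).
have tt : 0 <= t <= t by rewrite t0 lexx.
have /choice[v hv] j : exists v : LspaceType mu p1, to_L1 v = G t (incl u) j.
  by apply: Lp_of_L1; have [] := hK t (incl u) tt iu j.
by exists [ffun j => v j]; apply/ffunP => j; rewrite inclE ffunE hv.
Qed.

(** The preimage is unique because the inclusion is injective, and exists for t >= 0 by the L^p
    bound; the default 0 can only occur at negative times. *)
Definition restricted_semigroup t u : Xp :=
  if pselect (exists v, incl v = G t (incl u)) is left h then projT1 (cid h) else 0.

Local Notation Gp := restricted_semigroup.

Lemma restricted_semigroupE t u : 0 <= t -> incl (Gp t u) = G t (incl u).
Proof.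
move=> t0; rewrite /Gp; case: pselect => [h|]; first exact: projT2 (cid h).
by move=> /(_ (incl_range u t0)).
Qed.

Let GpL t : 0 <= t -> linear (Gp t).
Proof.
move=> t0 a u v; apply: incl_inj.
rewrite inclD inclZ !restricted_semigroupE// inclD inclZ.
by have [/(_ t t0)[lG _] _ _ _] := GC; rewrite lG.
Qed.

Let GpB t u v : 0 <= t -> Gp t (u - v) = Gp t u - Gp t v.
Proof.
move=> t0; apply: incl_inj.
by rewrite inclB !restricted_semigroupE// inclB (semigroupB GC).
Qed.

Let Gp_bound (T : R) : exists2 K : R, 0 < K & forall t u, 0 <= t <= T -> `|Gp t u| <= K * `|u|.
Proof.
have [K K0 hK] := transport_Lp_bound c_cont c_pos GC Ggen T p1'.
(* From the bound K times the sum of the p-th powers of the 2m component norms, each at most |u|^p,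
   by taking p-th roots. *)
pose K1 := (K * (2 * m)%:R) `^ p^-1.
exists ((2 * m)%:R * K1 + 1); first by rewrite ltr_wpDl// mulr_ge0 ?powR_ge0.
move=> t u tT; have t0 : 0 <= t by case/andP: tT.
apply: (@le_trans _ _ ((2 * m)%:R * (K1 * `|u|))); last first.
  by rewrite mulrDl mul1r mulrA lerDl.
apply: norm_le_comp => j; apply: (Lp_norm_le p1') => //.
  by rewrite mulr_ge0 ?powR_ge0.
have iu i : mu.-integrable setT (EFin \o (fun x => `|(incl u i : R -> R) x| `^ p)).
  by rewrite inclE; exact: (Lp_integrable p1' (u i)).
have [_] := hK t (incl u) tT iu j.
rewrite -restricted_semigroupE// inclE => /le_trans; apply.
rewrite powRM ?powR_ge0// -powRrM mulVf ?gt_eqF// powRr1; last by rewrite mulr_ge0// ltW.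
rewrite -mulrA ler_wpM2l ?(ltW K0)//.
apply: (@le_trans _ _ (\sum_(i < 2 * m) `|u| `^ p)); last first.
  by rewrite sumr_const card_ord mulr_natl.
apply: ler_sum => i _; rewrite inclE -[X in X <= _](Lp_normE p1').
by apply: ge0_ler_powR; rewrite ?nnegrE ?(ltW p0)//; exact: comp_le.
Qed.

(** An additive substitute for Hölder interpolation: the first term covers a <= M, the second a >
    M. *)
Let powR_interp (a M : R) : 0 <= a -> 0 < M ->
  a `^ p <= M `^ (p - 1) * a + M^-1 * a `^ (p + 1).
Proof.
move=> a0 M0; have e1 := mulr_powRB1 a0 p0.
have pp : 0 < p + 1 by rewrite addr_gt0.
have e2 := mulr_powRB1 a0 pp; rewrite addrK in e2.
case: (leP a M) => aM.
  rewrite -e1 mulrC (@le_trans _ _ (M `^ (p - 1) * a))//.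
    rewrite ler_wpM2r//; apply: ge0_ler_powR; rewrite ?nnegrE ?subr_ge0 ?(ltW p1') ?(ltW M0)//.
  by rewrite lerDl mulr_ge0 ?powR_ge0// invr_ge0 ltW.
rewrite (@le_trans _ _ (M^-1 * a `^ (p + 1)))//.
  by rewrite mulrC ler_pdivlMr// -e2 mulrC ler_wpM2r ?powR_ge0// ltW.
by rewrite lerDr mulr_ge0 ?powR_ge0.
Qed.

Let powR_distr (a b q : R) : 0 < q -> `|a - b| `^ q <= 2 `^ q * (`|a| `^ q + `|b| `^ q).
Proof.
move=> q0; pose M := Num.max `|a| `|b|.
have M0 : 0 <= M by rewrite le_max normr_ge0.
apply: (@le_trans _ _ ((2 * M) `^ q)).
  apply: ge0_ler_powR; rewrite ?nnegrE ?(ltW q0) ?mulr_ge0//.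
  rewrite (le_trans (ler_normB _ _))// mulr_natl mulr2n lerD// le_max lexx ?orbT//.
rewrite powRM// ler_wpM2l ?powR_ge0// /M.
by case: (leP `|a| `|b|) => _; rewrite ?lerDl ?lerDr powR_ge0.
Qed.

(** On [0, 1] the integral of |u - Gp t u|^(p+1) stays below a constant D. In [powR_interp] a large
    M makes this part small uniformly in t; with M fixed, the L^1 part tends to 0 by strong
    continuity of G. *)
Let bounded_cvg u : (forall j, mu.-integrable setT (EFin \o (fun x => `|(u j : R -> R) x| `^ (p + 1)))) ->
  Gp t u @[t --> 0^'+] --> u.
Proof.
move=> iq; have q1 : 1 < p + 1 by rewrite ltrDr.
have q0 : 0 < p + 1 by exact: lt_trans q1.
have [K K0 hK] := transport_Lp_bound c_cont c_pos GC Ggen 1 q1.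
have iq' i : mu.-integrable setT (EFin \o (fun x => `|(incl u i : R -> R) x| `^ (p + 1))).
  by rewrite inclE; exact: iq.
pose S := \sum_i \int[mu]_x `|(incl u i : R -> R) x| `^ (p + 1).
have S0 : 0 <= S by apply: sumr_ge0 => i _; apply: Rintegral_ge0 => x _; exact: powR_ge0.
pose D := 2 `^ (p + 1) * (K * S + S).
have D0 : 0 <= D by rewrite mulr_ge0 ?powR_ge0// addr_ge0// mulr_ge0// ltW.
apply/cvgrPdist_lt => e e0.
pose e1 := e / (2 * m).+1%:R; have e10 : 0 < e1 by rewrite divr_gt0.
have e1p : 0 < e1 `^ p by rewrite powR_gt0.
(* Chosen so that D / M is at most half of the target e1^p; the other half is left to the L^1
   part. *)
pose M := 2 * D / e1 `^ p + 1.
have M0 : 0 < M by rewrite ltr_wpDl// divr_ge0 ?powR_ge0// mulr_ge0.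
have DM : M^-1 * D <= e1 `^ p / 2.
  rewrite mulrC ler_pdivrMr// /M mulrDr mulr1.
  have -> : e1 `^ p / 2 * (2 * D / e1 `^ p) = D by field; rewrite gt_eqF.
  by rewrite lerDl divr_ge0// ltW.
have Mp0 : 0 < M `^ (p - 1) by rewrite powR_gt0.
have [_ _ _ /(_ (incl u))/cvgrPdist_lt/(_ (e1 `^ p / 2 / M `^ (p - 1)))] := GC.
move=> /(_ _)[|d /= d0 hd]; first by rewrite !divr_gt0.
near=> t.
have t0 : 0 < t by near: t; exact: nbhs_right_gt.
have t1 : t <= 1 by near: t; apply: nbhs_right_le.
have td : `|0 - t| < d.
  by rewrite sub0r normrN gtr0_norm//; near: t; apply: nbhs_right_lt.
have {}hd := hd t td t0.
apply: (@le_lt_trans _ _ ((2 * m)%:R * e1)); last first.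
  by rewrite /e1 mulrCA gtr_pMr// ltr_pdivrMr// mul1r ltr_nat.
apply: norm_le_comp => j; apply: (Lp_norm_le p1') => //; first exact: ltW.
set w := (u - Gp t u) j.
have t01 : 0 <= t <= 1 by rewrite ltW.
have [iG hG] := hK t (incl u) t01 iq' j.
rewrite -restricted_semigroupE ?(ltW t0)// inclE in iG hG.
have wE : (w : R -> R) = (fun x => (u j : R -> R) x - (Gp t u j : R -> R) x) %[ae mu].
  by rewrite /w !ffunE; exact: LspaceBE.
have mw : measurable_fun [set: measurableTypeR R] (w : R -> R) by exact: Lspace_measurable.
have mu_ : measurable_fun [set: measurableTypeR R] (u j : R -> R) by exact: Lspace_measurable.
have mG_ : measurable_fun [set: measurableTypeR R] (Gp t u j : R -> R) by exact: Lspace_measurable.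
pose h x := 2 `^ (p + 1) * (`|(u j : R -> R) x| `^ (p + 1) + `|(Gp t u j : R -> R) x| `^ (p + 1)).
have ih : mu.-integrable setT (EFin \o h).
  have := integrableZl measurableT (2 `^ (p + 1)) (integrableD measurableT (iq j) iG).
  exact: eq_integrable.
have wh : {ae mu, forall x, `|(w : R -> R) x| `^ (p + 1) <= h x}.
  by apply: ae_impl wE => x -> //; exact: powR_distr.
have iwq : mu.-integrable setT (EFin \o (fun x => `|(w : R -> R) x| `^ (p + 1))).
  apply: (@integrable_le _ _ _ mu _ h) => //; first exact: measurable_powR_norm.
  by apply: ae_impl wh => x; rewrite [X in _ -> X <= _]ger0_norm ?powR_ge0.
have wqD : \int[mu]_x `|(w : R -> R) x| `^ (p + 1) <= D.
  apply: (le_trans (ae_le_Rintegral iwq ih wh)).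
  rewrite RintegralZl//; last first.
    by have := integrableD measurableT (iq j) iG; apply: eq_integrable.
  rewrite RintegralD// ler_wpM2l ?powR_ge0// addrC lerD//.
  rewrite /S (bigD1 j)//= inclE lerDl sumr_ge0// => i _.
  by apply: Rintegral_ge0 => x _; exact: powR_ge0.
have w1 : \int[mu]_x `|(w : R -> R) x| <= e1 `^ p / 2 / M `^ (p - 1).
  rewrite -[X in X <= _](L1_normE (to_L1 w)) (le_trans _ (ltW hd))//.
  rewrite -restricted_semigroupE ?(ltW t0)// -inclB.
  by have := comp_le (incl (u - Gp t u)) j; rewrite inclE.
have iw1 := integrable_norm (L1_integrable (to_L1 w)).
have i1 : mu.-integrable setT (EFin \o (fun x => M `^ (p - 1) * `|(w : R -> R) x|)).
  by have := integrableZl measurableT (M `^ (p - 1)) iw1; apply: eq_integrable.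
have i2 : mu.-integrable setT (EFin \o (fun x => M^-1 * `|(w : R -> R) x| `^ (p + 1))).
  by have := integrableZl measurableT M^-1 iwq; apply: eq_integrable.
apply: (@le_trans _ _ (\int[mu]_x (M `^ (p - 1) * `|(w : R -> R) x| + M^-1 * `|(w : R -> R) x| `^ (p + 1)))).
  apply: le_Rintegral => //.
  - exact: Lp_integrable.
  - by have := integrableD measurableT i1 i2; apply: eq_integrable.
  - by move=> x _; exact: powR_interp.
rewrite RintegralD// RintegralZl// RintegralZl// [leRHS](splitr (e1 `^ p)) lerD//.
  by rewrite mulrC -ler_pdivlMr.
by apply: le_trans DM; rewrite ler_wpM2l// invr_ge0 ltW.
Unshelve. all: by end_near. Qed.

Let truncation u (e : R) : 0 < e -> exists2 v : Xp,
  forall j, mu.-integrable setT (EFin \o (fun x => `|(v j : R -> R) x| `^ (p + 1))) & `|u - v| <= e.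
Proof.
move=> e0; have q1 : 1 < p + 1 by rewrite ltrDr.
pose e1 := e / (2 * m).+1%:R; have e10 : 0 < e1 by rewrite divr_gt0.
(* Clipping to [-n, n]: the result is bounded, so all its positive powers are integrable, and since
   |a - tr n a| <= |a|, the error is dominated by |u|^p. *)
pose tr (n : nat) (a : R) : R := Num.max (- n%:R) (Num.min a n%:R).
have tr_cont n : continuous (tr n).
  move=> x; apply: (@continuous_max R R (cst (- n%:R)) (fun x => Num.min x n%:R)); first exact: cvg_cst.
  by apply: (@continuous_min R R id (cst n%:R)); [exact: cvg_id|exact: cvg_cst].
have tr_le n a : `|tr n a| <= n%:R.
  have n0 : 0 <= n%:R :> R by [].
  rewrite /tr ler_norml le_max lexx/= ge_max ge_min lexx orbT andbT.
  lra.
have tr_id (n : nat) (a : R) : `|a| <= n%:R -> tr n a = a.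
  by rewrite ler_norml => /andP[h1 h2]; rewrite /tr min_l// max_r.
have tr_dist (n : nat) (a : R) : `|a - tr n a| <= `|a|.
  have n0 : 0 <= n%:R :> R by [].
  rewrite /tr; case: (leP a n%:R) => h1; case: (leP (- n%:R) _) => h2.
  - by rewrite subrr normr0.
  - by rewrite !ler0_norm; lra.
  - by rewrite !ger0_norm; lra.
  - lra.
have comp j : exists v : LspaceType mu p1,
    mu.-integrable setT (EFin \o (fun x => `|(v : R -> R) x| `^ (p + 1))) /\ `|u j - v| <= e1.
  have mu_ : measurable_fun [set: measurableTypeR R] (u j : R -> R) by exact: Lspace_measurable.
  have mtr n : measurable_fun [set: measurableTypeR R] (fun x => tr n ((u j : R -> R) x)).
    by apply: measurableT_comp => //; exact: continuous_measurable_fun.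
  have itr (n : nat) (q : R) : 0 < q ->
      mu.-integrable setT (EFin \o (fun x => `|tr n ((u j : R -> R) x)| `^ q)).
    move=> q0; have cn : continuous (fun _ : R => n%:R `^ q : R) by move=> x; exact: cvg_cst.
    apply: (@integrable_le _ _ _ mu _ (fun=> n%:R `^ q)).
    - exact: measurable_powR_norm.
    - exact: (integrable_mu01_continuous cn).
    - apply: nearW => x; rewrite ger0_norm ?powR_ge0//.
      by apply: ge0_ler_powR; rewrite ?nnegrE ?(ltW q0).
  have lim : \int[mu]_x (`|(u j : R -> R) x - tr n ((u j : R -> R) x)| `^ p) @[n --> \oo] -->
      \int[mu]_x (fun=> 0 : R) x.
    apply: (@Rintegral_dominated _ _ _ mu
      (fun n x => `|(u j : R -> R) x - tr n ((u j : R -> R) x)| `^ p) _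
      (fun x => `|(u j : R -> R) x| `^ p)).
    - by move=> n; apply: measurable_powR_norm; exact: measurable_funB.
    - exact: measurable_cst.
    - exact: Lp_integrable.
    - apply: nearW => x; apply: cvg_trans (@cvg_cst R 0 nat \oo _); apply: near_eq_cvg.
      near=> n; rewrite tr_id ?subrr ?normr0 ?powR0 ?gt_eqF//.
      rewrite (le_trans (ltW (truncnS_gt _)))// ler_nat; near: n; exact: nbhs_infty_ge.
    - apply: nearW => x n; rewrite ger0_norm ?powR_ge0//.
      by apply: ge0_ler_powR; rewrite ?nnegrE ?(ltW p0).
  rewrite Rintegral_cst// mul0r in lim.
  have /cvgrPdist_lt/(_ (e1 `^ p))[|n _ /(_ n (leqnn _))] := lim; first by rewrite powR_gt0.
  rewrite sub0r normrN => hn.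
  have i1 : mu.-integrable setT (EFin \o (fun x => tr n ((u j : R -> R) x))).
    apply: (@integrable_le _ _ _ mu _ (fun x => `|tr n ((u j : R -> R) x)| `^ 1)) => //.
      exact: itr.
    by apply: nearW => x; rewrite powRr1.
  have [v' v'E] := L1_class i1.
  have iv' q : 0 < q -> mu.-integrable setT (EFin \o (fun x => `|(v' : R -> R) x| `^ q)).
    move=> q0; apply: ae_eq_integrable (itr n q q0).
    - exact: measurable_powR_norm.
    - by apply: measurable_powR_norm; exact: Lspace_measurable.
    - by apply: ae_impl v'E => x h Dx; rewrite h.
  have [v vE] := Lp_of_L1 p1 (iv' p p0).
  have vv' : (v : R -> R) = v' by rewrite -vE.
  exists v; split.
    by rewrite vv'; apply: iv'; rewrite addr_gt0.
  apply: (Lp_norm_le p1'); first exact: ltW.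
  apply: le_trans (ltW (le_lt_trans (ler_norm _) hn)).
  rewrite le_eqVlt; apply/orP; left; apply/eqP; apply: ae_eq_Rintegral.
  - by apply: measurable_powR_norm; exact: Lspace_measurable.
  - by apply: measurable_powR_norm; exact: measurable_funB.
  - have e1' := LspaceBE (u j) v; apply: ae_impl2 e1' v'E => x h1 h2 Dx.
    by rewrite h1// vv' h2.
have /choice[v hv] := comp.
exists [ffun j => v j] => [j|]; first by rewrite ffunE; exact: (hv j).1.
apply: (@le_trans _ _ ((2 * m)%:R * e1)).
  by apply: norm_le_comp => j; rewrite !ffunE; exact: (hv j).2.
by rewrite /e1 mulrCA ger_pMr// ler_pdivrMr// mul1r ler_nat.
Unshelve. all: by end_near. Qed.

Let subr_split (V : zmodType) (x y gx gy : V) :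
  x - gx = (x - y) + (y - gy) - (gx - gy).
Proof. by rewrite addrA subrK opprB addrA subrK. Qed.

Let Gp_cvg u : Gp t u @[t --> 0^'+] --> u.
Proof.
have [K K0 hK] := Gp_bound 1.
have arith (a b d f e : R) : d < e / 2 -> f <= K * b -> (K + 1) * b <= e / 2 ->
    a <= b + d + f -> a < e by move=> *; lra.
apply/cvgrPdist_lt => e e0.
have D0 : 0 < K + 1 by rewrite addr_gt0.
have [|v iv uv] := @truncation u (e / 2 / (K + 1)); first by rewrite !divr_gt0.
have e2 : 0 < e / 2 by rewrite divr_gt0.
have /cvgrPdist_lt/(_ _ e2) hv := bounded_cvg iv.
near=> t.
have t0 : 0 < t by near: t; exact: nbhs_right_gt.
have t1 : t <= 1 by near: t; apply: nbhs_right_le.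
have h1 : `|v - Gp t v| < e / 2 by near: t.
have t01 : 0 <= t <= 1 by rewrite ltW.
have h2 : `|Gp t (u - v)| <= K * `|u - v| by exact: hK.
rewrite (subr_split u v (Gp t u) (Gp t v)) -GpB ?(ltW t0)//.
apply: (arith _ _ _ _ _ h1 h2); first by rewrite mulrC -ler_pdivlMr.
rewrite (le_trans (ler_normB _ _))// lerD2r; exact: ler_normD.
Unshelve. all: by end_near. Qed.

Lemma restricted_semigroup_C0 : C0_semigroup Gp.
Proof.
have [_ G0 Ga _] := GC; split.
- move=> t t0; split; first exact: GpL.
  have [K _ hK] := Gp_bound t.
  by apply: (@linear_le_continuous _ _ _ K (GpL t0)) => u; apply: hK; rewrite t0 lexx.
- by move=> u; apply: incl_inj; rewrite restricted_semigroupE// G0.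
- move=> s t s0 t0 u; apply: incl_inj.
  by rewrite /= !restricted_semigroupE ?addr_ge0// Ga.
- exact: Gp_cvg.
Qed.

Let mean_const (V : lmodType R) (v : V) n : v = n.+1%:R^-1 *: (v *+ n.+1).
Proof. by rewrite -[v *+ _]scaler_nat scalerA mulVf ?scale1r. Qed.

Let rescale_dist (V : normedModType R) (S D v : V) (t a e : R) : 0 < t ->
  `|(t / a) *: S - D| <= t * e -> `|t^-1 *: D - v - (a^-1 *: S - v)| <= e.
Proof.
move=> t0 h; rewrite opprB addrA subrK distrC -(ler_pM2l t0).
rewrite -[X in X * `|_|](gtr0_norm t0) -normrZ scalerBr !scalerA.
by rewrite divff ?gt_eqF// scale1r.
Qed.

(** One inclusion only uses that X_p embeds boundedly in X_1. In the other, the Riemann means of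
    [Gp] lie in X_p, so they carry the L^p information that the L^1 limit of the difference
    quotients lacks. *)
Lemma restricted_generator : generator Gp = part incl (generator G).
Proof.
apply/seteqP; split=> -[u v]; rewrite /generator /part /=.
- move=> /cvgrPdist_lt uv; apply/cvgrPdist_lt => e e0.
  have e2 : 0 < e / 2 by rewrite divr_gt0.
  near=> t.
  have t0 : 0 <= t by near: t; exact: nbhs_right_ge.
  have h : `|v - t^-1 *: (Gp t u - u)| < e / 2 by near: t; exact: uv.
  have -> : incl v - t^-1 *: (G t (incl u) - incl u) = incl (v - t^-1 *: (Gp t u - u)).
    by rewrite inclB inclZ inclB restricted_semigroupE.
  rewrite (le_lt_trans (incl_norm _))// mulrC -ltr_pdivlMr//.
- move=> uv.
  apply/cvgrPdist_lt => e e0.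
  pose e1 := e / (2 * m).+1%:R; have e10 : 0 < e1 by rewrite divr_gt0.
  have /cvgrPdist_lt/(_ e1 e10)[d /= d0 hd] := @Gp_cvg v.
  have hd' s : 0 <= s < d -> `|Gp s v - v| <= e1.
    move=> /andP[]; rewrite le_eqVlt => /predU1P[<- _|s0 sd].
      have -> : Gp 0 v = v.
        by have [_ G0 _ _] := GC; apply: incl_inj; rewrite restricted_semigroupE// G0.
      by rewrite subrr normr0 ltW.
    by rewrite distrC ltW//; apply: hd => //=; rewrite sub0r normrN gtr0_norm.
  near=> t.
  have t0 : 0 < t by near: t; exact: nbhs_right_gt.
  have td : t < d by near: t; exact: nbhs_right_lt.
  apply: (@le_lt_trans _ _ ((2 * m)%:R * e1)); last first.
    by rewrite /e1 mulrCA gtr_pMr// ltr_pdivrMr// mul1r ltr_nat.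
  rewrite distrC.
  (* The accuracy t / (k + 1) becomes 1 / (k + 1) after division by t. *)
  have /choice[N hN] k : exists n : nat,
      `|(t / n.+1%:R) *: (\sum_(i < n.+1) G (i%:R * (t / n.+1%:R)) (incl v)) -
        (G t (incl u) - incl u)| <= t * k.+1%:R^-1.
    apply: (semigroup_riemann_sum GC (@X1_rapid_complete R m) uv (ltW t0)).
    by rewrite mulr_gt0// invr_gt0.
  (* All times in the mean are below t < d, so each term is within e1 of v in X_p, and so is the
     mean, for every k. *)
  pose z k := (N k).+1%:R^-1 *: (\sum_(i < (N k).+1) Gp (i%:R * (t / (N k).+1%:R)) v) - v.
  have ti k (i : 'I_(N k).+1) : 0 <= i%:R * (t / (N k).+1%:R) < d.
    rewrite mulr_ge0 ?divr_ge0 ?(ltW t0)//= (le_lt_trans _ td)//.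
    by rewrite mulrCA ger_pMr// ler_pdivrMr// mul1r ler_nat ltnW.
  apply: (@incl_lsc z) => //; first exact: ltW.
  + move=> k.
    have -> : z k = (N k).+1%:R^-1 *: (\sum_(i < (N k).+1) (Gp (i%:R * (t / (N k).+1%:R)) v - v)).
      rewrite sumrB sumr_const card_ord scalerBr /z; congr (_ - _).
      exact: mean_const.
    rewrite normrZ ger0_norm ?invr_ge0//.
    rewrite ler_pdivrMl// (le_trans (ler_norm_sum _ _ _))//.
    rewrite (le_trans (ler_sum _ (fun i _ => hd' _ (ti k i))))//.
    by rewrite sumr_const card_ord mulr_natl.
  + apply/cvgrPdist_le => e' e'0.
    have /cvgrPdist_lt/(_ _ e'0) := @cvg_harmonic R; apply: filterS => k.
    rewrite sub0r normrN ger0_norm ?invr_ge0// => hk.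
    apply: le_trans (ltW hk).
    have inclS k' (F : 'I_k' -> Xp) : incl (\sum_i F i) = \sum_i incl (F i).
      apply: (big_morph incl inclD).
      by apply/ffunP => j; rewrite !ffunE; exact: val_inj.
    rewrite /z !inclB !inclZ inclS inclB restricted_semigroupE ?(ltW t0)//.
    under eq_bigr => i _.
      rewrite restricted_semigroupE; last by have /andP[] := ti k i.
      over.
    have := hN k; set S := \sum_(i < _) _; set D := G t (incl u) - incl u => hS.
    exact: rescale_dist t0 hS.
Unshelve. all: by end_near. Qed.

End Lp_semigroup.

Theorem theorem4p11 (R : realType) (m mp : nat) (hmp : (mp <= 2 * m)%N)
    (c : 'I_(2 * m) -> R -> R)
    (c_cont : forall j, {within `[0, 1], continuous (c j)})
    (c_pos : forall j (x : R), x \in `[0, 1] -> 0 < c j x)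
    (B : 'M[R]_(2 * m))
    (G1 : R -> X1 R m -> X1 R m)
    (G1_C0 : C0_semigroup G1)
    (G1_gen : generator G1 = transport_operator mp c B)
    (p : R) (p1 : (1 <= p%:E)%E) :
  exists Gp : R -> Xspace m p1 -> Xspace m p1,
    [/\ forall t u, 0 <= t -> X_incl (Gp t u) = G1 t (X_incl u),
        C0_semigroup Gp
      & generator Gp = part (@X_incl R m p%:E p1) (transport_operator mp c B)].
Proof.
(* For p = 1 the inclusion is the identity, once the two proofs of 1 <= 1 are identified, and G1
   itself is the witness. The truncated powers require p > 1. *)
have := p1; rewrite lee_fin le_eqVlt => /predU1P[p1E|p1'].
  subst p; have p1E : p1 = lexx 1%E by exact: bool_irrelevance.
  subst p1.
  have inclid u : @X_incl R m 1%E (lexx 1%E) u = u.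
    by apply/ffunP => j; rewrite ffunE; exact: val_inj.
  exists G1; split=> [t u _||]; [by rewrite !inclid|exact: G1_C0|].
  by rewrite G1_gen; apply/seteqP; split=> -[u v]; rewrite /part/= !inclid.
exists (restricted_semigroup G1 (p1 := p1)); split.
- by move=> t u t0; exact: (restricted_semigroupE c_cont c_pos G1_C0 G1_gen p1' u t0).
- exact: (restricted_semigroup_C0 c_cont c_pos G1_C0 G1_gen p1 p1').
- by rewrite (restricted_generator c_cont c_pos G1_C0 G1_gen p1 p1') G1_gen.
Qed.
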